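(* Let $\mathcal{X}$ and $\mathcal{Y}$ be schemes of finite type over $\mathrm{Spec}\ \mathbb{Z}$ and let $\alpha: \mathcal{Y} \to \mathcal{X}$ be a finite map. For a prime $p$ write $\mathcal{X}(p) = \mathcal{X} \times \mathrm{Spec}\ \mathbb{F}_p$, $\mathcal{Y}(p) = \mathcal{Y} \times \mathrm{Spec}\ \mathbb{F}_p$, and let $\alpha_p : \mathcal{Y}(p) \to \mathcal{X}(p)$ be the restriction of $\alpha$. Then there is a positive integer $N$ such that the following holds for every prime $p > N$: if $\phi$ and $\psi$ are any Frobenius splittings on $\mathcal{X}(p)$ and $\mathcal{Y}(p)$ respectively such that $\alpha_p$ is compatible with $\phi$ and $\psi$, and $V$ is any compatibly split subvariety of $(\mathcal{X}(p), \phi)$, then the reduction $\alpha_p^{-1}(V)^{\mathrm{red}}$ is a compatibly split subvariety of $(\mathcal{Y}(p), \psi)$.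
   Context: Let $X$ be a scheme over $\mathbb{F}_p$ with structure sheaf $\mathcal{O}_X$. A Frobenius splitting on $X$ is a map of sheaves $\phi : \mathcal{O}_X \to \mathcal{O}_X$ such that $\phi(a+b) = \phi(a) + \phi(b)$, $\phi(a^p b) = a\,\phi(b)$ and $\phi(1) = 1$ for all sections $a, b$ of $\mathcal{O}_X$ on any open set. A (closed, reduced, possibly reducible) subvariety $Z$ of $X$ with ideal sheaf $\mathcal{I}_Z$ is compatibly split in $(X,\phi)$ if $\phi$ descends to a splitting on $Z$; equivalently, $\phi(\mathcal{I}_Z) \subseteq \mathcal{I}_Z$. If $\phi$ is a splitting on $X$ and $\psi$ a splitting on $Y$, a finite map $\beta : Y \to X$ of $\mathbb{F}_p$-schemes is compatible with $\phi$ and $\psi$ if $\psi(\beta^*(a)) = \beta^*(\phi(a))$ for all sections $a$ of $\mathcal{O}_X$. For a closed subvariety $V \subseteq X$, $\beta^{-1}(V)$ is the scheme-theoretic preimage, and $\beta^{-1}(V)^{\mathrm{red}}$ is the associated reduced closed subscheme of $Y$. *)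

(* Defs.v *)
From HB Require Import structures.
From mathcomp Require Import all_boot all_order all_algebra.
From mathcomp Require Import boolp classical_sets topology.

Set Implicit Arguments.
Unset Strict Implicit.
Unset Printing Implicit Defensive.

Import GRing.Theory.
Local Open Scope classical_set_scope.
Local Open Scope ring_scope.

(* Rings may be zero (comPzRingType): the sections over the empty set form
   the zero ring. *)
Definition invertible (A : comPzRingType) (a : A) : Prop :=
  exists b, a * b = 1.

Definition is_ideal (A : comPzRingType) (I : set A) : Prop :=
  [/\ I 0, forall a b, I a -> I b -> I (a + b) & forall a b, I b -> I (a * b)].

Definition prime_ideal (A : comPzRingType) (P : set A) : Prop :=
  [/\ is_ideal P, ~ P 1 & forall a b, P (a * b) -> P a \/ P b].

(* [g] exhibits [B] as the localization A_f = A[1/f]. *)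
Definition is_localization (A B : comPzRingType) (f : A) (g : A -> B) : Prop :=
  [/\ invertible (g f),
      forall b, exists (a : A) (n : nat), b * g f ^+ n = g a &
      forall a, g a = 0 -> exists n : nat, f ^+ n * a = 0].

(* [A] is a finitely generated Z-algebra: some finite subset lies in no proper
   subring. *)
Definition fg_ring (A : comPzRingType) : Prop :=
  exists (n : nat) (g : 'I_n -> A), forall S : set A,
    S 1 -> (forall a b, S a -> S b -> S (a - b)) ->
    (forall a b, S a -> S b -> S (a * b)) ->
    (forall i, S (g i)) -> forall a, S a.

Definition module_finite (A B : comPzRingType) (g : A -> B) : Prop :=
  exists (n : nat) (b : 'I_n -> B), forall s, exists c : 'I_n -> A,
    s = \sum_(i < n) g (c i) * b i.

Record opens (X : topologicalType) := Opens {
  oset :> set X;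
  opensP : open oset }.

Record ringed_space := RingedSpace {
  space :> topologicalType;
  sec : opens space -> comPzRingType;
  res : forall U V : opens space, V `<=` U -> {rmorphism sec U -> sec V};
  res_id : forall (U : opens space) (h : U `<=` U) (s : sec U), res h s = s;
  res_comp : forall (U V W : opens space)
    (hVU : V `<=` U) (hWV : W `<=` V) (hWU : W `<=` U) (s : sec U),
    res hWV (res hVU s) = res hWU s;
  sheaf_axiom : forall (I : Type) (U : I -> opens space) (V : opens space)
    (hU : forall i, U i `<=` V), V `<=` \bigcup_i U i ->
    forall s : (forall i, sec (U i)),
    (forall i j (W : opens space) (hi : W `<=` U i) (hj : W `<=` U j),
        res hi (s i) = res hj (s j)) ->
    exists! t : sec V, forall i, res (hU i) t = s i }.

(* The germ of [s] at [x] is a unit of the stalk. *)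
Definition unit_at (X : ringed_space) (U : opens X) (s : sec U) (x : X) : Prop :=
  exists (W : opens X) (h : W `<=` U), oset W x /\ invertible (res h s).

(* An isomorphism of ringed spaces from the open subspace [U] onto Spec A: a
   homeomorphism [h] from [U] onto the set of prime ideals of [A] with the
   Zariski topology (whose open sets are the unions of the basic ones
   D(f) = {P | f \notin P}), together with an identification, over A, of the
   sections on each D(f) with A_f.  The structure sheaf of Spec A is the one
   determined by its values A_f on the basis of the D(f). *)
Definition spec_chart (X : ringed_space) (U : opens X) (A : comPzRingType)
    (h : X -> set A) (theta : {rmorphism A -> sec U}) : Prop :=
  [/\ forall x, oset U x -> prime_ideal (h x),
      forall x y, oset U x -> oset U y -> h x = h y -> x = y,
      forall P, prime_ideal P -> exists2 x, oset U x & h x = P,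
      forall W : set X, W `<=` U ->
        (open W <-> exists E : set A, forall x, oset U x ->
                      (W x <-> exists2 f, E f & ~ h x f)) &
      forall (f : A) (D : opens X) (hD : D `<=` U),
        (forall x, oset U x -> (oset D x <-> ~ h x f)) ->
        is_localization f (fun a => res hD (theta a))].

Definition is_spec_on (X : ringed_space) (U : opens X) (A : comPzRingType) :
    Prop :=
  exists (h : X -> set A) (theta : {rmorphism A -> sec U}), spec_chart h theta.

Definition affine (X : ringed_space) (U : opens X) : Prop :=
  exists A : comPzRingType, is_spec_on U A.

(* Such a ringed space is automatically locally ringed. *)
Record scheme := Scheme {
  rspace :> ringed_space;
  locally_affine : forall x : rspace, exists2 U : opens rspace,
    oset U x & affine U }.

Definition whole (X : topologicalType) : opens X := Opens openT.

Definition is_spec (X : scheme) (A : comPzRingType) : Prop :=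
  is_spec_on (whole X) A.

Definition preim (X Y : topologicalType) (f : X -> Y) (hf : continuous f)
    (V : opens Y) : opens X :=
  Opens ((continuousP f).1 hf _ (opensP V)).

(* [sharp_local] says that the maps induced on stalks are local. *)
Record morphism (X Y : scheme) := Morphism {
  fmap :> X -> Y;
  fcont : continuous fmap;
  sharp : forall V : opens Y, {rmorphism sec V -> sec (preim fcont V)};
  sharp_res : forall (V V' : opens Y) (h : V' `<=` V)
    (h' : preim fcont V' `<=` preim fcont V) (s : sec V),
    sharp V' (res h s) = res h' (sharp V s);
  sharp_local : forall (V : opens Y) (s : sec V) (x : X),
    oset V (fmap x) -> unit_at (sharp V s) x -> unit_at s (fmap x) }.

Arguments fcont {X Y} m.
Arguments sharp {X Y} m V.
Arguments sharp_res {X Y} m {V V'} h h' s.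
Arguments sharp_local {X Y} m {V s x}.

Definition pre (X Y : scheme) (f : morphism X Y) (V : opens Y) : opens X :=
  preim (fcont f) V.

(* Equality of morphisms: same continuous map and same maps on sections. The
   latter are compared by restriction, because the opens [pre f V] and
   [pre g V] are only propositionally equal. *)
Definition mor_eq (X Y : scheme) (f g : morphism X Y) : Prop :=
  (forall x, f x = g x) /\
  forall (V : opens Y) (s : sec V) (W : opens X)
    (hf : W `<=` pre f V) (hg : W `<=` pre g V),
    res hf (sharp f V s) = res hg (sharp g V s).

Section Composition.
Variables (X Y Z : scheme) (g : morphism Y Z) (f : morphism X Y).

Let gf : X -> Z := g \o f.

Lemma comp_cont : continuous gf.
Proof. by move=> x; apply: continuous_comp; [exact: fcont|exact: fcont]. Qed.

Lemma comp_sub (V : opens Z) : preim comp_cont V `<=` pre f (pre g V).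
Proof. by []. Qed.

Definition comp_sharp (V : opens Z) :
    {rmorphism sec V -> sec (preim comp_cont V)} :=
  res (@comp_sub V) \o (sharp f (pre g V) \o sharp g V).

Lemma comp_sharp_res (V V' : opens Z) (h : V' `<=` V)
    (h' : preim comp_cont V' `<=` preim comp_cont V) (s : sec V) :
  comp_sharp V' (res h s) = res h' (comp_sharp V s).
Proof.
have hg : pre g V' `<=` pre g V by move=> y; exact: h.
have hf : pre f (pre g V') `<=` pre f (pre g V) by move=> x; exact: hg.
rewrite /comp_sharp /= (sharp_res g h hg) (sharp_res f hg hf).
have hW : preim comp_cont V' `<=` pre f (pre g V) by move=> x; exact: h.
by rewrite !(res_comp _ _ hW).
Qed.

Lemma comp_sharp_local (V : opens Z) (s : sec V) (x : X) :
  oset V (gf x) -> unit_at (comp_sharp V s) x -> unit_at s (gf x).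
Proof.
move=> Vx [W [hW [Wx hinv]]]; apply: (sharp_local g) => //.
apply: (sharp_local f) => //.
have hW' : W `<=` pre f (pre g V) by move=> y /hW.
exists W, hW'; split => //.
by move: hinv; rewrite /comp_sharp /= (res_comp _ _ hW').
Qed.

Definition mor_comp : morphism X Z :=
  Morphism comp_sharp_res comp_sharp_local.

End Composition.

(* [P], with projections [p1] and [p2], is the product of [X] and [Y] in the
   category of schemes, i.e. the fibre product over the terminal object
   Spec Z. *)
Definition is_product (X Y P : scheme) (p1 : morphism P X) (p2 : morphism P Y) :
    Prop :=
  forall (T : scheme) (f : morphism T X) (g : morphism T Y),
  exists u : morphism T P,
    [/\ mor_eq (mor_comp p1 u) f, mor_eq (mor_comp p2 u) g &
        forall v : morphism T P, mor_eq (mor_comp p1 v) f ->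
          mor_eq (mor_comp p2 v) g -> mor_eq v u].

(* Finite type over Spec Z; the structure morphism to Spec Z is unique. *)
Definition finite_type_Z (X : scheme) : Prop :=
  exists (n : nat) (U : 'I_n -> opens X),
    (forall x, exists i, oset (U i) x) /\
    forall i, exists2 A : comPzRingType, is_spec_on (U i) A & fg_ring A.

Definition finite_morphism (X Y : scheme) (f : morphism X Y) : Prop :=
  forall y : Y, exists V : opens Y,
    [/\ oset V y, affine V, affine (pre f V) & module_finite (sharp f V)].

(* A closed subscheme of [X] is given by its quasi-coherent ideal sheaf. *)
Definition subsheaf (X : scheme) := forall U : opens X, set (sec U).

Definition ideal_sheaf (X : scheme) (I : subsheaf X) : Prop :=
  [/\ forall U, is_ideal (I U),
      forall (U V : opens X) (h : V `<=` U) (s : sec U),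
        I U s -> I V (res h s) &
      forall (U : opens X) (s : sec U),
        (forall x, oset U x ->
          exists (W : opens X) (h : W `<=` U), oset W x /\ I W (res h s)) ->
        I U s].

(* Locally on affine opens [U], I(D(f)) = I(U)_f for every f in O(U), so that I
   is the sheaf associated with the O(U)-module I(U). *)
Definition quasi_coherent (X : scheme) (I : subsheaf X) : Prop :=
  forall x : X, exists U : opens X, [/\ oset U x, affine U &
    forall (f : sec U) (D : opens X) (hD : D `<=` U),
      (forall y, oset U y -> (oset D y <-> unit_at f y)) ->
      forall s : sec D, I D s -> exists (t : sec U) (n : nat),
        I U t /\ s * res hD f ^+ n = res hD t].

Definition closed_subscheme (X : scheme) (I : subsheaf X) : Prop :=
  ideal_sheaf I /\ quasi_coherent I.

Definition reduced (X : scheme) (I : subsheaf X) : Prop :=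
  forall (U : opens X) (s : sec U) (n : nat), I U (s ^+ n) -> I U s.

Definition subvariety (X : scheme) (I : subsheaf X) : Prop :=
  closed_subscheme I /\ reduced I.

(* The scheme-theoretic preimage: the ideal sheaf f^{-1}(I) . O_Y, the image of
   f^*(I) in O_Y. *)
Definition scheme_preimage (Y X : scheme) (f : morphism Y X) (I : subsheaf X) :
    subsheaf Y :=
  fun U => [set s | forall y, oset U y ->
    exists (W : opens Y) (hW : W `<=` U) (V : opens X) (hV : W `<=` pre f V),
      oset W y /\
      exists (n : nat) (a : 'I_n -> sec V) (b : 'I_n -> sec W),
        (forall i, I V (a i)) /\
        res hW s = \sum_(i < n) res hV (sharp f V (a i)) * b i].

(* The ideal sheaf of the associated reduced closed subscheme. *)
Definition red (X : scheme) (I : subsheaf X) : subsheaf X :=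
  fun U => [set s | forall x, oset U x ->
    exists (W : opens X) (hW : W `<=` U) (n : nat),
      oset W x /\ I W (res hW s ^+ n)].

Definition sheaf_endo (X : scheme) := forall U : opens X, sec U -> sec U.

Definition frobenius_splitting (p : nat) (X : scheme) (phi : sheaf_endo X) :
    Prop :=
  [/\ forall (U V : opens X) (h : V `<=` U) (s : sec U),
        phi V (res h s) = res h (phi U s),
      forall (U : opens X) (a b : sec U), phi U (a + b) = phi U a + phi U b,
      forall (U : opens X) (a b : sec U), phi U (a ^+ p * b) = a * phi U b &
      forall U : opens X, phi U 1 = 1].

Definition compatibly_split (X : scheme) (phi : sheaf_endo X) (I : subsheaf X) :
    Prop :=
  subvariety I /\ forall (U : opens X) (s : sec U), I U s -> I U (phi U s).

Definition compatible (Y X : scheme) (f : morphism Y X)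
    (psi : sheaf_endo Y) (phi : sheaf_endo X) : Prop :=
  forall (U : opens X) (a : sec U),
    psi (pre f U) (sharp f U a) = sharp f U (phi U a).

(* Main.v *)
Require Import Defs.
From HB Require Import structures.
From mathcomp Require Import all_boot all_order all_algebra.
From mathcomp Require Import boolp classical_sets topology.
From mathcomp Require Import ring zify.

(* Only the number n of generators of O_Y over O_X matters: p > n suffices.

   Locally, let g : A -> B be generated by n elements, phi and psi compatible
   splittings, I a phi-stable ideal and Q a prime of B containing g(I). Let C be
   the largest psi-stable ideal inside Q; it is prime. The point is that
   g(I) lies in C: a section in every prime over g(I) then lies in C, so psi of
   it lies in C as well, hence in Q. Suppose that a in I is not in C, and let K
   be the fraction field of A / g^-1(C). The ring B / C generates a K-algebra of
   dimension d <= n < p, with a trace Tr to K. If b_1, ..., b_d is a basis, so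
   is b_1^p, ..., b_d^p (apply psi to a linear relation), and therefore
   Tr (z^p) = (Tr z)^p and Tr (psi y) = phi (Tr y). Multiplying a by a common
   denominator c, all traces of multiples of c * a are in the image of I. By
   definition of C some u = psi^e (c * a * y) is not in Q, and all the powers
   of u have their traces in the image of I. Since d < p, Newton's identities
   put the coefficients of the characteristic polynomial of u in the image of I,
   so u^d is in Q by Cayley-Hamilton, a contradiction.

   Globally, X(p) is only known through its universal property. We compare it
   with the closed subscheme p = 0 of X, whose sheaf O_X / p is constructed by
   hand; this shows that the preimage of an affine open subset W of X is affine
   and that the sections over W surject onto the sections over its preimage. *)

Set Implicit Arguments.
Unset Strict Implicit.
Unset Printing Implicit Defensive.

Import GRing.Theory.
Local Open Scope classical_set_scope.
Local Open Scope ring_scope.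

(** * Quotient rings and residue fields *)

Section Quotient.

(** The prime [Q] need not be stable under [psi], so [psi] does not act on [B] modulo [Q]; the trace
    argument needs a stable prime, which is why it is run over [core]. That the p-th powers of a
    basis form a basis again is a form of separability, forced by the splitting; for an inseparable
    extension the trace would be zero and carry no information. Traces lie in K rather than in [A],
    and no normality is available to bring them back. Hence the argument tracks membership in the
    image of [I] under [A -> K], and a single denominator [c] must serve all traces. Newton's
    identities divide by 1, ..., d: this is the only source of the bound on p. For the passage to
    schemes, a subvariety is recovered from its set of points, so that stability of the reduced
    preimage is a condition at one point at a time: [psi s] must be a non-unit wherever the points
    of [V] pull back to. The bound is uniform because a finite affine cover of X bounds the numbers
    of generators, and such generators restrict to generators over X(p). *)

Record qideal (R : comPzRingType) := QIdeal {
  qid :> set R;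
  qidP : is_ideal qid }.

Lemma idealN (R : comPzRingType) (I : set R) (a : R) :
  is_ideal I -> I a -> I (- a).
Proof. by case=> _ _ hM Ia; rewrite -mulN1r; apply: hM. Qed.

Lemma idealB (R : comPzRingType) (I : set R) (a b : R) :
  is_ideal I -> I a -> I b -> I (a - b).
Proof. by move=> hI Ia Ib; case: (hI) => _ hD _; apply: hD => //; apply: idealN. Qed.

Lemma idealMr (R : comPzRingType) (I : set R) (a b : R) :
  is_ideal I -> I a -> I (a * b).
Proof. by case=> _ _ hM Ia; rewrite mulrC; apply: hM. Qed.

Lemma ideal_sum (R : comPzRingType) (I : set R) (J : Type) (r : seq J)
    (P : pred J) (F : J -> R) :
  is_ideal I -> (forall j, P j -> I (F j)) -> I (\sum_(j <- r | P j) F j).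
Proof. by case=> h0 hD _ hF; apply: big_ind. Qed.

Variables (R : comPzRingType) (I : qideal R).

(** Choice is applied to the whole coset of [a]: congruent elements have the same coset, hence the
    same representative. The quotient is then a subtype of [R] in which congruence is plain
    equality. *)
Definition coset_repr (a : R) : R := xget 0 [set b | qid I (b - a)].

Lemma coset_reprP (a : R) : qid I (coset_repr a - a).
Proof.
rewrite /coset_repr; case: xgetP => // /(_ a) [] /=.
by rewrite subrr; case: (qidP I).
Qed.

Lemma coset_repr_eq (a b : R) : coset_repr a = coset_repr b <-> qid I (a - b).
Proof.
split=> [e|Iab].
  have := idealB (qidP I) (coset_reprP b) (coset_reprP a).
  by rewrite e opprB [_ + (a - _)]addrC addrA subrK.
rewrite /coset_repr; congr xget; apply/seteqP; split=> c /= h.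
  by case: (qidP I) => _ /(_ _ _ h Iab); rewrite addrA subrK.
by have := idealB (qidP I) h Iab; rewrite opprB addrA subrK.
Qed.

Definition quot := {a : R | coset_repr a == a}.

Lemma coset_repr_id (a : R) : coset_repr (coset_repr a) == coset_repr a.
Proof. by apply/eqP/coset_repr_eq/coset_reprP. Qed.

Definition qpi (a : R) : quot := exist _ (coset_repr a) (coset_repr_id a).

Lemma qpi_eq (a b : R) : qpi a = qpi b <-> qid I (a - b).
Proof.
rewrite -coset_repr_eq; split=> [[]//|e].
exact: val_inj.
Qed.

Lemma qpiK (x : quot) : qpi (val x) = x.
Proof. by apply: val_inj; apply/eqP; apply: (valP x). Qed.

HB.instance Definition _ := Choice.on quot.

Definition quot_add (x y : quot) := qpi (val x + val y).
Definition quot_mul (x y : quot) := qpi (val x * val y).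
Definition quot_opp (x : quot) := qpi (- val x).

Lemma quot_addE (a b : R) : quot_add (qpi a) (qpi b) = qpi (a + b).
Proof.
apply/qpi_eq; rewrite opprD addrACA.
by case: (qidP I) => _ hD _; apply: hD; apply: coset_reprP.
Qed.

Lemma quot_mulE (a b : R) : quot_mul (qpi a) (qpi b) = qpi (a * b).
Proof.
apply/qpi_eq => /=; have hI := qidP I; set a' := coset_repr a; set b' := coset_repr b.
have -> : a' * b' - a * b = (a' - a) * b' + a * (b' - b) by ring.
case: (hI) => _ hD hM; apply: hD; last by apply: hM; apply: coset_reprP.
by apply: idealMr => //; apply: coset_reprP.
Qed.

Lemma quot_oppE (a : R) : quot_opp (qpi a) = qpi (- a).
Proof.
apply/qpi_eq => /=; rewrite -opprD; apply: idealN (qidP I) _; exact: coset_reprP.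
Qed.

Lemma quotW (P : quot -> Prop) : (forall a, P (qpi a)) -> forall x, P x.
Proof. by move=> h x; rewrite -(qpiK x). Qed.

Lemma quot_addA : associative quot_add.
Proof. by elim/quotW=> a; elim/quotW=> b; elim/quotW=> c; rewrite !quot_addE addrA. Qed.
Lemma quot_addC : commutative quot_add.
Proof. by elim/quotW=> a; elim/quotW=> b; rewrite !quot_addE addrC. Qed.
Lemma quot_add0 : left_id (qpi 0) quot_add.
Proof. by elim/quotW=> a; rewrite !quot_addE add0r. Qed.
Lemma quot_addN : left_inverse (qpi 0) quot_opp quot_add.
Proof. by elim/quotW=> a; rewrite quot_oppE quot_addE addNr. Qed.
Lemma quot_mulA : associative quot_mul.
Proof. by elim/quotW=> a; elim/quotW=> b; elim/quotW=> c; rewrite !quot_mulE mulrA. Qed.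
Lemma quot_mulC : commutative quot_mul.
Proof. by elim/quotW=> a; elim/quotW=> b; rewrite !quot_mulE mulrC. Qed.
Lemma quot_mul1 : left_id (qpi 1) quot_mul.
Proof. by elim/quotW=> a; rewrite !quot_mulE mul1r. Qed.
Lemma quot_mulD : left_distributive quot_mul quot_add.
Proof.
elim/quotW=> a; elim/quotW=> b; elim/quotW=> c.
by rewrite !(quot_addE, quot_mulE) mulrDl.
Qed.

HB.instance Definition _ := GRing.isZmodule.Build quot
  quot_addA quot_addC quot_add0 quot_addN.
HB.instance Definition _ := GRing.Zmodule_isComPzRing.Build quot
  quot_mulA quot_mulC quot_mul1 quot_mulD.

Lemma qpi_zmod : zmod_morphism qpi.
Proof. by move=> a b; rewrite -quot_addE -quot_oppE. Qed.
Lemma qpi_monoid : monoid_morphism qpi.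
Proof. by split=> [//|a b]; rewrite -quot_mulE. Qed.

HB.instance Definition _ := GRing.isZmodMorphism.Build R quot qpi qpi_zmod.
HB.instance Definition _ := GRing.isMonoidMorphism.Build R quot qpi qpi_monoid.

Lemma qpi_eq0 (a : R) : qpi a = 0 <-> qid I a.
Proof. by rewrite -[0]/(qpi 0) qpi_eq subr0. Qed.

Section Lift.
Variables (S : comPzRingType) (f : {rmorphism R -> S}).
Hypothesis f0 : forall a, qid I a -> f a = 0.

Definition quot_lift (x : quot) : S := f (val x).

Lemma quot_liftE (a : R) : quot_lift (qpi a) = f a.
Proof.
by apply/eqP; rewrite -subr_eq0 -rmorphB; apply/eqP/f0/coset_reprP.
Qed.

Lemma quot_lift_zmod : zmod_morphism quot_lift.
Proof.
elim/quotW=> a; elim/quotW=> b.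
by rewrite -rmorphB !quot_liftE rmorphB.
Qed.

Lemma quot_lift_monoid : monoid_morphism quot_lift.
Proof.
split; first by rewrite -[1]/(qpi 1) quot_liftE rmorph1.
elim/quotW=> a; elim/quotW=> b.
by rewrite -rmorphM !quot_liftE rmorphM.
Qed.
End Lift.

Lemma quot_liftP (S : comPzRingType) (f : {rmorphism R -> S}) :
  (forall a, qid I a -> f a = 0) ->
  exists F : {rmorphism quot -> S}, forall a, F (qpi a) = f a.
Proof.
move=> f0.
pose z := GRing.isZmodMorphism.Build _ _ _ (quot_lift_zmod f0).
pose m := GRing.isMonoidMorphism.Build _ _ _ (quot_lift_monoid f0).
pose F : {rmorphism quot -> S} := HB.pack (quot_lift f) z m.
by exists F => a; apply: quot_liftE.
Qed.

End Quotient.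

Lemma fraction_numden (D : idomainType) (x : {fraction D}) :
  exists n d : D, d != 0 /\ x * FracField.tofrac d = FracField.tofrac n.
Proof.
elim/quotP: x => r <-; exists (\n_r), (\d_r); split; first exact: denom_ratioP.
unlock FracField.tofrac; rewrite -[LHS]FracField.pi_mul; apply/eqmodP => /=.
rewrite FracField.equivfE /FracField.mulf /= !numden_Ratio.
  by rewrite !mulr1 FracField.equivf_l.
all: by rewrite ?mulf_neq0 ?oner_neq0 ?denom_ratioP.
Qed.

Section ResidueField.

Variables (A : comPzRingType) (P : set A) (hP : prime_ideal P).

Let I : qideal A := QIdeal (let: And3 h _ _ := hP in h).

(** An alias of the quotient that carries the primality proof, so that the structure of an integral
    domain can be attached to it. *)
Definition quot_dom of prime_ideal P := quot I.
Local Notation D := (quot_dom hP).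
HB.instance Definition _ := GRing.ComPzRing.on D.

Lemma quot_dom1 : (1 : D) != 0.
Proof. by apply/eqP => /(@qpi_eq0 _ I) /=; case: hP. Qed.
HB.instance Definition _ := GRing.PzSemiRing_isNonZero.Build D quot_dom1.

Definition quot_dom_unit : pred D := fun x => `[< exists y, y * x = 1 >].
Definition quot_dom_inv (x : D) : D := xget x [set y | y * x = 1].

Lemma quot_dom_mulV : {in quot_dom_unit, left_inverse 1 quot_dom_inv *%R}.
Proof.
move=> x /asboolP [y hy]; rewrite /quot_dom_inv; case: xgetP => // /(_ y) [].
exact: hy.
Qed.
Lemma quot_dom_unitP (x y : D) : y * x = 1 -> quot_dom_unit x.
Proof. by move=> h; apply/asboolP; exists y. Qed.
Lemma quot_dom_inv_out : {in [predC quot_dom_unit], quot_dom_inv =1 id}.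
Proof.
move=> x /asboolPn h; rewrite /quot_dom_inv; case: xgetP => // y _ hy.
by case: h; exists y.
Qed.
HB.instance Definition _ := GRing.ComNzRing_hasMulInverse.Build D
  quot_dom_mulV quot_dom_unitP quot_dom_inv_out.

Lemma quot_dom_integral : GRing.integral_domain_axiom D.
Proof.
move=> x y; rewrite -(@qpiK _ I x) -(@qpiK _ I y); move: (val x) (val y) => a b.
rewrite -[X in X = 0 -> _](@rmorphM _ _ (@qpi _ I)) => /qpi_eq0 /= hab.
have [_ _ /(_ _ _ hab)] := hP; case=> [/(@qpi_eq0 _ I) h|/(@qpi_eq0 _ I) h]; apply/orP.
  by left; apply/eqP.
by right; apply/eqP.
Qed.
HB.instance Definition _ := GRing.ComUnitRing_isIntegral.Build D quot_dom_integral.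

Lemma residue_field : exists (K : fieldType) (k : {rmorphism A -> K}),
  (forall a, k a = 0 <-> P a) /\
  forall x : K, exists a b : A, ~ P b /\ x * k b = k a.
Proof.
exists {fraction D}, (@FracField.tofrac D \o (@qpi _ I : {rmorphism A -> D})).
split=> [a|x] /=.
  split=> [/eqP|h]; first by rewrite tofrac_eq0 => /eqP /(@qpi_eq0 _ I).
  by have /(@qpi_eq0 _ I) -> : qid I a by []; rewrite rmorph0.
have [n [d [d0 hx]]] := fraction_numden x.
exists (val n), (val d); split.
  by move=> /(@qpi_eq0 _ I); rewrite qpiK => e; rewrite e eqxx in d0.
by rewrite !(@qpiK _ I).
Qed.
End ResidueField.

(** * Newton's identities *)

Section NewtonIdentities.

Lemma deriv_prod (R : comNzRingType) (I : finType) (F : I -> {poly R}) :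
  (\prod_i F i)^`() = \sum_i \prod_j (if j == i then (F j)^`() else F j).
Proof.
have gen (r : seq I) : uniq r -> (\prod_(i <- r) F i)^`() =
    \sum_(i <- r) \prod_(j <- r) (if j == i then (F j)^`() else F j).
  elim: r => [|a r IH] /=; first by rewrite !big_nil derivC.
  case/andP=> ar ur; rewrite !big_cons eqxx derivM; congr (_ * _ + _).
    apply: eq_big_seq => j jr; case: eqP => // e; by rewrite -e jr in ar.
  rewrite (IH ur) big_distrr /=; apply: eq_big_seq => i ir; rewrite big_cons.
  by case: eqP => // e; rewrite e ir in ar.
by rewrite gen ?index_enum_uniq.
Qed.

Lemma deriv_det (R : comNzRingType) n (A : 'M[{poly R}]_n) :
  (\det A)^`() = \sum_i \sum_j (A i j)^`() * cofactor A i j.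
Proof.
pose B i : 'M[{poly R}]_n :=
  \matrix_(k, l) (if k == i then (A k l)^`() else A k l).
transitivity (\sum_i \det (B i)).
  rewrite /determinant raddf_sum exchange_big /=; apply: eq_bigr => s _.
  rewrite -big_distrr /= -(rmorph_sign polyC) deriv_mulC deriv_prod.
  congr (_ * _); apply: eq_bigr => i _; apply: eq_bigr => j _.
  by rewrite mxE.
apply: eq_bigr => i _; rewrite (expand_det_row _ i); apply: eq_bigr => j _.
rewrite mxE eqxx; congr (_ * (_ * \det _)); apply/matrixP => k l.
by rewrite !mxE eq_sym (negPf (neq_lift _ _)).
Qed.

(** Jacobi's formula: only the diagonal entries of [X - M] have a nonzero derivative, namely 1, and
    each picks out a diagonal cofactor. *)
Lemma deriv_char_poly (R : comNzRingType) n (M : 'M[R]_n) :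
  (char_poly M)^`() = \tr (\adj (char_poly_mx M)).
Proof.
rewrite /char_poly deriv_det; apply: eq_bigr => i _.
rewrite (bigD1 i) //= big1 ?addr0 => [|j ji]; rewrite !mxE derivB derivC subr0.
  by rewrite eqxx mulr1n derivX mul1r.
by rewrite eq_sym (negPf ji) mulr0n derivC mul0r.
Qed.

Lemma char_poly_sum (R : comNzRingType) n (M : 'M[R]_n.+1) :
  \sum_(i < n.+2) (char_poly M)`_i *: M ^+ i = 0.
Proof.
rewrite -[RHS](Cayley_Hamilton M) -[in RHS](coefK (char_poly M)) poly_def.
rewrite size_char_poly rmorph_sum /=; apply: eq_bigr => i _.
by rewrite linearZ /= rmorphXn /= horner_mx_X.
Qed.

Lemma char_poly_def (R : comNzRingType) n (M : 'M[R]_n.+1) :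
  char_poly M = \sum_(i < n.+2) ((char_poly M)`_i)%:P * 'X^i.
Proof.
rewrite -[LHS]coefK poly_def size_char_poly.
by apply: eq_bigr => i _; rewrite mul_polyC.
Qed.

(** With chi the characteristic polynomial and c_i its coefficients, chi(M) = 0 gives chi(X) as the
    sum of the c_i (X^i - M^i), and each difference is X - M times a geometric sum. So the
    right-hand side [R] satisfies (X - M) R = chi(X). *)
Lemma adj_char_poly_mx (K : idomainType) n (M : 'M[K]_n.+1) :
  \adj (char_poly_mx M) =
  \sum_(i < n.+2) ((char_poly M)`_i)%:P *:
     \sum_(j < i) 'X^(i.-1 - j) *: map_mx polyC (M ^+ j).
Proof.
set C := char_poly_mx M; set R := (RHS).
have CR : C *m R = (char_poly M)%:M.
  rewrite /R mulmx_sumr.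
  transitivity (\sum_(i < n.+2) (((char_poly M)`_i)%:P *:
      (('X : {poly K})%:M ^+ i - map_mx polyC (M ^+ i)) : 'M[{poly K}]_n.+1)).
    apply: eq_bigr => i _; rewrite -scalemxAr; congr (_ *: _).
    rewrite rmorphXn /= subrXX_comm; last by exact: comm_scalar_mx.
    rewrite -/C; congr (_ * _); apply: eq_bigr => j _.
    rewrite rmorphXn -mul_scalar_mx; congr (_ * _); exact: rmorphXn.
  under eq_bigr do rewrite scalerBr; rewrite sumrB.
  rewrite [X in _ - X](_ : _ = 0) ?subr0.
    rewrite [in RHS]char_poly_def.
    rewrite (raddf_sum (scalar_mx : {poly K} -> 'M_n.+1)); apply: eq_bigr => i _.
    by rewrite -rmorphXn /= -mul_scalar_mx -scalar_mxM.
  transitivity (map_mx polyC (\sum_(i < n.+2) (char_poly M)`_i *: M ^+ i)).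
    by rewrite raddf_sum; apply: eq_bigr => i _ /=; rewrite map_mxZ.
  by rewrite char_poly_sum map_mx0.
(* [X - M] is not invertible over polynomials; multiplying by its adjugate turns it into the scalar
   chi, which is monic and cancels entrywise. *)
have : char_poly M *: R = char_poly M *: \adj C.
  have := congr1 (mulmx (\adj C)) CR.
  by rewrite mulmxA mul_adj_mx mul_scalar_mx mul_mx_scalar.
move/matrixP => e; apply/matrixP => i j; move/(_ i j): e; rewrite !mxE.
by move/(mulfI (monic_neq0 (char_poly_monic M))).
Qed.

(** Compares the coefficients of X^(l-1) in [deriv_char_poly], the adjugate being expanded as above.
    For [l = 0] it is the trace of the Cayley-Hamilton relation. *)
Lemma char_poly_newton (K : idomainType) n (M : 'M[K]_n.+1) (l : nat) :
  \sum_(i < n.+2 | (l <= i)%N) (char_poly M)`_i * \tr (M ^+ (i - l)) =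
  (char_poly M)`_l *+ l.
Proof.
case: l => [|l].
  rewrite mulr0n -[RHS](@mxtrace0 _ n.+1) -(char_poly_sum M) raddf_sum /=.
  by apply: eq_bigr => i _; rewrite subn0 mxtraceZ.
rewrite -coef_deriv deriv_char_poly adj_char_poly_mx.
move: (char_poly M) => chi; rewrite raddf_sum /= coef_sum.
rewrite big_mkcond; apply: eq_bigr => i _.
rewrite mxtraceZ coefCM raddf_sum /= coef_sum.
have trE (j : 'I_i) : (\tr ('X^(i.-1 - j) *: map_mx polyC (M ^+ j)))`_l =
    if (i.-1 - j == l)%N then \tr (M ^+ j) else 0.
  rewrite mxtraceZ trace_map_mx mulrC coefCM coefXn eq_sym.
  by case: eqP; rewrite ?mulr1 ?mulr0.
rewrite (eq_bigr _ (fun j _ => trE j)).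
case: ltnP => li; last first.
  rewrite big1 ?mulr0 // => j _; case: eqP => // e.
  by have := ltn_ord j; lia.
have hj : (i - l.+1 < i)%N by lia.
rewrite (bigD1 (Ordinal hj)) //= big1 ?addr0.
  by case: eqP => // -[]; lia.
move=> j /eqP ji; case: eqP => // e; case: ji; apply: val_inj => /=.
by have := ltn_ord j; lia.
Qed.

(* By char_poly_newton, the coefficient of X^l times n + 1 - l is expressed by
   the traces of the powers of M and the higher coefficients. *)
Lemma char_poly_coef_closed (K : fieldType) n (M : 'M[K]_n.+1) (S : K -> Prop) :
  S 0 -> (forall x y, S x -> S y -> S (x + y)) ->
  (forall x y, S x -> S y -> S (x * y)) ->
  (forall k x, (0 < k <= n.+1)%N -> S x -> S (- (x / k%:R))) ->
  (forall k, (0 < k <= n.+1)%N -> k%:R != 0 :> K) ->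
  (forall k, (0 < k)%N -> S (\tr (M ^+ k))) ->
  forall l, (l < n.+1)%N -> S (char_poly M)`_l.
Proof.
move=> S0 SD SM Sdiv kn0 Str l ln.
(* Descending induction on [l], with [m] bounding [n - l]. *)
have [m lm] : exists m, (n - l < m)%N by exists (n - l).+1.
elim: m l ln lm => // m IH l ln lm.
have := char_poly_newton M l; rewrite (bigD1 (inord l)) /=; last first.
  by rewrite inordK //; lia.
rewrite inordK; last by lia.
rewrite subnn expr0 mxtrace1 => e.
have k0 : (0 < n.+1 - l <= n.+1)%N by lia.
have {}e : (char_poly M)`_l * (n.+1 - l)%:R = - \sum_(i < n.+2 | (l <= i)%N && (i != inord l))
    (char_poly M)`_i * \tr (M ^+ (i - l)).
  by rewrite natrB 1?ltnW // mulrBr (mulr_natr _ l) -e opprD addNKr.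
suff h : S (\sum_(i < n.+2 | (l <= i)%N && (i != inord l))
    (char_poly M)`_i * \tr (M ^+ (i - l))).
  have := Sdiv _ _ k0 h; rewrite -mulNr -e mulfK //; exact: kn0.
apply: big_ind => // i /andP [li /eqP il].
have {}li : (l < i)%N.
  rewrite ltn_neqAle li andbT; apply/eqP => e'; apply: il; apply: val_inj.
  by rewrite /= inordK; lia.
(* The leading coefficient 1 need not belong to [S], which will be the image of an ideal; the top
   term is a trace by itself. *)
have := ltn_ord i; rewrite ltnS leq_eqVlt => /orP [/eqP e'|lin].
  have := char_poly_monic M; rewrite monicE lead_coefE size_char_poly /=.
  by rewrite e' => /eqP ->; rewrite mul1r; apply: Str; lia.
by apply: SM; [apply: IH; lia|apply: Str; lia].
Qed.
End NewtonIdentities.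

(** * Compatible splittings of a finite ring extension *)

Section PrimeAvoidance.

Variables (A : comPzRingType).

Lemma prime_ideal_exp (P : set A) (a : A) (n : nat) :
  prime_ideal P -> P (a ^+ n) -> P a.
Proof.
case=> _ P1 hP; elim: n => [|n IH]; first by rewrite expr0.
by rewrite exprS => /hP [].
Qed.

(** An ideal maximal among those containing [J] and missing the powers of [s] is prime. In
    contrapositive form: an element of all primes over [J] has a power in [J]. *)
Lemma prime_avoiding (J : set A) (s : A) :
  is_ideal J -> (forall n, ~ J (s ^+ n)) ->
  exists P, [/\ prime_ideal P, J `<=` P & ~ P s].
Proof.
move=> hJ hs.
pose good (X : set A) := [/\ is_ideal X, J `<=` X & forall n, ~ X (s ^+ n)].
(* [Zorn_bigcup] also asks for the union of the empty chain, which is empty and not an ideal. A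
   maximal set cannot be empty, since [J] is larger. *)
pose Pr (X : set A) := X = set0 \/ good X.
have [F FP totF|X [PrX maxX]] := @Zorn_bigcup A Pr.
- case: (pselect (exists2 X, F X & good X)) => [[X0 FX0 [[z0 zD zM] JX0 sX0]]|h]; last first.
    left; apply/seteqP; split=> // a [X FX Xa].
    case: (FP X FX) => [e|gX]; first by rewrite e in Xa.
    by case: h; exists X.
  have gF X a : F X -> X a -> good X.
    by move=> FX Xa; case: (FP X FX) => // e; rewrite e in Xa.
  right; split.
  + split; first by exists X0.
    * move=> a b [X FX Xa] [Y FY Yb].
      case: (gF _ _ FX Xa) => -[_ XD _] _ _; case: (gF _ _ FY Yb) => -[_ YD _] _ _.
      case: (totF X Y FX FY) => sub.
        by exists Y => //; apply: YD => //; apply: sub.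
      by exists X => //; apply: XD => //; apply: sub.
    * move=> a b [X FX Xb]; exists X => //.
      by case: (gF _ _ FX Xb) => -[_ _ XM] _ _; apply: XM.
  + by move=> a Ja; exists X0 => //; apply: JX0.
  + by move=> n [X FX Xs]; case: (gF _ _ FX Xs) => _ _ /(_ n).
- case: PrX => [X0|[iX JX sX]].
  + exfalso; apply: (maxX J); last by right; split.
    rewrite X0; split=> // h; have [J0 _ _] := hJ; exact: (h 0 J0).
  exists X; have [X0 XD XM] := iX; have X1 : ~ X 1 by have := sX 0%N; rewrite expr0.
  split=> //; last by have := sX 1%N; rewrite expr1.
  split=> //.
  move=> a b Xab; apply: contrapT => /not_orP [Xa Xb].
  have ext (c : A) : ~ X c -> exists n r x, X x /\ s ^+ n = x + r * c.
    move=> Xc; pose Y : set A := [set y | exists x r, X x /\ y = x + r * c].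
    apply: contrapT => h; apply: (maxX Y).
      split; last by move=> YX; apply: Xc; apply: YX; exists 0, 1; rewrite add0r mul1r.
      by move=> x Xx; exists x, 0; rewrite mul0r addr0.
    right; split.
    + split; first by exists 0, 0; rewrite mul0r addr0.
      * move=> _ _ [x [r [Xx ->]]] [y [t [Xy ->]]].
        by exists (x + y), (r + t); split; [exact: XD|rewrite mulrDl addrACA].
      * move=> u _ [x [r [Xx ->]]].
        by exists (u * x), (u * r); split; [exact: XM|rewrite mulrDr mulrA].
    + by move=> x Jx; exists x, 0; split; [exact: JX|rewrite mul0r addr0].
    + by move=> n [x [r [Xx e]]]; apply: h; exists n, r, x.
  have [n [r [x [Xx ex]]]] := ext a Xa; have [m [t [y [Xy ey]]]] := ext b Xb.
  apply: (sX (n + m)%N); rewrite exprD ex ey.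
  have -> : (x + r * a) * (y + t * b) = (y + t * b) * x + (r * a) * y + (r * t) * (a * b).
    by ring.
  by apply: (XD); [apply: (XD)|]; apply: (XM).
Qed.
End PrimeAvoidance.

(** * Bases of a finite extension modulo a prime *)

Section BasisModulo.

Variables (A B : comPzRingType) (g : {rmorphism A -> B}) (Q : set B).
Hypothesis hQ : prime_ideal Q.
Variables (n : nat) (beta : 'I_n -> B).
Hypothesis gen : forall y, exists c : 'I_n -> A, y = \sum_(i < n) g (c i) * beta i.

Let iQ : is_ideal Q. Proof. by case: hQ. Qed.
Let QD : forall a b, Q a -> Q b -> Q (a + b). Proof. by case: iQ. Qed.
Let QM : forall a b, Q b -> Q (a * b). Proof. by case: iQ. Qed.

(** Linear independence over the fraction field of [A] modulo the preimage of [Q], with denominators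
    cleared so that the field is not mentioned. *)
Let indep (D : {set 'I_n}) := forall a : 'I_n -> A,
  Q (\sum_(i in D) g (a i) * beta i) -> forall i, i \in D -> Q (g (a i)).

Lemma prime_idealM (a b : B) : ~ Q a -> ~ Q b -> ~ Q (a * b).
Proof. by case: hQ => _ _ h Qa Qb /h []. Qed.

Lemma prime_ideal_prod (I : Type) (r : seq I) (P : pred I) (F : I -> B) :
  (forall i, P i -> ~ Q (F i)) -> ~ Q (\prod_(i <- r | P i) F i).
Proof.
move=> h; apply: (big_ind (fun x => ~ Q x)) => //; first by case: hQ.
exact: prime_idealM.
Qed.

(** A maximal independent subset of the generators is a basis: by maximality every other generator
    satisfies a relation in which its own coefficient lies outside [Q]. This is how the number of
    generators bounds the dimension. *)
Lemma mod_basis : exists (d : nat) (b : 'I_d -> B), [/\ (d <= n)%N,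
  forall a : 'I_d -> A, Q (\sum_k g (a k) * b k) -> forall k, Q (g (a k)) &
  exists2 c, ~ Q (g c) & forall y, exists s : 'I_d -> A,
    Q (g c * y - \sum_k g (s k) * b k)].
Proof.
have ind0 : `[< indep finset.set0 >] by apply/asboolP => a _ i; rewrite finset.in_set0.
case: (@arg_maxnP _ _ (fun D => `[< indep D >]) (fun D : {set 'I_n} => #|D|) ind0) => D /asboolP indD maxD.
exists #|D|, (fun k => beta (enum_val k)); split.
- by rewrite -[X in (_ <= X)%N]card_ord max_card.
- move=> a ha k.
  pose a' i := a (enum_rank_in (enum_valP k) i).
  have e j : a' (enum_val j) = a j by rewrite /a' enum_valK_in.
  rewrite -e; apply: indD; last exact: enum_valP.
  by rewrite big_enum_val; under eq_bigr do rewrite e.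
have spanj j : exists a, ~ Q (g a) /\ exists t : 'I_n -> A,
    Q (g a * beta j - \sum_(i in D) g (t i) * beta i).
  case: (boolP (j \in D)) => jD.
    exists 1; split; first by rewrite rmorph1; case: hQ.
    exists (fun i => (i == j)%:R); rewrite (bigD1 j) //= big1 ?addr0.
      by rewrite eqxx subrr; case: iQ.
    by move=> i /andP [_ /negPf ->]; rewrite rmorph0 mul0r.
  have nind : ~ indep (j |: D).
    move=> /asboolP /maxD; rewrite cardsU1 jD add1n => h.
    by have := leq_trans h (leqnn _); rewrite ltnn.
  have [a [ha [i0 [i0D hi0]]]] : exists a : 'I_n -> A,
      Q (\sum_(i in j |: D) g (a i) * beta i) /\
      exists i, i \in j |: D /\ ~ Q (g (a i)).
    apply: contrapT => h; apply: nind => a ha i iD; apply: contrapT => hi.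
    by apply: h; exists a; split=> //; exists i.
  rewrite big_setU1 //= in ha; exists (a j); split=> [Qaj|]; last first.
    exists (fun i => - a i); rewrite -sumrN; under eq_bigr do rewrite rmorphN mulNr opprK.
    exact: ha.
  have h i : i \in D -> Q (g (a i)).
    apply: indD; have := idealB iQ ha (idealMr (beta j) iQ Qaj).
    by rewrite addrAC subrr add0r.
  by move: i0D; rewrite in_setU1 => /orP [/eqP e|/h//]; apply: hi0; rewrite e.
have [aj haj] := choice spanj.
have /choice [tj htj] : forall j, exists t : 'I_n -> A,
    Q (g (aj j) * beta j - \sum_(i in D) g (t i) * beta i) by move=> j; case: (haj j).
(* [aj j] is a denominator for [beta j]. The product serves all generators at once, and the
   coefficients of [y] carry the complementary products over [i != j]. *)
exists (\prod_j aj j).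
  by rewrite rmorph_prod; apply: prime_ideal_prod => j _; case: (haj j).
move=> y; have [c ->] := gen y.
exists (fun k => \sum_j (c j * \prod_(i | i != j) aj i) * tj j (enum_val k)).
rewrite -(big_enum_val (fun i => g (\sum_j (c j * \prod_(i | i != j) aj i) * tj j i) * beta i)) /=.
under [X in _ - X]eq_bigr do rewrite rmorph_sum mulr_suml.
rewrite exchange_big mulr_sumr -sumrB /=; apply: ideal_sum => // j _.
rewrite (bigD1 j) //=; set P := \prod_(i | i != j) aj i.
have -> : \sum_(i in D) g (c j * P * tj j i) * beta i =
    (g (c j) * g P) * \sum_(i in D) g (tj j i) * beta i.
  by rewrite mulr_sumr; apply: eq_bigr => i _; rewrite !rmorphM /= !mulrA.
rewrite rmorphM.
rewrite [X in Q X](_ : _ = (g (c j) * g P) *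
    (g (aj j) * beta j - \sum_(i in D) g (tj j i) * beta i)); first exact: QM.
by ring.
Qed.
End BasisModulo.

(** * The largest stable ideal inside a prime *)

Section CompatibleCore.

Definition ring_splitting (p : nat) (B : comPzRingType) (psi : B -> B) : Prop :=
  [/\ forall a b, psi (a + b) = psi a + psi b,
      forall a b, psi (a ^+ p * b) = a * psi b & psi 1 = 1].

Variables (p : nat) (B : comPzRingType) (psi : B -> B).
Hypothesis p_gt0 : (0 < p)%N.
Hypothesis hpsi : ring_splitting p psi.

Lemma splittingD a b : psi (a + b) = psi a + psi b. Proof. by case: hpsi. Qed.
Lemma splittingM a b : psi (a ^+ p * b) = a * psi b. Proof. by case: hpsi. Qed.
Lemma splitting0 : psi 0 = 0.
Proof. by apply: (addrI (psi 0)); rewrite -splittingD !addr0. Qed.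
Lemma splittingN a : psi (- a) = - psi a.
Proof. by apply: (addrI (psi a)); rewrite -splittingD !subrr splitting0. Qed.
Lemma splitting_sum (I : Type) (r : seq I) (P : pred I) (F : I -> B) :
  psi (\sum_(i <- r | P i) F i) = \sum_(i <- r | P i) psi (F i).
Proof. by apply: big_morph; [exact: splittingD|exact: splitting0]. Qed.
Lemma splittingX a : psi (a ^+ p) = a.
Proof. by rewrite -[a ^+ p]mulr1 splittingM; case: hpsi => _ _ ->; rewrite mulr1. Qed.

Lemma iter_splittingD e a b : iter e psi (a + b) = iter e psi a + iter e psi b.
Proof. by elim: e => //= e ->; rewrite splittingD. Qed.
Lemma iter_splitting0 e : iter e psi 0 = 0.
Proof. by elim: e => //= e ->; rewrite splitting0. Qed.
Lemma iter_splittingM e a b : iter e psi (a ^+ (p ^ e) * b) = a * iter e psi b.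
Proof.
elim: e a => [|e IH] a; first by rewrite expn0 expr1.
by rewrite !iterS expnS exprM IH splittingM.
Qed.

Variables (Q : set B) (hQ : prime_ideal Q).

Let iQ : is_ideal Q. Proof. by case: hQ. Qed.

(* The largest psi-stable ideal contained in Q. *)
Definition core : set B := [set b | forall e y, Q (iter e psi (b * y))].

Lemma core_sub : core `<=` Q.
Proof. by move=> b /(_ 0%N 1); rewrite mulr1. Qed.

(** A multiplier outside [psi] moves inside, [y * psi b = psi (y ^+ p * b)], so the condition on
    [psi b] is an instance of the condition on [b] with one more iterate. *)
Lemma core_stable b : core b -> core (psi b).
Proof. by move=> h e y; rewrite mulrC -splittingM -iterSr mulrC; apply: h. Qed.

Lemma core_ideal : is_ideal core.
Proof.
have [Q0 QD QM] := iQ; split.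
- by move=> e y; rewrite mul0r iter_splitting0.
- by move=> a b ha hb e y; rewrite mulrDl iter_splittingD; apply: QD.
- by move=> a b hb e y; rewrite -mulrA mulrCA; apply: hb.
Qed.

Lemma core_prime : prime_ideal core.
Proof.
have [_ Q1 QP] := hQ; split; [exact: core_ideal|by move=> /core_sub|].
move=> a b hab; apply: contrapT => /not_orP [ha hb].
have ncore x : ~ core x -> exists e y, ~ Q (iter e psi (x * y)).
  move=> hx; apply: contrapT => h; apply: hx => e y; apply: contrapT => hy.
  by apply: h; exists e, y.
have [e [y hy]] := ncore a ha; have [f [z hz]] := ncore b hb.
set u := iter e psi (a * y) in hy.
have pe k : (0 < p ^ k)%N by rewrite expn_gt0 p_gt0.
(* The multiplier of [a * b] is chosen so that the product is [t ^+ (p ^ e) * (a * y)]. The [e]-th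
   iterate of [psi] turns it into [t * u = u ^+ (p ^ f) * (b * z)], and the [f]-th iterate turns
   that into [u] times the image of [b * z]: two factors outside [Q]. *)
pose t := b * z * u ^+ (p ^ f).-1.
have : Q (iter (f + e) psi (a * b * (y * (t ^+ (p ^ e).-1 * (z * u ^+ (p ^ f).-1))))).
  exact: hab.
rewrite (_ : a * b * _ = t ^+ (p ^ e) * (a * y)); last first.
  by rewrite -[in RHS](prednK (pe e)) exprS {2}/t; ring.
rewrite iterD iter_splittingM -/u /t -mulrA -exprSr prednK //.
rewrite mulrC iter_splittingM => /QP []; [exact: hy|exact: hz].
Qed.
End CompatibleCore.

(** * The trace over the residue field and its behaviour under Frobenius and splittings *)

Section RegularTrace.

Lemma exprD_prime (R : comPzRingType) (p : nat) (x y : R) :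
  prime p -> p%:R = 0 :> R -> (x + y) ^+ p = x ^+ p + y ^+ p.
Proof.
case: p => // q pp p0; rewrite exprDn big_ord_recl big_ord_recr /= big1 => [|i _].
  by rewrite bin0 mulr1n subn0 expr0 mulr1 add0r /bump /= add1n subnn expr0 mul1r binn.
have iq := ltn_ord i.
have /dvdnP [m ->] : (q.+1 %| 'C(q.+1, bump 0 i))%N.
  by apply: prime_dvd_bin => //; rewrite /bump /=; lia.
by rewrite mulrnA -[_ *+ q.+1]mulr_natr p0 mulr0.
Qed.

Lemma exprN_prime (R : comPzRingType) (p : nat) (x : R) :
  prime p -> p%:R = 0 :> R -> (- x) ^+ p = - x ^+ p.
Proof.
move=> pp p0; apply/eqP; rewrite -subr_eq0 opprK -exprD_prime //.
by rewrite addNr expr0n; case: p pp {p0}.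
Qed.

Lemma expr_sum_prime (R : comPzRingType) (p : nat) (I : Type) (r : seq I) (F : I -> R) :
  prime p -> p%:R = 0 :> R -> (\sum_(i <- r) F i) ^+ p = \sum_(i <- r) F i ^+ p.
Proof.
move=> pp p0; elim: r => [|i r IH]; last by rewrite !big_cons exprD_prime // IH.
by rewrite !big_nil expr0n; case: p pp {p0}.
Qed.

Variables (A B : comPzRingType) (g : {rmorphism A -> B}) (Q : set B).
Hypothesis hQ : prime_ideal Q.
Variables (K : fieldType) (k : {rmorphism A -> K}) (d : nat) (b : 'I_d.+1 -> B).
Hypothesis k0 : forall a, k a = 0 <-> Q (g a).
Hypothesis kfrac : forall x : K, exists a c : A, ~ Q (g c) /\ x * k c = k a.
Hypothesis ind : forall a : 'I_d.+1 -> A,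
  Q (\sum_i g (a i) * b i) -> forall i, Q (g (a i)).
Variable c : A.
Hypothesis c0 : ~ Q (g c).
Variable s : B -> 'I_d.+1 -> A.
Hypothesis hs : forall y, Q (g c * y - \sum_i g (s y i) * b i).

Let iQ : is_ideal Q. Proof. by case: hQ. Qed.
Let QD : forall a b, Q a -> Q b -> Q (a + b). Proof. by case: iQ. Qed.
Let QM : forall a b, Q b -> Q (a * b). Proof. by case: iQ. Qed.

Lemma k_neq0 a : ~ Q (g a) -> k a != 0.
Proof. by move=> h; apply/eqP => /k0. Qed.

(** The K-algebra generated by [B] modulo [Q] is never formed: an element is handled through its
    coordinates on the basis [b], read off from [hs] with the common denominator [c]. In the
    application [Q] is the stable prime [core]. *)
Definition coord (y : B) : 'rV[K]_d.+1 := \row_i (k (s y i) / k c).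

(** Coordinates do not depend on the expression chosen: multiplying the given relation by [g c] and
    [hs y] by [g a] leaves a relation between the [b i], to which [ind] applies. *)
Lemma coordE a y t : Q (g a * y - \sum_i g (t i) * b i) ->
  k a *: coord y = \row_i k (t i).
Proof.
move=> h; apply/rowP => i; rewrite !mxE mulrA; apply: (canLR (mulfK (k_neq0 c0))).
apply/eqP; rewrite -subr_eq0 -!rmorphM -rmorphB; apply/eqP/k0; move: i.
apply: ind; have := idealB iQ (idealMr (g c) iQ h) (idealMr (g a) iQ (hs y)).
have -> : \sum_i g (a * s y i - t i * c) * b i =
    g a * (\sum_i g (s y i) * b i) - g c * (\sum_i g (t i) * b i).
  rewrite !mulr_sumr -sumrB; apply: eq_bigr => i _.
  by rewrite rmorphB !rmorphM; ring.
by congr Q; ring.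
Qed.

Lemma coord_lin (t : 'I_d.+1 -> A) : coord (\sum_i g (t i) * b i) = \row_i k (t i).
Proof.
rewrite -[LHS]scale1r -(rmorph1 k); apply: coordE.
by rewrite rmorph1 mul1r subrr; case: iQ.
Qed.

Lemma coord_eq0 y : coord y = 0 <-> Q y.
Proof.
split=> [e|Qy]; last first.
  rewrite -[LHS]scale1r -(rmorph1 k) (@coordE 1 _ (fun=> 0)).
    by apply/rowP => i; rewrite !mxE rmorph0.
  by rewrite big1 ?subr0 ?rmorph1 ?mul1r // => i _; rewrite rmorph0 mul0r.
have h i : Q (g (s y i)).
  apply/k0; move/rowP/(_ i): e; rewrite !mxE => /(canRL (divfK (k_neq0 c0))).
  by rewrite mul0r.
have : Q (g c * y).
  rewrite -[_ * y](subrK (\sum_i g (s y i) * b i)); apply: QD => //.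
  by apply: ideal_sum => // i _; apply: idealMr.
by case: hQ => _ _ hP /hP [].
Qed.

Lemma coordD x y : coord (x + y) = coord x + coord y.
Proof.
apply: (scalerI (k_neq0 c0)); rewrite (@coordE c _ (fun i => s x i + s y i)).
  by apply/rowP => i; rewrite !mxE rmorphD -mulrDl mulrCA mulfV ?mulr1 // k_neq0.
have -> : \sum_i g (s x i + s y i) * b i = \sum_i g (s x i) * b i + \sum_i g (s y i) * b i.
  by rewrite -big_split; apply: eq_bigr => i _; rewrite rmorphD mulrDl.
by have := QD (hs x) (hs y); congr Q; ring.
Qed.

Lemma coordZ a y : coord (g a * y) = k a *: coord y.
Proof.
apply: (scalerI (k_neq0 c0)); rewrite (@coordE c _ (fun i => a * s y i)).
  apply/rowP => i; rewrite !mxE rmorphM.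
  by rewrite [k c * _]mulrC -!mulrA mulVf ?mulr1 // k_neq0.
have -> : \sum_i g (a * s y i) * b i = g a * \sum_i g (s y i) * b i.
  by rewrite mulr_sumr; apply: eq_bigr => i _; rewrite rmorphM mulrA.
by have := QM (g a) (hs y); congr Q; ring.
Qed.

Lemma coord0 : coord 0 = 0.
Proof. by apply/coord_eq0; case: iQ. Qed.

Lemma coord_sum (I : Type) (r : seq I) (P : pred I) (F : I -> B) :
  coord (\sum_(i <- r | P i) F i) = \sum_(i <- r | P i) coord (F i).
Proof. by apply: big_morph; [exact: coordD|exact: coord0]. Qed.

Lemma coord_mod x y : Q (x - y) -> coord x = coord y.
Proof. by move=> /coord_eq0 h; rewrite -[x](subrK y) coordD h add0r. Qed.

(* acts on row vectors of coordinates, from the right *)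
Definition mulmat (y : B) : 'M[K]_d.+1 := \matrix_(i, j) coord (b i * y) 0 j.

Lemma row_mulmat i y : row i (mulmat y) = coord (b i * y).
Proof. by apply/rowP => j; rewrite !mxE. Qed.

Lemma coord_modM a w v y : Q (g a * w - v) -> k a *: coord (w * y) = coord (v * y).
Proof.
move=> h; rewrite -coordZ; apply: coord_mod; rewrite mulrA -mulrBl.
exact: idealMr.
Qed.

Lemma row_coord_mul (t : 'I_d.+1 -> A) (N : 'M[K]_d.+1) :
  (\row_i k (t i)) *m N = \sum_i k (t i) *: row i N.
Proof. by rewrite mulmx_sum_row; apply: eq_bigr => i _; rewrite mxE. Qed.

Lemma coord_mulmat w y : coord w *m mulmat y = coord (w * y).
Proof.
apply: (scalerI (k_neq0 c0)); rewrite scalemxAl (coordE (hs w)) row_coord_mul.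
rewrite (coord_modM _ (hs w)) mulr_suml coord_sum.
by apply: eq_bigr => i _; rewrite row_mulmat -mulrA coordZ.
Qed.

Lemma coord_b i : coord (b i) = delta_mx 0 i.
Proof.
have -> : b i = \sum_j g ((j == i)%:R) * b j.
  rewrite (bigD1 i) //= eqxx rmorph1 mul1r big1 ?addr0 // => j /negPf ->.
  by rewrite rmorph0 mul0r.
by rewrite coord_lin; apply/rowP => j; rewrite !mxE rmorph_nat eqxx.
Qed.

Lemma mulmatM y z : mulmat (y * z) = mulmat y *m mulmat z.
Proof. by apply/row_matrixP => i; rewrite row_mul !row_mulmat coord_mulmat mulrA. Qed.

Lemma mulmatD y z : mulmat (y + z) = mulmat y + mulmat z.
Proof. by apply/row_matrixP => i; rewrite raddfD /= !row_mulmat mulrDr coordD. Qed.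

Lemma mulmatZ a y : mulmat (g a * y) = k a *: mulmat y.
Proof. by apply/row_matrixP => i; rewrite linearZ /= !row_mulmat mulrCA coordZ. Qed.

Lemma mulmat1 : mulmat 1 = 1%:M.
Proof.
by apply/row_matrixP => i; rewrite row_mulmat mulr1 coord_b row1.
Qed.

Lemma mulmatX y n : mulmat (y ^+ n) = mulmat y ^+ n.
Proof. by elim: n => [|n IH]; rewrite ?expr0 ?mulmat1 // !exprS mulmatM IH. Qed.

Lemma mulmat_eq0 y : mulmat y = 0 -> Q y.
Proof. by move=> e; rewrite -[y]mul1r; apply/coord_eq0; rewrite -coord_mulmat e mulmx0. Qed.

Lemma mulmat_mod x y : Q (x - y) -> mulmat x = mulmat y.
Proof.
move=> h; apply/row_matrixP => i; rewrite !row_mulmat; apply: coord_mod.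
by rewrite -mulrBr; apply: QM.
Qed.

Definition trace (y : B) : K := \tr (mulmat y).

Lemma trace_mod x y : Q (x - y) -> trace x = trace y.
Proof. by move=> h; rewrite /trace (mulmat_mod h). Qed.

Lemma traceZ a y : trace (g a * y) = k a * trace y.
Proof. by rewrite /trace mulmatZ mxtraceZ. Qed.

Lemma trace_sum (I : Type) (r : seq I) (P : pred I) (F : I -> B) :
  trace (\sum_(i <- r | P i) F i) = \sum_(i <- r | P i) trace (F i).
Proof.
apply: big_morph => [x y|]; first by rewrite /trace mulmatD mxtraceD.
by rewrite -[0](mul0r 0) -(rmorph0 g) traceZ rmorph0 mul0r.
Qed.

(** All coordinates have the denominator [c], hence so do the diagonal entries of every
    multiplication matrix. Multiples of [g c] thus have traces coming from [A]. *)
Lemma trace_den y : exists v, k c * trace y = k v.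
Proof.
exists (\sum_i s (b i * y) i).
rewrite rmorph_sum mulr_sumr; apply: eq_bigr => i _.
by rewrite !mxE mulrCA mulfV ?mulr1 // k_neq0.
Qed.

Lemma common_denominator (v : 'rV[K]_d.+1) :
  exists e t, ~ Q (g e) /\ k e *: v = \row_i k (t i).
Proof.
have /choice [f hf] : forall i, exists ac : A * A, ~ Q (g ac.2) /\ v 0 i * k ac.2 = k ac.1.
  by move=> i; have [a [e h]] := kfrac (v 0 i); exists (a, e).
exists (\prod_i (f i).2), (fun i => (f i).1 * \prod_(j | j != i) (f j).2); split.
  by rewrite rmorph_prod; apply: prime_ideal_prod => // i _; case: (hf i).
apply/rowP => i; rewrite !mxE (bigD1 i) //= !rmorphM.
by case: (hf i) => _ <-; ring.
Qed.

Variables (p : nat) (phi : A -> A) (psi : B -> B).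
Hypothesis pp : prime p.
Hypothesis pA : p%:R = 0 :> A.
Hypotheses (hphi : ring_splitting p phi) (hpsi : ring_splitting p psi).
Hypothesis compat : forall a, psi (g a) = g (phi a).
Hypothesis Qpsi : forall y, Q y -> Q (psi y).

Let pB : p%:R = 0 :> B. Proof. by rewrite -(rmorph_nat g) pA rmorph0. Qed.
Let pK : p \in [pchar K].
Proof. by rewrite inE pp -(rmorph_nat k) pA rmorph0 eqxx. Qed.
Local Notation F := (pFrobenius_aut pK).

Lemma splittingZ a w : psi (g a * w ^+ p) = g (phi a) * w.
Proof. by rewrite mulrC (splittingM hpsi) compat mulrC. Qed.

Definition powmat : 'M[K]_d.+1 := \matrix_(i, j) coord (b i ^+ p) 0 j.

Lemma row_powmat i : row i powmat = coord (b i ^+ p).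
Proof. by apply/rowP => j; rewrite !mxE. Qed.

(* A relation between the b_i^p, multiplied by t_i^(p-1), is sent by psi to a
   relation between the b_i with i-th coefficient t_i. *)
Lemma powmat_unit : powmat \in unitmx.
Proof.
rewrite -row_free_unit; apply: inj_row_free => v hv.
have [e [t [e0 et]]] := common_denominator v.
have h : Q (\sum_i g (t i) * b i ^+ p).
  apply/coord_eq0; rewrite coord_sum; transitivity (k e *: v *m powmat).
    rewrite et row_coord_mul; apply: eq_bigr => i _.
    by rewrite row_powmat coordZ.
  by rewrite -scalemxAl hv scaler0.
have h' x i : Q (g (phi (x * t i))).
  apply: (ind (a := fun i => phi (x * t i))).
  have := Qpsi (QM (g x) h); rewrite mulr_sumr (splitting_sum hpsi); congr Q.
  by apply: eq_bigr => j _; rewrite mulrA -rmorphM splittingZ.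
have t0 i : k (t i) = 0.
  apply/k0; have := h' (t i ^+ p.-1) i.
  by rewrite -exprSr prednK ?prime_gt0 // (splittingX hphi).
have : k e *: v = 0 by rewrite et; apply/rowP => i; rewrite !mxE t0.
by move/eqP; rewrite scaler_eq0 (negPf (k_neq0 e0)) => /eqP.
Qed.

(** The p-th power of the relation [hs w] is a relation between the [b i ^+ p] with p-th powers as
    coefficients, since the p-th power map is additive. *)
Lemma coord_powmat w : coord (w ^+ p) = map_mx F (coord w) *m powmat.
Proof.
have e0 := k_neq0 c0; have e1 : F (k c) != 0 by rewrite fmorph_eq0.
apply: (scalerI e1); rewrite [RHS]scalemxAl -map_mxZ (coordE (hs w)).
have -> : map_mx F (\row_i k (s w i)) = \row_i k (s w i ^+ p).
  by apply/rowP => i; rewrite !mxE rmorphXn.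
rewrite row_coord_mul /= pFrobenius_autE -rmorphXn -coordZ.
transitivity (coord (\sum_i g (s w i ^+ p) * b i ^+ p)).
  apply: coord_mod.
  have h := hs w; have : Q ((g c * w - \sum_i g (s w i) * b i) ^+ p).
    by rewrite -(prednK (prime_gt0 pp)) exprS; apply: idealMr.
  rewrite exprD_prime // exprN_prime // expr_sum_prime // exprMn rmorphXn.
  by under eq_bigr do rewrite exprMn -rmorphXn.
by rewrite coord_sum; apply: eq_bigr => i _; rewrite coordZ row_powmat.
Qed.

(* The matrix of y^p on the basis (b_i^p) is the Frobenius twist of the matrix
   of y on the basis (b_i). *)
Lemma traceX y : trace (y ^+ p) = trace y ^+ p.
Proof.
have e : powmat *m mulmat (y ^+ p) = map_mx F (mulmat y) *m powmat.
  apply/row_matrixP => i; rewrite !row_mul row_powmat coord_mulmat -exprMn.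
  by rewrite coord_powmat -map_row row_mulmat.
have {}e : mulmat (y ^+ p) = invmx powmat *m (map_mx F (mulmat y) *m powmat).
  by rewrite -e mulmxA mulVmx ?powmat_unit // mul1mx.
by rewrite /trace e mxtrace_mulC -mulmxA mulmxV ?powmat_unit // mulmx1 trace_map_mx.
Qed.

(** [psi] can be computed on multiples of p-th powers, as [psi (g a * b i ^+ p) = g (phi a) * b i];
    so [y] is expanded on the [b i ^+ p], a basis by [powmat_unit]. *)
Lemma pow_spanP y : exists e t, ~ Q (g e) /\ Q (g e * y - \sum_i g (t i) * b i ^+ p).
Proof.
have [e [t [e0 et]]] := common_denominator (coord y *m invmx powmat).
exists e, t; split=> //; apply/coord_eq0; rewrite -[_ * y](mulr1 _).
have -> x z : coord (x - z) = coord x - coord z.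
  by rewrite -[in RHS](subrK z x) [in RHS]coordD addrK.
rewrite mulr1 coordZ coord_sum; apply/eqP; rewrite subr_eq0; apply/eqP.
transitivity (k e *: (coord y *m invmx powmat) *m powmat).
  by rewrite -scalemxAl mulmxKV ?powmat_unit.
by rewrite et row_coord_mul; apply: eq_bigr => i _; rewrite coordZ row_powmat.
Qed.

Lemma phi_k0 a : k a = 0 -> k (phi a) = 0.
Proof. by move/k0 => h; apply/k0; rewrite -compat; apply: Qpsi. Qed.

(** [phi] descends to the image of [A] in [K], because the kernel of [k] is stable under it. It is
    not extended to [K], so statements about traces name a preimage in [A]. *)
Lemma phi_k a a' : k a = k a' -> k (phi a) = k (phi a').
Proof.
move=> e; rewrite -(subrK a' a) (splittingD hphi) rmorphD phi_k0 ?add0r //.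
by rewrite rmorphB e subrr.
Qed.

Lemma trace_splitting y i : trace y = k i -> trace (psi y) = k (phi i).
Proof.
move=> tri; have [e [t [e0 h]]] := pow_spanP y.
have /choice [v hv] : forall j, exists v, k c * trace (b j) = k v.
  by move=> j; apply: trace_den.
have he : e ^+ p = e ^+ p.-1 * e by rewrite -exprSr prednK // prime_gt0.
(* The factor [e ^+ p.-1] completes the coefficient of [y] to [e ^+ p], which [psi] releases as
   [e]. *)
have h1 : Q (g e * psi y - \sum_j g (phi (e ^+ p.-1 * t j)) * b j).
  have := Qpsi (QM (g (e ^+ p.-1)) h).
  have -> : g (e ^+ p.-1) * (g e * y - \sum_j g (t j) * b j ^+ p) =
      g e ^+ p * y + \sum_j g (- (e ^+ p.-1 * t j)) * b j ^+ p.
    rewrite mulrBr mulrA -rmorphM -he rmorphXn mulr_sumr -sumrN.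
    by congr (_ + _); apply: eq_bigr => j _; rewrite rmorphN rmorphM; ring.
  rewrite (splittingD hpsi) (splittingM hpsi) (splitting_sum hpsi) -sumrN.
  congr (Q (_ + _)); apply: eq_bigr => j _.
  by rewrite splittingZ // (splittingN hphi) rmorphN mulNr.
have h2 : k e * trace (psi y) = \sum_j k (phi (e ^+ p.-1 * t j)) * trace (b j).
  rewrite -traceZ (trace_mod h1) trace_sum; apply: eq_bigr => j _.
  by rewrite traceZ.
have h3 : k e * k i = \sum_j k (t j) * trace (b j) ^+ p.
  rewrite -tri -traceZ (trace_mod h) trace_sum; apply: eq_bigr => j _.
  by rewrite traceZ traceX.
(* [phi] acts on [A] only, so denominators are cleared first: [e] for the expansion of [y] and [c]
   for the traces of the [b j]. Inside [phi] they become the factor [(e * c) ^+ p]. *)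
apply: (mulfI (k_neq0 c0)); apply: (mulfI (k_neq0 e0)).
rewrite mulrCA h2 mulr_sumr.
transitivity (k (phi ((e * c) ^+ p * i))); last first.
  by rewrite (splittingM hphi) !rmorphM; ring.
transitivity (k (phi (\sum_j e ^+ p.-1 * t j * v j ^+ p))).
  rewrite (splitting_sum hphi) rmorph_sum; apply: eq_bigr => j _.
  by rewrite [_ * v j ^+ p]mulrC (splittingM hphi) rmorphM -hv; ring.
apply: phi_k; rewrite rmorph_sum exprMn he !rmorphM.
transitivity (k (e ^+ p.-1) * k (c ^+ p) * (k e * k i)); last first.
  by move: (k (e ^+ p.-1)) (k (c ^+ p)) (k e) (k i) => ? ? ? ?; ring.
rewrite h3 mulr_sumr; apply: eq_bigr => j _.
rewrite !rmorphM [k (v j ^+ p)]rmorphXn -hv exprMn [k (c ^+ p)]rmorphXn.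
by move: (k (e ^+ p.-1)) (k c ^+ p) (k (t j)) (_ ^+ p) => ? ? ? ?; ring.
Qed.
End RegularTrace.

(** * The theorem for a finite ring extension *)

Section SplittingTheorem.

Variables (A B : comPzRingType) (g : {rmorphism A -> B}).
Variables (n : nat) (beta : 'I_n -> B).
Hypothesis gen : forall y, exists c : 'I_n -> A, y = \sum_(i < n) g (c i) * beta i.
Variables (p : nat) (phi : A -> A) (psi : B -> B).
Hypotheses (pp : prime p) (np : (n < p)%N).
Hypothesis pA : p%:R = 0 :> A.
Hypotheses (hphi : ring_splitting p phi) (hpsi : ring_splitting p psi).
Hypothesis compat : forall a, psi (g a) = g (phi a).
Variables (I : set A) (Q : set B).
Hypotheses (iI : is_ideal I) (phiI : forall a, I a -> I (phi a)).
Hypotheses (hQ : prime_ideal Q) (IQ : forall a, I a -> Q (g a)).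

Let C := core psi Q.
Let hC : prime_ideal C. Proof. exact: (core_prime (prime_gt0 pp) hpsi hQ). Qed.

Lemma ideal_sub_core a : I a -> C (g a).
Proof.
move=> Ia; apply: contrapT => Ca.
have hP : prime_ideal [set x | C (g x)].
  have [[C0 CD CM] C1 CP] := hC; split=> /=; last 2 first.
  - by rewrite rmorph1.
  - by move=> x y; rewrite rmorphM => /CP.
  split=> /= [|x y hx hy|x y hy]; first by rewrite rmorph0.
    by rewrite rmorphD; apply: CD.
  by rewrite rmorphM; apply: CM.
have [K [k [k0 kfrac]]] := residue_field hP.
have [d [b [dn ind [c c0 hs]]]] := mod_basis hC gen.
have /choice [s {}hs] := hs.
(* An empty basis would put [g c] in [C], by the relation for 1. The positive size makes the square
   matrices a ring. *)
case: d b dn ind s hs => [|d] b dn ind s hs.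
  by apply: c0; have := hs 1; rewrite big_ord0 subr0 mulr1.
have Cpsi y : C y -> C (psi y) by apply: (core_stable hpsi).
pose tr := trace k b c s; pose S (x : K) := exists2 i, I i & x = k i.
have Str e y : S (tr y) -> S (tr (iter e psi y)).
  elim: e => // e IH /IH [i Ii hi]; exists (phi i); first exact: phiI.
  exact: (trace_splitting hC k0 kfrac ind c0 hs pp pA hphi hpsi compat Cpsi hi).
have [e [y hu]] : exists e y, ~ Q (iter e psi (g c * g a * y)).
  have h := prime_idealM hC c0 Ca; apply: contrapT => h'; apply: h => e y.
  by apply: contrapT => hy; apply: h'; exists e, y.
set u := iter e psi _ in hu.
(* A multiplier of [u] enters the iterate of [psi] as its [p ^ e]-th power, so it suffices to treat
   multiples of [c * a]. There [c] clears the trace and the remaining factor [a] puts it in the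
   image of [I]. Taking [w] a power of [u] covers all positive powers of [u]. *)
have Stru w : S (tr (w * u)).
  rewrite /u -(iter_splittingM hpsi); apply: Str.
  have -> : w ^+ (p ^ e) * (g c * g a * y) = g (a * c) * (w ^+ (p ^ e) * y).
    by rewrite rmorphM; ring.
  have [v hv] := trace_den b k0 c0 s (w ^+ (p ^ e) * y).
  exists (a * v); first exact: idealMr.
  by rewrite /tr (traceZ hC k0 ind c0 hs) rmorphM -mulrA hv rmorphM.
have [I0 ID IM] := iI.
(* [j] is inverted by a natural number and not merely in [K], so that division by [j] preserves the
   image of [I]. The bound [n < p] makes [j] prime to [p]. *)
have unitk j : (0 < j <= d.+1)%N -> exists j', j%:R * j'%:R = 1 :> K.
  case/andP=> j0 jd; have : coprime j p.
    rewrite coprime_sym prime_coprime //; apply/negP => /(dvdn_leq j0); lia.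
  case/(coprimeP _ j0) => -[v w] /= hvw; exists v.
  have e1 : (v * j = w * p + 1)%N by lia.
  have pK : p%:R = 0 :> K by rewrite -(rmorph_nat k) pA rmorph0.
  by rewrite -natrM mulnC e1 natrD natrM pK mulr0 add0r.
have Schi l : (l < d.+1)%N -> S (char_poly (mulmat k b c s u))`_l.
  apply: char_poly_coef_closed.
  - by exists 0; rewrite ?rmorph0.
  - move=> _ _ [x Ix ->] [z Iz ->]; exists (x + z); first exact: ID.
    by rewrite rmorphD.
  - move=> _ _ [x Ix ->] [z Iz ->]; exists (x * z); first exact: IM.
    by rewrite rmorphM.
  - move=> j _ /unitk [j' hj] [x Ix ->]; exists (- (x * j'%:R)).
      by apply: idealN => //; apply: idealMr.
    rewrite rmorphN rmorphM rmorph_nat; congr (- (_ * _)).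
    have j0 : j%:R != 0 :> K.
      by apply/eqP => e0; move: hj; rewrite e0 mul0r => /eqP; rewrite eq_sym oner_eq0.
    by apply: (mulfI j0); rewrite mulfV.
  - move=> j /unitk [j' hj]; apply/eqP => e0; move: hj.
    by rewrite e0 mul0r => /eqP; rewrite eq_sym oner_eq0.
  - move=> j j0; rewrite -(mulmatX hC k0 ind c0 hs) -(prednK j0) exprSr.
    exact: Stru.
have /choice [f hf] : forall l : 'I_d.+1, exists i,
    I i /\ (char_poly (mulmat k b c s u))`_l = k i.
  by move=> l; have [i Ii hi] := Schi l (ltn_ord l); exists i.
(* Cayley-Hamilton for the matrix of [u], read back in [B]: an element whose multiplication matrix
   is zero lies in [C]. *)
have Cy : C (\sum_l g (f l) * u ^+ l + u ^+ d.+1).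
  apply: (mulmat_eq0 hC k0 ind c0 hs).
  rewrite (mulmatD hC k0 ind c0 hs).
  rewrite -[RHS](char_poly_sum (mulmat k b c s u)) [RHS]big_ord_recr /=; congr (_ + _).
    have -> : mulmat k b c s (\sum_l g (f l) * u ^+ l) =
        \sum_l mulmat k b c s (g (f l) * u ^+ l).
      apply: big_morph => [x z|]; first exact: (mulmatD hC k0 ind c0 hs).
      by rewrite -[X in mulmat k b c s X](mul0r 0) -(rmorph0 g) (mulmatZ hC k0 ind c0 hs) rmorph0 scale0r.
    apply: eq_bigr => l _.
    by rewrite (mulmatZ hC k0 ind c0 hs) (mulmatX hC k0 ind c0 hs); case: (hf l) => _ <-.
  rewrite (mulmatX hC k0 ind c0 hs).
  have := char_poly_monic (mulmat k b c s u).
  by rewrite monicE lead_coefE size_char_poly /= => /eqP ->; rewrite scale1r.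
have iQ : is_ideal Q by case: hQ.
apply/hu/(@prime_ideal_exp _ Q _ d.+1 hQ).
have h : Q (\sum_l g (f l) * u ^+ l).
  apply: ideal_sum => // l _; apply: idealMr => //; apply: IQ; by case: (hf l).
by have := idealB iQ (core_sub Cy) h; rewrite addrAC subrr add0r.
Qed.

Lemma splitting_radical x :
  (forall P, prime_ideal P -> (forall a, I a -> P (g a)) -> P x) -> Q (psi x).
Proof.
by move=> h; apply: core_sub; apply: (core_stable hpsi); apply: h => // a /ideal_sub_core.
Qed.
End SplittingTheorem.

(** * Germs and affine charts *)

Section Germs.

Variable X : ringed_space.
Implicit Types U V W : opens X.

Definition capo (T : topologicalType) (U V : opens T) : opens T :=
  Opens (openI (opensP U) (opensP V)).

Lemma res_irr U V (h h' : V `<=` U) (s : sec U) : res h s = res h' s.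
Proof. by rewrite (Prop_irrelevance h h'). Qed.

(** Stalks are not constructed. The relation also compares sections over open sets that are only
    propositionally equal, or different. *)
Definition germ_eq U V (s : sec U) (t : sec V) (x : X) : Prop :=
  exists (W : opens X) (h : W `<=` U) (h' : W `<=` V),
    oset W x /\ res h s = res h' t.

Lemma germ_eq_refl U (s : sec U) x : oset U x -> germ_eq s s x.
Proof. by move=> Ux; exists U, (fun y h => h), (fun y h => h). Qed.

Lemma germ_eq_sym U V (s : sec U) (t : sec V) x : germ_eq s t x -> germ_eq t s x.
Proof. by case=> W [h [h' [Wx e]]]; exists W, h', h. Qed.

Lemma germ_eq_in U V (s : sec U) (t : sec V) x : germ_eq s t x -> oset U x /\ oset V x.
Proof. by case=> W [h [h' [Wx e]]]; split; [apply: (h)|apply: (h')]. Qed.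

Lemma germ_eq_shrink U V (s : sec U) (t : sec V) x W :
  oset W x -> germ_eq s t x ->
  exists W' (h : W' `<=` U) (h' : W' `<=` V), [/\ oset W' x, W' `<=` W & res h s = res h' t].
Proof.
move=> Wx [W' [h [h' [W'x e]]]].
have i1 : capo W W' `<=` W' by move=> y [].
have h1 : capo W W' `<=` U by move=> y /i1 /h.
have h2 : capo W W' `<=` V by move=> y /i1 /h'.
exists (capo W W'), h1, h2; split=> //; first by move=> y [].
by rewrite -(res_comp h i1) -(res_comp h' i1) e.
Qed.

Lemma germ_eq_trans U V W (s : sec U) (t : sec V) (r : sec W) x :
  germ_eq s t x -> germ_eq t r x -> germ_eq s r x.
Proof.
move=> [O [h [h' [Ox e]]]] /(germ_eq_shrink Ox) [O' [k [k' [O'x i e']]]].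
have h1 : O' `<=` U by move=> y /i /h.
exists O', h1, k'; split=> //.
by rewrite -e' -(res_comp h i) e (res_comp _ _ k).
Qed.

Lemma germ_eq_res U V (h : V `<=` U) (s : sec U) x : oset V x -> germ_eq (res h s) s x.
Proof.
by move=> Vx; exists V, (fun y h => h), h; split=> //; rewrite res_id.
Qed.

Lemma germ_eq_resl U V W (h : V `<=` U) (s : sec U) (t : sec W) x :
  oset V x -> germ_eq (res h s) t x <-> germ_eq s t x.
Proof.
move=> Vx; split; apply: germ_eq_trans; last exact: germ_eq_res.
by apply: germ_eq_sym; apply: germ_eq_res.
Qed.

Lemma germ_eq_resr U V W (h : V `<=` U) (s : sec U) (t : sec W) x :
  oset V x -> germ_eq t (res h s) x <-> germ_eq t s x.
Proof.
by move=> Vx; split=> /germ_eq_sym /(germ_eq_resl h _ _ Vx) /germ_eq_sym.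
Qed.

(** [f] is any binary operation natural in ring morphisms, so that sums, products and differences
    are treated at once. *)
Lemma germ_eq_mor2 (f : forall R : comPzRingType, R -> R -> R)
  (hf : forall (R S : comPzRingType) (g : {rmorphism R -> S}) a b, g (f R a b) = f S (g a) (g b))
  U V (s s' : sec U) (t t' : sec V) x :
  germ_eq s t x -> germ_eq s' t' x -> germ_eq (f _ s s') (f _ t t') x.
Proof.
move=> [O [h [h' [Ox e]]]] /(germ_eq_shrink Ox) [O' [k [k' [O'x i e']]]].
exists O', k, k'; split=> //; rewrite !hf e'; congr (f _ _ _).
by rewrite -(res_comp h i) -(res_comp h' i) e.
Qed.

Lemma germ_eqD U V (s s' : sec U) (t t' : sec V) x :
  germ_eq s t x -> germ_eq s' t' x -> germ_eq (s + s') (t + t') x.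
Proof. by apply: (@germ_eq_mor2 (fun R a b => a + b)) => R S g a b; rewrite rmorphD. Qed.

Lemma germ_eqM U V (s s' : sec U) (t t' : sec V) x :
  germ_eq s t x -> germ_eq s' t' x -> germ_eq (s * s') (t * t') x.
Proof. by apply: (@germ_eq_mor2 (fun R a b => a * b)) => R S g a b; rewrite rmorphM. Qed.

Lemma germ_eqB U V (s s' : sec U) (t t' : sec V) x :
  germ_eq s t x -> germ_eq s' t' x -> germ_eq (s - s') (t - t') x.
Proof. by apply: (@germ_eq_mor2 (fun R a b => a - b)) => R S g a b; rewrite rmorphB. Qed.

Lemma germ_eq_nat U V n x : oset U x -> oset V x -> germ_eq (n%:R : sec U) (n%:R : sec V) x.
Proof.
move=> Ux Vx; have h1 : capo U V `<=` U by move=> y [].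
have h2 : capo U V `<=` V by move=> y [].
by exists (capo U V), h1, h2; rewrite !rmorph_nat.
Qed.

Lemma germ_eq0 U V x : oset U x -> oset V x -> germ_eq (0 : sec U) (0 : sec V) x.
Proof. exact: (@germ_eq_nat U V 0). Qed.

Lemma germ_eq1 U V x : oset U x -> oset V x -> germ_eq (1 : sec U) (1 : sec V) x.
Proof. exact: (@germ_eq_nat U V 1). Qed.

Lemma germ_eqX U V (s : sec U) (t : sec V) n x :
  germ_eq s t x -> germ_eq (s ^+ n) (t ^+ n) x.
Proof.
move=> h; elim: n => [|n IH]; last by rewrite !exprS; apply: germ_eqM.
by rewrite !expr0; have [] := germ_eq_in h; apply: germ_eq1.
Qed.

Lemma germ_eq_subr0 U (s t : sec U) x :
  oset U x -> germ_eq (s - t) (0 : sec U) x <-> germ_eq s t x.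
Proof.
move=> Ux; split=> h.
  by have := germ_eqD h (germ_eq_refl t Ux); rewrite subrK add0r.
by have := germ_eqB h (germ_eq_refl t Ux); rewrite subrr.
Qed.

Lemma sec_eq U (s t : sec U) : (forall x, oset U x -> germ_eq s t x) -> s = t.
Proof.
move=> h; pose I := {x | oset U x}.
have /choice [W hW] : forall i : I, exists W : opens X, oset W (sval i) /\
    exists hW : W `<=` U, res hW s = res hW t.
  move=> [x Ux]; have [W [k [k' [Wx e]]]] := h x Ux; exists W; split=> //.
  by exists k; rewrite e; apply: res_irr.
have hWU i : W i `<=` U by case: (hW i) => _ [].
have cov : U `<=` \bigcup_i W i.
  by move=> x Ux; exists (exist _ x Ux) => //; case: (hW (exist _ x Ux)).
have cmp i j (O : opens X) (hi : O `<=` W i) (hj : O `<=` W j) :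
    res hi (res (hWU i) s) = res hj (res (hWU j) s).
  have hO : O `<=` U by move=> x /hi /hWU.
  by rewrite !(res_comp _ _ hO).
have [r [_ hr]] := sheaf_axiom hWU cov cmp.
rewrite -(hr s) // -(hr t) // => i; case: (hW i) => _ [hi e].
by rewrite (res_irr (hWU i) hi) -e; apply: res_irr.
Qed.

Lemma sec_empty U (s t : sec U) : (forall x, ~ oset U x) -> s = t.
Proof. by move=> h; apply: sec_eq => x /h. Qed.

Lemma glue U (F : X -> {W : opens X & sec W}) :
  (forall x, oset U x -> oset (projT1 (F x)) x) ->
  (forall x y z, oset U x -> oset U y -> oset U z ->
     oset (projT1 (F x)) z -> oset (projT1 (F y)) z ->
     germ_eq (projT2 (F x)) (projT2 (F y)) z) ->
  exists t : sec U, forall x z, oset U x -> oset U z -> oset (projT1 (F x)) z ->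
    germ_eq t (projT2 (F x)) z.
Proof.
move=> hF cmpF; pose I := {x | oset U x}.
pose W (i : I) := capo (projT1 (F (sval i))) U.
have hWU i : W i `<=` U by move=> x [].
have hW i : W i `<=` projT1 (F (sval i)) by move=> x [].
have cov : U `<=` \bigcup_i W i.
  by move=> x Ux; exists (exist _ x Ux) => //; split=> //; apply: hF.
have cmp i j (O : opens X) (hi : O `<=` W i) (hj : O `<=` W j) :
    res hi (res (hW i) (projT2 (F (sval i)))) = res hj (res (hW j) (projT2 (F (sval j)))).
  apply: sec_eq => z Oz; have [zi Uz] := hi z Oz; have [zj _] := hj z Oz.
  apply/germ_eq_resl => //; apply/germ_eq_resr => //; apply/germ_eq_resl => //; apply/germ_eq_resr => //.
  by apply: cmpF => //; apply: svalP.
have [t [ht _]] := sheaf_axiom hWU cov cmp.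
exists t => x z Ux Uz xz; pose i : I := exist _ x Ux.
have Wz : oset (W i) z by split.
by apply/(germ_eq_resl (hWU i) t) => //; rewrite ht; apply: germ_eq_res.
Qed.

Lemma germ_eq_unit U V (s : sec U) (t : sec V) x : germ_eq s t x -> unit_at s x -> unit_at t x.
Proof.
move=> e [W [h [Wx [b hb]]]].
have [O [k [k' [Ox i e']]]] := germ_eq_shrink Wx e.
exists O, k'; split=> //; exists (res i b); rewrite -e' -(res_comp h i) -rmorphM hb.
exact: rmorph1.
Qed.

Lemma unit_at_in U (s : sec U) x : unit_at s x -> oset U x.
Proof. by case=> W [h [Wx _]]; apply: h. Qed.

Lemma unit_at_res U V (h : V `<=` U) (s : sec U) x :
  oset V x -> unit_at (res h s) x <-> unit_at s x.
Proof.
move=> Vx; split; apply: germ_eq_unit; first exact: germ_eq_res.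
by apply: germ_eq_sym; apply: germ_eq_res.
Qed.

Lemma unit_atM U (s t : sec U) x : unit_at (s * t) x <-> unit_at s x /\ unit_at t x.
Proof.
split=> [[W [h [Wx [b hb]]]]|[[W [h [Wx [b hb]]]] [O [k [Ox [c hc]]]]]].
  rewrite rmorphM in hb; split; exists W, h; split=> //.
    by exists (res h t * b); rewrite mulrA.
  by exists (res h s * b); rewrite mulrA [res h t * _]mulrC.
have i1 : capo W O `<=` W by move=> y [].
have i2 : capo W O `<=` O by move=> y [].
have i : capo W O `<=` U by move=> y /i1 /h.
exists (capo W O), i; split=> //; exists (res i1 b * res i2 c).
rewrite rmorphM -(res_comp h i1 i s) -(res_comp k i2 i t) mulrACA -!rmorphM hb hc.
by rewrite !rmorph1 mulr1.
Qed.

Lemma unit_at1 U x : oset U x -> unit_at (1 : sec U) x.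
Proof.
by move=> Ux; exists U, (fun y h => h); split=> //; exists 1; rewrite rmorph1 mulr1.
Qed.

Lemma unit_atX U (s : sec U) n x : unit_at s x -> unit_at (s ^+ n) x.
Proof.
move=> h; elim: n => [|n IH]; first by rewrite expr0; apply: unit_at1; apply: unit_at_in h.
by rewrite exprS; apply/unit_atM.
Qed.

End Germs.

Section Charts.

Section OneChart.
Variables (X : ringed_space) (U : opens X) (A : comPzRingType).
Variables (h : X -> set A) (theta : {rmorphism A -> sec U}).
Hypothesis chart : spec_chart h theta.

Lemma chart_prime x : oset U x -> prime_ideal (h x). Proof. by case: chart => H *; apply: H. Qed.
Lemma chart_inj x y : oset U x -> oset U y -> h x = h y -> x = y.
Proof. by case: chart => ? H *; apply: H. Qed.
Lemma chart_surj P : prime_ideal P -> exists2 x, oset U x & h x = P.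
Proof. by case: chart => ? ? H *; apply: H. Qed.

Lemma chart_open_iff W : W `<=` U ->
  (open W <-> exists E : set A, forall x, oset U x -> (W x <-> exists2 f, E f & ~ h x f)).
Proof. by case: chart => ? ? ? H *; apply: H. Qed.

Lemma basic_open (f : A) : open [set x | oset U x /\ ~ h x f].
Proof.
apply/(chart_open_iff (fun x => @proj1 _ _)); exists [set f] => x Ux /=; split.
  by case=> _ hf; exists f.
by case=> _ -> hf.
Qed.

Definition basic (f : A) : opens X := Opens (basic_open f).

Lemma basic_sub f : basic f `<=` U. Proof. by move=> x []. Qed.

Lemma basic_loc f : is_localization f (fun a => res (@basic_sub f) (theta a)).
Proof.
by case: chart => _ _ _ _; apply => x Ux; split=> [[]|].
Qed.

Lemma basic_mul f e x : oset (basic (f * e)) x <-> oset (basic f) x /\ oset (basic e) x.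
Proof.
split=> [[Ux hx]|[[Ux hf] [_ he]]].
  have [[_ _ hM] _ _] := chart_prime Ux; split; split=> // h'; apply: hx.
    by rewrite mulrC; apply: hM.
  exact: hM.
by split=> //; have [_ _ hP] := chart_prime Ux; move=> /hP [].
Qed.

Lemma chart_basis x (W : opens X) : oset U x -> oset W x ->
  exists f, oset (basic f) x /\ basic f `<=` W.
Proof.
move=> Ux Wx; have hW : capo W U `<=` U by move=> y [].
have [E hE] := (chart_open_iff hW).1 (opensP (capo W U)).
have [f Ef hf] := (hE x Ux).1 (conj Wx Ux).
by exists f; split=> // y [Uy hy]; apply: (proj1 ((hE y Uy).2 _)); exists f.
Qed.

Lemma basic_frac f (V : opens X) (hV : basic f `<=` V) (s : sec V) :
  exists a n, res hV s * res (@basic_sub f) (theta f) ^+ n = res (@basic_sub f) (theta a).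
Proof. by have [_ /(_ (res hV s)) [a [n e]] _] := basic_loc f; exists a, n. Qed.

Lemma basic_zero f a : res (@basic_sub f) (theta a) = 0 -> exists n, f ^+ n * a = 0.
Proof. by have [_ _ H] := basic_loc f; apply: H. Qed.

Lemma basic_invertible f : invertible (res (@basic_sub f) (theta f)).
Proof. by case: (basic_loc f). Qed.

(** Identifies the prime of a point with the non-units there, so that later arguments can speak of
    [unit_at] instead of a chart. If [b] inverts [a] on D(f), write b = c / f^n; some f^m (a c -
    f^n) is zero, and [a] in the prime would force [f] into it. *)
Lemma chart_unit x a : oset U x -> unit_at (theta a) x <-> ~ h x a.
Proof.
move=> Ux; split=> [[W [k [Wx [b hb]]]] hxa|hxa]; last first.
  by exists (basic a), (@basic_sub a); split=> //; apply: basic_invertible.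
have [f [fx fW]] := chart_basis Ux Wx; have [_ hf] := fx.
have [c [n hc]] := basic_frac fW b.
have e : res (@basic_sub f) (theta (a * c - f ^+ n)) = 0.
  have ha : res (@basic_sub f) (theta a) = res fW (res k (theta a)) by rewrite (res_comp k fW (@basic_sub f)).
  rewrite rmorphB rmorphM rmorphB rmorphM /= -hc ha mulrA -[_ * res fW b]rmorphM hb.
  by rewrite rmorph1 mul1r !rmorphXn subrr.
have [m hm] := basic_zero e.
have [[h0 hD hM] _ _] := chart_prime Ux; apply: hf.
apply: (@prime_ideal_exp _ _ _ (m + n) (chart_prime Ux)); rewrite exprD.
have -> : f ^+ m * f ^+ n = f ^+ m * c * a by apply/eqP; rewrite -subr_eq0 -oppr_eq0 -[X in _ == X]hm; apply/eqP; ring.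
exact: hM.
Qed.

Lemma basic_frac_unit f (V : opens X) (hV : basic f `<=` V) (s : sec V) a n x :
  oset (basic f) x ->
  res hV s * res (@basic_sub f) (theta f) ^+ n = res (@basic_sub f) (theta a) ->
  (unit_at s x <-> ~ h x a).
Proof.
move=> fx e; have [Ux hf] := fx.
rewrite -(chart_unit a Ux) -(unit_at_res hV s fx) -(unit_at_res (@basic_sub f) _ fx) -e.
split=> [hs|/unit_atM [] //]; apply/unit_atM; split=> //.
by apply: unit_atX; apply/(unit_at_res _ _ fx)/(chart_unit _ Ux).
Qed.

(** Expresses that stalks are local: near [x] every section is a fraction a / f^n of the chart, and
    it is a unit at [x] exactly when [a] lies outside [h x]. *)
Lemma chart_nonunit_prime (V : opens X) x : oset U x -> oset V x ->
  prime_ideal [set s : sec V | ~ unit_at s x].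
Proof.
move=> Ux Vx; have [f [fx fV]] := chart_basis Ux Vx; have [_ hf] := fx.
have [[h0 hD hM] h1 hP] := chart_prime Ux.
have nu (s : sec V) : exists a n, res fV s * res (@basic_sub f) (theta f) ^+ n =
    res (@basic_sub f) (theta a) /\ (~ unit_at s x <-> h x a).
  have [a [n e]] := basic_frac fV s; exists a, n; split=> //.
  rewrite (basic_frac_unit fx e); split=> [|hh]; last by apply.
  exact: contrapT.
split; last 2 first.
- by move=> /= /(_ (unit_at1 Vx)).
- move=> s t /= hst; apply: contrapT => /not_orP [/contrapT hs /contrapT ht].
  by apply: hst; apply/unit_atM.
split=> /=.
- have [a [n [e ->]]] := nu 0; have [m hm] : exists m, f ^+ m * a = 0.
    by apply: basic_zero; rewrite -e rmorph0 mul0r.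
  have : h x (f ^+ m * a) by rewrite hm.
  by case/hP => // /(prime_ideal_exp (chart_prime Ux)) /hf.
- move=> s t; have [a [n [ea ->]]] := nu s; have [b [m [eb ->]]] := nu t => ha hb.
  have e : res fV (s + t) * res (@basic_sub f) (theta f) ^+ (n + m) =
      res (@basic_sub f) (theta (f ^+ m * a + f ^+ n * b)).
    rewrite !rmorphD !rmorphM -ea -eb !rmorphXn exprD; ring.
  by rewrite (basic_frac_unit fx e); apply; apply: hD; apply: hM.
- by move=> s t ht /unit_atM [].
Qed.

(** [U] is the basic open set of 1, and localizing at 1 changes nothing. *)
Lemma chart_theta_surj s : exists a, theta a = s.
Proof.
have hU : forall x, oset U x -> (oset U x <-> ~ h x 1).
  by move=> x Ux; split=> // _; case: (chart_prime Ux).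
have [_ _ _ _ H] := chart.
have [_ /(_ s) [a [n e]] _] := H 1 U (fun y hy => hy) hU.
by exists a; move: e; rewrite !res_id rmorph1 expr1n mulr1.
Qed.

Lemma chart_theta_inj a : theta a = 0 -> a = 0.
Proof.
have hU : forall x, oset U x -> (oset U x <-> ~ h x 1).
  by move=> x Ux; split=> // _; case: (chart_prime Ux).
have [_ _ _ _ H] := chart; have [_ _ H'] := H 1 U (fun y hy => hy) hU.
by move=> e; have [|n] := H' a; rewrite ?res_id // expr1n mul1r.
Qed.

End OneChart.

Section AffineOpen.
Variables (X : ringed_space) (U : opens X).
Hypothesis aU : affine U.

Lemma affine_basis x (W : opens X) : oset U x -> oset W x ->
  exists (f : sec U) (D : opens X), [/\ unit_at f x, D `<=` W, D `<=` U &
    forall y, oset U y -> (oset D y <-> unit_at f y)].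
Proof.
case: aU => A [h [th ch]] Ux Wx; have [f [fx fW]] := chart_basis ch Ux Wx.
exists (th f), (basic ch f); split=> //; first by apply/(chart_unit ch) => //; case: fx.
  exact: basic_sub.
by move=> y Uy; rewrite (chart_unit ch) //; split=> [[]|].
Qed.

Lemma affine_prime (P : set (sec U)) : prime_ideal P ->
  exists2 x, oset U x & forall s, P s <-> ~ unit_at s x.
Proof.
case: aU => A [h [th ch]] [[P0 PD PM] P1 PP].
have pA : prime_ideal [set a | P (th a)].
  split; last 2 first.
  - by rewrite /= rmorph1.
  - by move=> a b /=; rewrite rmorphM => /PP.
  split=> /= [|a b|a b]; first by rewrite rmorph0.
    by rewrite rmorphD; apply: PD.
  by rewrite rmorphM; apply: PM.
have [x Ux hx] := chart_surj ch pA; exists x => // s.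
have [a <-] := chart_theta_surj ch s; rewrite (chart_unit ch) // hx.
by split=> [Pa|/contrapT //]; apply.
Qed.

Lemma affine_frac (f : sec U) (D : opens X) (hD : D `<=` U) (s : sec D) :
  (forall y, oset U y -> (oset D y <-> unit_at f y)) ->
  exists t n, s * res hD f ^+ n = res hD t.
Proof.
case: aU => A [h [th ch]] hf; have [a ea] := chart_theta_surj ch f.
have hD' y : oset U y -> (oset D y <-> ~ h y a).
  by move=> Uy; rewrite hf // -ea (chart_unit ch).
have [_ _ _ _ /(_ a D hD hD') [_ /(_ s) [t [n e]] _]] := ch.
by exists (th t), n; rewrite -ea.
Qed.

End AffineOpen.

Section SchemePoints.
Variable X : scheme.

Lemma nonunit_prime (V : opens X) x : oset V x ->
  prime_ideal [set s : sec V | ~ unit_at s x].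
Proof.
move=> Vx; have [U Ux [A [h [th ch]]]] := locally_affine x.
exact: (chart_nonunit_prime ch).
Qed.

Lemma unit_at_neq0 (V : opens X) x : ~ unit_at (0 : sec V) x.
Proof. by move=> h; have [[+ _ _] _ _] := nonunit_prime (unit_at_in h). Qed.

Lemma unit_at_exp (V : opens X) (s : sec V) n x : oset V x -> unit_at (s ^+ n) x -> (0 < n)%N -> unit_at s x.
Proof.
by case: n => // n _; rewrite exprS => /unit_atM [].
Qed.
End SchemePoints.
End Charts.

(** * The closed subscheme q = 0 *)

Section ModpImmersion.

Lemma germ_eqN0_cancel (X : ringed_space) (U : opens X) (u s : sec U) x :
  unit_at u x -> germ_eq (s * u) (0 : sec U) x -> germ_eq s (0 : sec U) x.
Proof.
case=> W [h [Wx [b hb]]] hs; apply/(germ_eq_resl h) => //.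
have Ux := h x Wx.
have h1 : germ_eq (res h (s * u)) (0 : sec W) x.
  by apply/(germ_eq_resl h) => //; apply: germ_eq_trans hs (germ_eq0 Ux Wx).
have := germ_eqM h1 (germ_eq_refl b Wx); rewrite mul0r rmorphM -mulrA hb mulr1 => h2.
exact: germ_eq_trans h2 (germ_eq0 Wx Ux).
Qed.

Variables (X : scheme) (P : ringed_space) (q : nat) (i : P -> X).
Hypothesis hi : continuous i.
Variable sh : forall V : opens X, {rmorphism sec V -> sec (Defs.preim hi V)}.

Definition sharp_compat := forall (V V' : opens X) (h : V' `<=` V)
  (h' : Defs.preim hi V' `<=` Defs.preim hi V) (s : sec V), sh V' (res h s) = res h' (sh V s).

(* The properties of the closed subscheme q = 0 of X that determine P locally. *)
Record modp_immersion : Prop := ModpImmersion {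
  imm_sharp : sharp_compat;
  imm_inj : forall x y, i x = i y -> x = y;
  imm_open : forall (O : opens P) x, oset O x ->
    exists W : opens X, oset W (i x) /\ forall y, oset W (i y) -> oset O y;
  imm_image : forall z, (exists x, i x = z) <-> ~ unit_at (q%:R : sec (whole X)) z;
  imm_surj : forall (U : opens P) (t : sec U) x, oset U x ->
    exists (W : opens X) (s : sec W), oset W (i x) /\ germ_eq t (sh W s) x;
  imm_ker : forall (V : opens X) (s : sec V) x, oset V (i x) ->
    germ_eq (sh V s) (0 : sec (Defs.preim hi V)) x ->
    exists (W : opens X) (r : sec W), germ_eq s (q%:R * r) (i x);
  imm_char : q%:R = 0 :> sec (whole P) }.

Lemma germ_eq_sharp (hsh : sharp_compat) (V V' : opens X) (s : sec V) (t : sec V') x :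
  germ_eq s t (i x) -> germ_eq (sh V s) (sh V' t) x.
Proof.
case=> W [h [h' [Wx e]]].
have k : Defs.preim hi W `<=` Defs.preim hi V by move=> y /h.
have k' : Defs.preim hi W `<=` Defs.preim hi V' by move=> y /h'.
by exists (Defs.preim hi W), k, k'; split=> //; rewrite -!hsh e.
Qed.

Hypothesis imm : modp_immersion.
Let hsh := imm_sharp imm.

Variables (W : opens X) (A : comPzRingType) (h : X -> set A).
Variable theta : {rmorphism A -> sec W}.
Hypothesis ch : spec_chart h theta.

Definition modp_map : {rmorphism A -> sec (Defs.preim hi W)} := sh W \o theta.
Local Notation G := modp_map.
Local Notation basic := (basic ch).

Lemma char0 (U : opens P) : q%:R = 0 :> sec U.
Proof.
have k : U `<=` whole P by [].
by rewrite -(rmorph_nat (res k)) (imm_char imm) rmorph0.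
Qed.

Lemma chart_natE y : oset W y -> h y q%:R <-> exists x, i x = y.
Proof.
move=> Wy; rewrite (imm_image imm).
have k : W `<=` whole X by [].
have -> : unit_at (q%:R : sec (whole X)) y <-> unit_at (theta q%:R) y.
  by rewrite rmorph_nat -(rmorph_nat (res k)) unit_at_res.
by rewrite (chart_unit ch) //; split=> [hy|/contrapT //]; apply.
Qed.

(* Instead of finite covers of the quasi-compact D(f), the next lemmas use that
   an ideal J none of whose elements is a power of f lies in a prime avoiding f;
   the local structure at that point produces an element of J outside it. *)
Lemma modp_ker (a f : A) :
  (forall x, oset (basic f) (i x) -> germ_eq (G a) (0 : sec (Defs.preim hi W)) x) ->
  exists n b, f ^+ n * a = q%:R * b.
Proof.
move=> hf; pose J : set A := [set b | exists r, b * a = q%:R * r].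
have iJ : is_ideal J.
  split=> [|x y [r hr] [t ht]|x y [r hr]].
  - by exists 0; rewrite mul0r mulr0.
  - by exists (r + t); rewrite mulrDl hr ht mulrDr.
  - by exists (x * r); rewrite -mulrA hr; ring.
apply: contrapT => nJ; have hJ n : ~ J (f ^+ n).
  by move=> [r hr]; apply: nJ; exists n, r.
have [Q [pQ JQ Qf]] := prime_avoiding iJ hJ.
have [y Wy hy] := chart_surj ch pQ; rewrite -hy in JQ Qf.
have hq : h y q%:R by apply: JQ; exists a.
have [x xy] := (chart_natE Wy).1 hq; subst y.
have fx : oset (basic f) (i x) by split.
have [W0 [r [O [k [k' [Ox e]]]]]] := imm_ker imm Wy (hf x fx).
have [e0 [e0x e0O]] := chart_basis ch Wy Ox.
have [r' [n hr]] := basic_frac e0O (res k' r).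
have hz : res (@basic_sub _ _ _ _ _ ch e0) (theta (e0 ^+ n * a - q%:R * r')) = 0.
  have ha : res (@basic_sub _ _ _ _ _ ch e0) (theta a) = res e0O (res k (theta a)).
    by rewrite (res_comp _ _ (@basic_sub _ _ _ _ _ ch e0)).
  rewrite rmorphB !rmorphM rmorphB !rmorphM /= ha e -hr !rmorphM !rmorph_nat !rmorphXn.
  by rewrite mulrCA [X in _ - _ * X]mulrC subrr.
have [m hm] := basic_zero hz; case: e0x => _; apply.
apply: (@prime_ideal_exp _ _ _ (m + n) (chart_prime ch Wy)); apply: JQ.
exists (e0 ^+ m * r').
by apply/eqP; rewrite -subr_eq0 -hm exprD; apply/eqP; ring.
Qed.

(** [imm_surj] lifts [t] near [x] to a section on [X], which is a fraction in the chart; [imm_open]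
    allows a basic open set so small that over it the lift agrees with [t]. *)
Lemma modp_locrep (D : opens P) (hD : D `<=` Defs.preim hi W) (t : sec D) x (W' : opens X) :
  oset D x -> oset W' (i x) ->
  exists e k a, [/\ oset (basic e) (i x), basic e `<=` W' & forall x', oset (basic e) (i x') ->
    oset D x' /\ germ_eq (t * res hD (G e) ^+ k) (G a) x'].
Proof.
move=> Dx W'x; have Wx : oset W (i x) := hD x Dx.
have [W0 [s [W0x e0]]] := imm_surj imm t Dx.
have [O [kD [k0 [Ox eO]]]] := e0.
have [W1 [W1x W1O]] := imm_open imm Ox.
have Cx : oset (capo (capo W0 W1) W') (i x) by [].
have [e [ex eC]] := chart_basis ch Wx Cx.
have eW0 : basic e `<=` W0 by move=> y /eC [] [].
have [a [n ha]] := basic_frac eW0 s.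
exists e, n, a; split=> //; first by move=> y /eC [].
move=> x' ex'; have Ox' : oset O x' by apply: W1O; case: (eC _ ex') => [] [].
have Dx' := kD _ Ox'; split=> //.
have g1 : germ_eq t (sh W0 s) x' by exists O, kD, k0.
have g2 : germ_eq t (sh (basic e) (res eW0 s)) x'.
  by apply: germ_eq_trans g1 (germ_eq_sharp hsh (germ_eq_sym (germ_eq_res eW0 s ex'))).
have bs := @basic_sub _ _ _ _ _ ch e.
have g3 : germ_eq (res hD (G e)) (sh (basic e) (res bs (theta e))) x'.
  by apply/germ_eq_resl => //; apply: (germ_eq_sharp hsh); apply/germ_eq_sym/germ_eq_res.
have hsa : sh (basic e) (res eW0 s) * sh (basic e) (res bs (theta e)) ^+ n =
    sh (basic e) (res bs (theta a)).
  by rewrite !(res_irr bs (@basic_sub _ _ _ _ _ ch e)) -ha rmorphM rmorphXn.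
have := germ_eqM g2 (germ_eqX n g3); rewrite hsa => g4.
by apply: germ_eq_trans g4 (germ_eq_sharp hsh (germ_eq_res _ _ _)).
Qed.

Lemma modp_unit_basic (D : opens P) (hD : D `<=` Defs.preim hi W) e x :
  oset D x -> oset (basic e) (i x) -> unit_at (res hD (G e)) x.
Proof.
move=> Dx ex; apply/unit_at_res => //.
have := basic_invertible ch e => -[b hb].
have k : Defs.preim hi (basic e) `<=` Defs.preim hi W by move=> y [].
exists (Defs.preim hi (basic e)), k; split=> //; exists (sh _ b).
by rewrite /modp_map /= -(hsh (@basic_sub _ _ _ _ _ ch e)) -rmorphM hb rmorph1.
Qed.

Lemma modp_annihilate (D : opens P) (f e : A) (z : sec D) (hD : D `<=` Defs.preim hi W) :
  (forall x, oset D x <-> oset (basic f) (i x)) ->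
  (forall x, oset D x -> oset (basic e) (i x) -> germ_eq z (0 : sec D) x) ->
  exists l, z * res hD (G e) ^+ l = 0.
Proof.
move=> Df hz.
pose J : set A := [set b | exists l, forall x, oset D x -> oset (basic b) (i x) ->
  germ_eq (z * res hD (G e) ^+ l) (0 : sec D) x].
have mono l m x : oset D x -> germ_eq (z * res hD (G e) ^+ l) (0 : sec D) x ->
    germ_eq (z * res hD (G e) ^+ (l + m)) (0 : sec D) x.
  move=> Dx hl; rewrite exprD mulrA -[0](mul0r (res hD (G e) ^+ m)).
  exact: germ_eqM hl (germ_eq_refl _ Dx).
have iJ : is_ideal J.
  split=> [|b b' [l hl] [m hm]|b b' [l hl]].
  - by exists 0%N => x Dx [Wx]; have [[H _ _] _ _] := chart_prime ch Wx.
  - exists (l + m)%N => x Dx [Wx hx].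
    have [_ HD _] := (let: And3 H _ _ := chart_prime ch Wx in H).
    have [hb|hb] := pselect (h (i x) b).
      rewrite addnC; apply: mono => //; apply: hm => //; split=> // hb'.
      by apply: hx; apply: HD.
    by apply: mono => //; apply: hl.
  - by exists l => x Dx /basic_mul [_ hx]; apply: hl.
suff [n [l hl]] : exists n, J (f ^+ n).
  exists l; apply: sec_eq => x Dx; apply: hl => //.
  have [Wx hx] := (Df x).1 Dx; split=> // /(prime_ideal_exp (chart_prime ch Wx)) //.
apply: contrapT => nJ; have hJ n : ~ J (f ^+ n) by move=> H; apply: nJ; exists n.
have [Q [pQ JQ Qf]] := prime_avoiding iJ hJ.
have [y Wy hy] := chart_surj ch pQ; rewrite -hy in JQ Qf.
have hq : h y q%:R.
  apply: JQ; exists 0%N => x Dx [Wx hx]; case: hx.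
  by apply/chart_natE => //; exists x.
have [x xy] := (chart_natE Wy).1 hq; subst y.
have Dx : oset D x by apply/Df.
have [e' [k [a [e'x _ he']]]] := modp_locrep hD z Dx Wy.
(* Near [i x], [z] is a / e'^k, and [z = 0] on D(e) makes [a] vanish on D(e e'). By [modp_ker] some
   (e e')^n a is a multiple of [q], hence zero on [P]. So z e^n vanishes on D(e'), which puts [e']
   in [J] although it lies outside the prime. *)
have [n [b hn]] : exists n b, (e * e') ^+ n * a = q%:R * b.
  apply: modp_ker => x' /basic_mul [ex' ex''].
  have [Dx' ga] := he' x' ex''; apply: germ_eq_trans (germ_eq_sym ga) _.
  have := germ_eqM (hz x' Dx' ex') (germ_eq_refl (res hD (G e') ^+ k) Dx').
  by rewrite mul0r => g; apply: germ_eq_trans g (germ_eq0 Dx' _); apply: (hD).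
case: e'x => _; apply; apply: JQ; exists n => x' Dx' ex'.
have [_ ga] := he' x' ex'.
have g0 : germ_eq (G ((e * e') ^+ n * a)) (0 : sec D) x'.
  rewrite hn rmorphM rmorph_nat char0 mul0r; apply: germ_eq0 => //; exact: (hD).
apply: (@germ_eqN0_cancel _ _ (res hD (G e') ^+ (k + n))).
  by apply: unit_atX; apply: modp_unit_basic.
apply: germ_eq_trans g0.
have g1 : germ_eq (res hD (G ((e * e') ^+ n))) (G ((e * e') ^+ n)) x' by apply: germ_eq_res.
have := germ_eqM g1 ga; rewrite -!rmorphM => g2.
apply: germ_eq_trans g2; rewrite !rmorphXn !rmorphM exprD exprMn.
set u := res hD (G e); set v := res hD (G e').
have -> : z * u ^+ n * (v ^+ k * v ^+ n) = u ^+ n * v ^+ n * (z * v ^+ k) by ring.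
exact: germ_eq_refl.
Qed.

Lemma modp_frac (D : opens P) (f : A) (t : sec D) (hD : D `<=` Defs.preim hi W) :
  (forall x, oset D x <-> oset (basic f) (i x)) ->
  exists a n, t * res hD (G f) ^+ n = res hD (G a).
Proof.
move=> Df; pose J : set A := [set b | exists a, t * res hD (G b) = res hD (G a)].
have iJ : is_ideal J.
  split=> [|b b' [a ha] [a' ha']|b b' [a ha]].
  - by exists 0; rewrite !rmorph0 mulr0.
  - by exists (a + a'); rewrite !rmorphD mulrDr ha ha'.
  - by exists (b * a); rewrite !rmorphM mulrCA ha.
suff [n [a ha]] : exists n, J (f ^+ n) by exists a, n; rewrite -!rmorphXn.
apply: contrapT => nJ; have hJ n : ~ J (f ^+ n) by move=> H; apply: nJ; exists n.
have [Q [pQ JQ Qf]] := prime_avoiding iJ hJ.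
have [y Wy hy] := chart_surj ch pQ; rewrite -hy in JQ Qf.
have hq : h y q%:R by apply: JQ; exists 0; rewrite !rmorph_nat char0 mulr0 !rmorph0.
have [x xy] := (chart_natE Wy).1 hq; subst y.
have Dx : oset D x by apply/Df.
have [e [k [a [ex _ he]]]] := modp_locrep hD t Dx Wy.
(* [t * e^k - a] vanishes on D(e), so a power of [e] kills it on all of [D]; therefore
   [e ^+ (k + l)] belongs to [J]. *)
have [l hl] : exists l, (t * res hD (G e) ^+ k - res hD (G a)) * res hD (G e) ^+ l = 0.
  apply: (modp_annihilate (f := f)) => // x' Dx' ex'; apply/germ_eq_subr0 => //.
  by apply/germ_eq_resr => //; case: (he x' ex').
case: ex => _; apply; apply: (prime_ideal_exp (chart_prime ch Wy)).
apply: (JQ (e ^+ (k + l))); exists (a * e ^+ l).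
apply/eqP; rewrite -subr_eq0 -hl exprD !rmorphM !rmorphXn; apply/eqP; ring.
Qed.

Lemma modp_surj (t : sec (Defs.preim hi W)) : exists a, G a = t.
Proof.
have D1 x : oset (Defs.preim hi W) x <-> oset (basic 1) (i x).
  by split=> [Wx|[]//]; split=> //; case: (chart_prime ch Wx).
have [a [n e]] := modp_frac t (fun y hy => hy) D1.
by exists a; move: e; rewrite !res_id rmorph1 expr1n mulr1.
Qed.

(** The coordinate ring is the ring of sections itself, with the identity as [theta]. It is A / qA
    in disguise: [modp_map] is onto by [modp_surj], with kernel controlled by [modp_ker], so points,
    open sets and fractions are all transported from [A]. *)
Lemma modp_spec_on : is_spec_on (Defs.preim hi W) (sec (Defs.preim hi W)).
Proof.
pose h' x : set (sec (Defs.preim hi W)) := [set t | exists2 a, h (i x) a & t = G a].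
have hprime x : oset W (i x) -> prime_ideal (h (i x)) by apply: (chart_prime ch).
have hG x a : oset W (i x) -> h' x (G a) <-> h (i x) a.
  move=> Wx; split=> [[a' ha' e]|ha]; last by exists a.
  have [n [b hn]] : exists n b, 1 ^+ n * (a - a') = q%:R * b.
    apply: modp_ker => x' [Wx' _]; rewrite rmorphB e subrr.
    exact: germ_eq_refl.
  have [[_ HD HM] _ _] := hprime x Wx.
  rewrite -(subrK a' a) -[a - a']mul1r -(expr1n _ n) hn; apply: HD => //.
  by rewrite mulrC; apply: HM; apply/chart_natE => //; exists x.
have hGset x : oset W (i x) -> h (i x) = [set a | h' x (G a)].
  by move=> Wx; apply/seteqP; split=> a /=; rewrite hG.
exists h', idfun; split.
- move=> x Wx; have [[H0 HD HM] H1 HP] := hprime x Wx; split; last 2 first.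
  + by rewrite -(rmorph1 G) hG.
  + move=> s t; have [a <-] := modp_surj s; have [b <-] := modp_surj t.
    by rewrite -rmorphM !hG // => /HP.
  split.
  + by exists 0; rewrite ?rmorph0.
  + by move=> _ _ [a ha ->] [b hb ->]; exists (a + b); [exact: HD|rewrite rmorphD].
  + move=> s _ [b hb ->]; have [a <-] := modp_surj s.
    by exists (a * b); [exact: HM|rewrite rmorphM].
- move=> x y Wx Wy e; apply: (imm_inj imm); apply: (chart_inj ch) => //.
  by rewrite !hGset // e.
- move=> Q [[Q0 QD QM] Q1 QP].
  have pQ : prime_ideal [set a | Q (G a)].
    split; last 2 first.
    + by rewrite /= !rmorph1.
    + by move=> a b /=; rewrite !rmorphM => /QP.
    split=> /= [|a b|a b]; first by rewrite !rmorph0.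
      by rewrite !rmorphD; apply: QD.
    by rewrite !rmorphM; apply: QM.
  have [y Wy hy] := chart_surj ch pQ.
  have [x xy] : exists x, i x = y.
    by apply/chart_natE => //; rewrite hy /= !rmorph_nat char0.
  subst y; exists x => //; apply/seteqP; split=> t; have [a <-] := modp_surj t.
    by rewrite hG // hy.
  by rewrite hG // hy.
- move=> O OW; split=> [oO|[E hE]].
    exists [set t | forall x, oset (Defs.preim hi W) x -> ~ h' x t -> O x] => x Wx.
    split=> [Ox|[t ht hxt]]; last exact: ht.
    have [W1 [W1x W1O]] := imm_open imm (O := Opens oO) Ox.
    have [f [fx fW1]] := chart_basis ch Wx W1x.
    exists (G f); last by rewrite hG //; case: fx.
    by move=> y Wy; rewrite hG // => hy; apply: W1O; apply: fW1.
  have -> : O = \bigcup_(a in [set a | E (G a)]) Defs.preim hi (basic a).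
    apply/seteqP; split=> [x Ox|x [a Ea [Wx hxa]]]; last first.
      by apply/(hE x Wx); exists (G a) => //; rewrite hG.
    have Wx := OW x Ox; have [t Et hxt] := (hE x Wx).1 Ox.
    by have [a ea] := modp_surj t; subst t; exists a => //; split=> //; rewrite -hG.
  by apply: bigcup_open => a _; apply: opensP.
- move=> t D hD hDt; have [f ef] := modp_surj t; subst t.
  have Df x : oset D x <-> oset (basic f) (i x).
    split=> [Dx|[Wx hx]]; last by apply/hDt => //; rewrite hG.
    by split; [exact: hD|rewrite -hG; [apply/hDt; [exact: hD|]|exact: hD]].
  split.
  + have [b hb] := basic_invertible ch f.
    have k : D `<=` Defs.preim hi (basic f) by move=> x /Df.
    have k' : Defs.preim hi (basic f) `<=` Defs.preim hi W by move=> x [].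
    exists (res k (sh _ b)); rewrite /= -(res_comp k' k hD) -rmorphM.
    by rewrite -(hsh (@basic_sub _ _ _ _ _ ch f)) -rmorphM hb !rmorph1.
  + move=> b; have [a [n e]] := modp_frac b hD Df; exists (G a), n; exact: e.
  + move=> s; have [a ea] := modp_surj s; subst s => /= e.
    have [n [b hn]] : exists n b, f ^+ n * a = q%:R * b.
      apply: modp_ker => x /Df Dx; apply/(germ_eq_resl hD) => //; rewrite e.
      by apply: germ_eq0 => //; apply: (hD).
    exists n; transitivity (G (f ^+ n * a)); first by rewrite rmorphM rmorphXn.
    by rewrite hn rmorphM rmorph_nat char0 mul0r.
Qed.

End ModpImmersion.

(** * Products of families of rings *)

Section DepProduct.

Definition dprod (I : Type) (F : I -> comPzRingType) : Type := forall i, F i.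

Variables (I : Type) (F : I -> comPzRingType).
Local Notation T := (dprod F).

HB.instance Definition _ := gen_eqMixin T.
HB.instance Definition _ := gen_choiceMixin T.

Let dext (f g : T) : (forall i, f i = g i) -> f = g.
Proof. exact: functional_extensionality_dep. Qed.

Definition dprod_add (f g : T) : T := fun i => f i + g i.
Definition dprod_mul (f g : T) : T := fun i => f i * g i.
Definition dprod_opp (f : T) : T := fun i => - f i.

Lemma dprod_addA : associative dprod_add.
Proof. by move=> f g h; apply: dext => i; rewrite /dprod_add addrA. Qed.
Lemma dprod_addC : commutative dprod_add.
Proof. by move=> f g; apply: dext => i; rewrite /dprod_add addrC. Qed.
Lemma dprod_add0 : left_id ((fun=> 0) : T) dprod_add.
Proof. by move=> f; apply: dext => i; rewrite /dprod_add add0r. Qed.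
Lemma dprod_addN : left_inverse ((fun=> 0) : T) dprod_opp dprod_add.
Proof. by move=> f; apply: dext => i; rewrite /dprod_add addNr. Qed.
Lemma dprod_mulA : associative dprod_mul.
Proof. by move=> f g h; apply: dext => i; rewrite /dprod_mul mulrA. Qed.
Lemma dprod_mulC : commutative dprod_mul.
Proof. by move=> f g; apply: dext => i; rewrite /dprod_mul mulrC. Qed.
Lemma dprod_mul1 : left_id ((fun=> 1) : T) dprod_mul.
Proof. by move=> f; apply: dext => i; rewrite /dprod_mul mul1r. Qed.
Lemma dprod_mulD : left_distributive dprod_mul dprod_add.
Proof. by move=> f g h; apply: dext => i; rewrite /dprod_mul mulrDl. Qed.

HB.instance Definition _ := GRing.isZmodule.Build T
  dprod_addA dprod_addC dprod_add0 dprod_addN.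
HB.instance Definition _ := GRing.Zmodule_isComPzRing.Build T
  dprod_mulA dprod_mulC dprod_mul1 dprod_mulD.

End DepProduct.

(** * The sheaf O_X / q on the closed set where q is not a unit *)

Section ModpSheaf.

Variables (X : ringed_space) (q : nat).

(** Equality of germs at [x] in O_X / q. *)
Definition cong (W W' : opens X) (s : sec W) (t : sec W') (x : X) : Prop :=
  exists (V : opens X) (h : V `<=` W) (h' : V `<=` W') (r : sec V),
    oset V x /\ res h s = res h' t + q%:R * r.

Lemma germ_eq_cong (W W' : opens X) (s : sec W) (t : sec W') x : germ_eq s t x -> cong s t x.
Proof.
by case=> V [h [h' [Vx e]]]; exists V, h, h', 0; rewrite mulr0 addr0.
Qed.

Lemma cong_sym (W W' : opens X) (s : sec W) (t : sec W') x : cong s t x -> cong t s x.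
Proof.
case=> V [h [h' [r [Vx e]]]]; exists V, h', h, (- r); split=> //.
by rewrite e mulrN addrK.
Qed.

Lemma cong_shrink (W W' : opens X) (s : sec W) (t : sec W') x (O : opens X) :
  oset O x -> cong s t x ->
  exists (V : opens X) (h : V `<=` W) (h' : V `<=` W') (r : sec V),
    [/\ oset V x, V `<=` O & res h s = res h' t + q%:R * r].
Proof.
move=> Ox [V [h [h' [r [Vx e]]]]].
have i : capo O V `<=` V by move=> y [].
have k : capo O V `<=` W by move=> y /i /h.
have k' : capo O V `<=` W' by move=> y /i /h'.
exists (capo O V), k, k', (res i r); split=> //; first by move=> y [].
by rewrite -(res_comp h i k) e rmorphD rmorphM rmorph_nat (res_comp _ _ k').
Qed.

Lemma cong_trans (W W' W'' : opens X) (s : sec W) (t : sec W') (u : sec W'') x :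
  cong s t x -> cong t u x -> cong s u x.
Proof.
move=> [V [h [h' [r [Vx e]]]]] /(cong_shrink Vx) [O [k [k' [r' [Ox OV e']]]]].
have l : O `<=` W by move=> y /OV /h.
exists O, l, k', (r' + res OV r); split=> //.
rewrite -(res_comp h OV l) e rmorphD rmorphM rmorph_nat (res_comp _ _ k) e'.
by rewrite mulrDr addrA.
Qed.

Lemma congB (W W' : opens X) (s s' : sec W) (t t' : sec W') x :
  cong s t x -> cong s' t' x -> cong (s - s') (t - t') x.
Proof.
move=> [V [h [h' [r [Vx e]]]]] /(cong_shrink Vx) [O [k [k' [r' [Ox OV e']]]]].
exists O, k, k', (res OV r - r'); split=> //.
rewrite !rmorphB e' -(res_comp h OV k) e rmorphD rmorphM rmorph_nat (res_comp _ _ k').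
by rewrite mulrBr opprD addrACA.
Qed.

Lemma congM (W W' : opens X) (s s' : sec W) (t t' : sec W') x :
  cong s t x -> cong s' t' x -> cong (s * s') (t * t') x.
Proof.
move=> [V [h [h' [r [Vx e]]]]] /(cong_shrink Vx) [O [k [k' [r' [Ox OV e']]]]].
exists O, k, k', (res OV r * (res k' t' + q%:R * r') + res k' t * r'); split=> //.
rewrite !rmorphM e' -(res_comp h OV k) e rmorphD rmorphM rmorph_nat (res_comp _ _ k').
by ring.
Qed.

Definition modp_point := {x : X | `[< ~ unit_at (q%:R : sec (whole X)) x >]}.
Definition modp_space : topologicalType := initial_topology (val : modp_point -> X).
Definition modp_emb (z : modp_space) : X := val (z : modp_point).

Lemma modp_emb_cont : continuous modp_emb.
Proof. exact: initial_continuous. Qed.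

(* A section over U is given by a family a(z, W), for z in the closed set and W
   open in X, such that near every point of U a single section of O_X is
   congruent to a(z, W) for all z and all small W; families are identified when
   they are congruent at each point. The index z makes glueing immediate. *)
Definition fam := dprod (fun zW : modp_space * opens X => sec zW.2).

Definition rep (a : fam) (z : modp_space) (W0 : opens X) (s : sec W0) : Prop :=
  exists W1 : opens X, oset W1 (modp_emb z) /\ forall W : opens X, W `<=` W1 ->
    oset W (modp_emb z) -> cong (a (z, W)) s (modp_emb z).

Lemma rep_cong (a : fam) z (W0 W0' : opens X) (s : sec W0) (s' : sec W0') :
  rep a z s -> rep a z s' <-> cong s s' (modp_emb z).
Proof.
move=> [W1 [W1z h]]; split=> [[W2 [W2z h']]|c]; last first.
  by exists W1; split=> // W WW1 Wz; apply: cong_trans c; apply: h.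
have Cz : oset (capo W1 W2) (modp_emb z) by [].
apply: cong_trans (h' (capo W1 W2) _ Cz); last by move=> y [].
by apply/cong_sym/h => // y [].
Qed.

Lemma rep_op (f : forall R : comPzRingType, R -> R -> R) (a b c : fam) z (W0 : opens X)
    (s t : sec W0) :
  (forall zW, c zW = f _ (a zW) (b zW)) ->
  (forall (W W' : opens X) (s s' : sec W) (t t' : sec W') x,
     cong s t x -> cong s' t' x -> cong (f _ s s') (f _ t t') x) ->
  rep a z s -> rep b z t -> rep c z (f _ s t).
Proof.
move=> hc hf [W1 [W1z h1]] [W2 [W2z h2]]; exists (capo W1 W2); split=> // W hW Wz.
by rewrite hc; apply: hf; [apply: h1|apply: h2] => // y /hW [].
Qed.

Lemma repB (a b : fam) z (W0 : opens X) (s t : sec W0) :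
  rep a z s -> rep b z t -> rep (a - b) z (s - t).
Proof. by apply: (@rep_op (fun R x y => x - y)) => // *; apply: congB. Qed.

Lemma repM (a b : fam) z (W0 : opens X) (s t : sec W0) :
  rep a z s -> rep b z t -> rep (a * b) z (s * t).
Proof. by apply: (@rep_op (fun R x y => x * y)) => // *; apply: congM. Qed.

Lemma rep_res (a : fam) z (W0 V : opens X) (h : V `<=` W0) (s : sec W0) :
  oset V (modp_emb z) -> rep a z s -> rep a z (res h s).
Proof.
by move=> Vz r; apply/(rep_cong _ r)/germ_eq_cong/germ_eq_sym/germ_eq_res.
Qed.

Lemma rep1 z (W0 : opens X) : oset W0 (modp_emb z) -> rep 1 z (1 : sec W0).
Proof. by move=> Wz; exists (whole X); split=> // W _ Wz'; apply/germ_eq_cong/germ_eq1. Qed.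

Lemma rep0 z (W0 : opens X) : oset W0 (modp_emb z) -> rep 0 z (0 : sec W0).
Proof. by move=> Wz; exists (whole X); split=> // W _ Wz'; apply/germ_eq_cong/germ_eq0. Qed.

Section Sections.
Variable U : opens modp_space.

Definition locrep (a : fam) : Prop := forall z, oset U z ->
  exists (W : opens X) (s : sec W), oset W (modp_emb z) /\
    forall z', oset U z' -> oset W (modp_emb z') -> rep a z' s.

Definition locrep_pred : {pred fam} := fun a => `[< locrep a >].

Lemma locrep_subring : subring_closed locrep_pred.
Proof.
split.
- apply/asboolP => z Uz; exists (whole X), 1; split=> // z' _ _; exact: rep1.
- move=> a b /asboolP ha /asboolP hb; apply/asboolP => z Uz.
  have [W [s [Wz hs]]] := ha z Uz; have [W' [t [Wz' ht]]] := hb z Uz.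
  have k : capo W W' `<=` W by move=> y [].
  have k' : capo W W' `<=` W' by move=> y [].
  exists (capo W W'), (res k s - res k' t); split=> // z' Uz' [Wz1 Wz1'].
  by apply: repB; apply: rep_res => //; [apply: hs|apply: ht].
- move=> a b /asboolP ha /asboolP hb; apply/asboolP => z Uz.
  have [W [s [Wz hs]]] := ha z Uz; have [W' [t [Wz' ht]]] := hb z Uz.
  have k : capo W W' `<=` W by move=> y [].
  have k' : capo W W' `<=` W' by move=> y [].
  exists (capo W W'), (res k s * res k' t); split=> // z' Uz' [Wz1 Wz1'].
  by apply: repM; apply: rep_res => //; [apply: hs|apply: ht].
Qed.

Definition locfam := {a : fam | locrep_pred a}.
HB.instance Definition _ := SubChoice.on locfam.
HB.instance Definition _ :=
  GRing.SubChoice_isSubComPzRing.Build fam locrep_pred locfam locrep_subring.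

Definition nullfam : set locfam := [set a | forall z, oset U z ->
  rep (val a) z (0 : sec (whole X))].

Lemma nullfam_ideal : is_ideal nullfam.
Proof.
split.
- by move=> z Uz; apply: rep0.
- move=> a b ha hb z Uz.
  have h := repB (rep0 (z := z) (W0 := whole X) I) (hb z Uz).
  have := repB (ha z Uz) h; rewrite !subr0.
  by rewrite sub0r opprK.
- move=> a b hb z Uz; have /asboolP /(_ z Uz) [W [s [Wz hs]]] := svalP a.
  have k : W `<=` whole X by [].
  have := repM (hs z Uz Wz) (rep_res k Wz (hb z Uz)); rewrite rmorph0 mulr0 => r.
  by apply/(rep_cong _ r)/germ_eq_cong/germ_eq0.
Qed.

Definition modp_sec : comPzRingType := quot (QIdeal nullfam_ideal).
End Sections.
End ModpSheaf.

Section ModpScheme.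

Variables (X : ringed_space) (q : nat).
Local Notation Z := (modp_space X q).
Local Notation j := (@modp_emb X q).
Local Notation S := (@modp_sec X q).
Implicit Types (U : opens Z) (z : Z).

Lemma repD (a b : fam X q) z (W0 : opens X) (s t : sec W0) :
  rep a z s -> rep b z t -> rep (a + b) z (s + t).
Proof.
move=> ha hb; have Wz : oset W0 (j z).
  by have [W1 [W1z h]] := ha; have [V [_ [h' [r [Vz _]]]]] := h W1 (fun y i => i) W1z; apply: (h').
have := repB ha (repB (rep0 Wz) hb); rewrite !sub0r !opprK.
by [].
Qed.

(** The germ of [t] at [z] is the class of [s]. This relation hides the families: sections are built
    by [trep_make], compared by [trep_eq], and their germs are unique up to [cong] by
    [trep_cong]. *)
Definition trep U (t : S U) z (W : opens X) (s : sec W) : Prop :=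
  rep (val (val t)) z s.

Lemma trep_in U (t : S U) z (W : opens X) (s : sec W) : trep t z s -> oset W (j z).
Proof.
move=> [W1 [W1z h]]; have [V [_ [h' [r [Vz _]]]]] := h W1 (fun y i => i) W1z.
exact: (h').
Qed.

Lemma rep_in (a : fam X q) z (W : opens X) (s : sec W) : rep a z s -> oset W (j z).
Proof.
move=> [W1 [W1z h]]; have [V [_ [h' [r [Vz _]]]]] := h W1 (fun y i => i) W1z.
exact: (h').
Qed.

Lemma rep_null (a b : fam X q) z (W : opens X) (s : sec W) :
  rep (b - a) z (0 : sec (whole X)) -> rep b z s <-> rep a z s.
Proof.
have k : W `<=` whole X by [].
move=> n0; split=> h; have := rep_res k (rep_in h) n0; rewrite rmorph0 => n1.
  by have := repB h n1; rewrite subr0 opprB addrC subrK.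
by have := repD h n1; rewrite addr0 addrC subrK.
Qed.

Lemma trep_qpi U (a : locfam U) z (W : opens X) (s : sec W) : oset U z ->
  trep (qpi (QIdeal (nullfam_ideal U)) a) z s <-> rep (val a) z s.
Proof.
move=> Uz; apply: rep_null; rewrite -raddfB.
exact: (coset_reprP (QIdeal (nullfam_ideal U)) a).
Qed.

Lemma trep_local U (t : S U) z : oset U z ->
  exists (W : opens X) (s : sec W), oset W (j z) /\
    forall z', oset U z' -> oset W (j z') -> trep t z' s.
Proof. by move=> Uz; have /asboolP /(_ z Uz) := valP (val t). Qed.

Lemma trep_eq U (t t' : S U) :
  (forall z, oset U z -> exists (W : opens X) (s : sec W), trep t z s /\ trep t' z s) ->
  t = t'.
Proof.
move=> h; rewrite -(qpiK t) -(qpiK t'); apply/qpi_eq => z Uz.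
have [W [s [hs hs']]] := h z Uz; have := repB hs hs'; rewrite subrr => r.
by apply/(rep_cong _ r)/germ_eq_cong/germ_eq0 => //; apply: trep_in hs.
Qed.

Lemma trep_cong U (t : S U) z (W W' : opens X) (s : sec W) (s' : sec W') :
  trep t z s -> trep t z s' <-> cong q s s' (j z).
Proof. exact: rep_cong. Qed.

Lemma trepW U (P : S U -> Prop) : (forall a, P (qpi _ a)) -> forall t, P t.
Proof. by move=> h t; rewrite -(qpiK t). Qed.

Lemma trepB U (t t' : S U) z (W : opens X) (s s' : sec W) : oset U z ->
  trep t z s -> trep t' z s' -> trep (t - t') z (s - s').
Proof.
move=> Uz; elim/trepW: t => a; elim/trepW: t' => b.
rewrite -rmorphB !trep_qpi // raddfB; exact: repB.
Qed.

Lemma trepM U (t t' : S U) z (W : opens X) (s s' : sec W) : oset U z ->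
  trep t z s -> trep t' z s' -> trep (t * t') z (s * s').
Proof.
move=> Uz; elim/trepW: t => a; elim/trepW: t' => b.
rewrite -rmorphM !trep_qpi // rmorphM; exact: repM.
Qed.

Lemma trep1 U z (W : opens X) : oset U z -> oset W (j z) -> trep (1 : S U) z (1 : sec W).
Proof.
move=> Uz Wz; rewrite -(rmorph1 (qpi (QIdeal (nullfam_ideal U)))) trep_qpi // rmorph1.
exact: rep1.
Qed.

Lemma trep0 U z (W : opens X) : oset U z -> oset W (j z) -> trep (0 : S U) z (0 : sec W).
Proof.
by move=> Uz Wz; have := trepB Uz (trep1 Uz Wz) (trep1 Uz Wz); rewrite !subrr.
Qed.

Lemma trep_nat U z (W : opens X) n : oset U z -> oset W (j z) ->
  trep (n%:R : S U) z (n%:R : sec W).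
Proof.
move=> Uz Wz; elim: n => [|n IH]; first exact: trep0.
have := trepB Uz IH (trepB Uz (trep0 Uz Wz) (trep1 Uz Wz)).
by rewrite !sub0r !opprK -!natr1.
Qed.

Lemma trep_make U (F : Z -> {W : opens X & sec W}) :
  (forall z, oset U z -> oset (projT1 (F z)) (j z)) ->
  (forall z z', oset U z -> oset U z' -> oset (projT1 (F z)) (j z') ->
     cong q (projT2 (F z)) (projT2 (F z')) (j z')) ->
  exists t : S U, forall z, oset U z -> trep t z (projT2 (F z)).
Proof.
move=> hF cF.
(* [rep] tests only small [W], for which the restriction exists; 0 is the default for the others. *)
pose a : fam X q := fun zW => match pselect (zW.2 `<=` projT1 (F zW.1)) with
  | left h => res h (projT2 (F zW.1)) | right _ => 0 end.
have ra z : oset U z -> rep a z (projT2 (F z)).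
  move=> Uz; exists (projT1 (F z)); split; first exact: hF.
  move=> W hW Wz; rewrite /a /=; case: pselect => // k.
  exact/germ_eq_cong/germ_eq_res.
have la : locrep_pred U a.
  apply/asboolP => z Uz; exists (projT1 (F z)), (projT2 (F z)); split; first exact: hF.
  by move=> z' Uz' Wz'; apply/(rep_cong _ (ra z' Uz'))/cong_sym/cF.
pose a' : locfam U := exist _ a la.
by exists (qpi (QIdeal (nullfam_ideal U)) a') => z Uz; apply/trep_qpi => //; apply: ra.
Qed.

Definition locfam_res U U' (h : U' `<=` U) (a : locfam U) : locfam U'.
Proof.
exists (val a); apply/asboolP => z Uz.
have /asboolP /(_ z (h z Uz)) [W [s [Wz hs]]] := valP a.
by exists W, s; split=> // z' Uz'; apply: hs; apply: h.
Defined.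

Section Res.
Variables (U U' : opens Z) (h : U' `<=` U).

Lemma locfam_res_zmod : zmod_morphism (locfam_res h).
Proof. by move=> a b; apply: val_inj. Qed.
Lemma locfam_res_monoid : monoid_morphism (locfam_res h).
Proof.
by split=> [|a b]; apply: val_inj.
Qed.

Lemma modp_res_ex : exists F : {rmorphism S U -> S U'}, forall a,
  F (qpi _ a) = qpi _ (locfam_res h a).
Proof.
pose zm := GRing.isZmodMorphism.Build _ _ _ locfam_res_zmod.
pose mm := GRing.isMonoidMorphism.Build _ _ _ locfam_res_monoid.
pose F : {rmorphism locfam U -> locfam U'} := HB.pack (locfam_res h) zm mm.
have [|G hG] := @quot_liftP _ (QIdeal (nullfam_ideal U)) (S U')
    (qpi (QIdeal (nullfam_ideal U')) \o F).
  by move=> a ha; apply/qpi_eq0 => z Uz; apply: ha; apply: h.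
by exists G => a; rewrite hG.
Qed.

Definition modp_res : {rmorphism S U -> S U'} := sval (cid modp_res_ex).

Lemma trep_modp_res (t : S U) z (W : opens X) (s : sec W) : oset U' z ->
  trep (modp_res t) z s <-> trep t z s.
Proof.
move=> Uz; elim/trepW: t => a; rewrite /modp_res; case: cid => F /= ->.
by rewrite !trep_qpi //; apply: h.
Qed.
End Res.

Lemma modp_res_id U (h : U `<=` U) (t : S U) : modp_res h t = t.
Proof.
apply: trep_eq => z Uz; have [W [s [Wz hs]]] := trep_local t Uz.
by exists W, s; split; [apply/trep_modp_res => //|]; apply: hs.
Qed.

Lemma modp_res_comp (U V W : opens Z) (hVU : V `<=` U) (hWV : W `<=` V)
  (hWU : W `<=` U) (t : S U) : modp_res hWV (modp_res hVU t) = modp_res hWU t.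
Proof.
apply: trep_eq => z Wz; have Vz := hWV z Wz; have Uz := hVU z Vz.
have [O [s [Oz hs]]] := trep_local t Uz; exists O, s; split.
  by apply/trep_modp_res => //; apply/trep_modp_res => //; apply: hs.
by apply/trep_modp_res => //; apply: hs.
Qed.

Lemma modp_open U z : oset U z ->
  exists W : opens X, oset W (j z) /\ forall z', oset W (j z') -> oset U z'.
Proof.
move=> Uz; have [O oO e] := opensP U; exists (Opens oO).
by split=> [|z' Oz']; [|rewrite -e]; move: Uz; rewrite -e.
Qed.

(** Every point of [V] contributes one local lift of one of the [s i]. Agreement on overlaps makes
    the lifts congruent, which is all that [trep_make] asks for. *)
Lemma modp_sheaf (I : Type) (U : I -> opens Z) (V : opens Z)
  (hU : forall i, U i `<=` V) : V `<=` \bigcup_i U i ->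
  forall s : (forall i, S (U i)),
  (forall i i' (W : opens Z) (hi : W `<=` U i) (hj : W `<=` U i'),
      modp_res hi (s i) = modp_res hj (s i')) ->
  exists! t : S V, forall i, modp_res (hU i) t = s i.
Proof.
move=> cov s cmp.
have /choice [F hF] : forall z, exists Ws : {W : opens X & sec W}, oset V z ->
    exists i, [/\ oset (U i) z, oset (projT1 Ws) (j z) & forall z',
      oset (projT1 Ws) (j z') -> oset (U i) z' /\ trep (s i) z' (projT2 Ws)].
  move=> z; case: (pselect (oset V z)) => [Vz|nV]; last by exists (existT _ (whole X) (0 : sec (whole X))).
  have [i _ Uz] := cov z Vz; have [W [r [Wz hr]]] := trep_local (s i) Uz.
  have [O [Oz hO]] := modp_open Uz.
  have k : capo W O `<=` W by move=> y [].
  exists (existT _ (capo W O) (res k r)) => _; exists i; split=> // z' /= [Wz' Oz'].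
  have Uz' := hO z' Oz'; split=> //; have h := hr z' Uz' Wz'.
  by apply/(trep_cong _ h)/germ_eq_cong/germ_eq_sym/germ_eq_res.
have agree i i' z (W : opens X) (r : sec W) : oset (U i) z -> oset (U i') z ->
    trep (s i) z r -> trep (s i') z r.
  move=> Uz Uz' h; have k : capo (U i) (U i') `<=` U i by move=> y [].
  have k' : capo (U i) (U i') `<=` U i' by move=> y [].
  have zz : oset (capo (U i) (U i')) z by [].
  by apply/(trep_modp_res k') => //; rewrite -(cmp _ _ _ k k'); apply/trep_modp_res.
have [||t ht] := @trep_make V F.
- by move=> z /hF [i []].
- move=> z z' /hF [i [Uz _ hz]] Vz' Fz'; have [i' [Uz' Wz' hz']] := hF z' Vz'.
  have [Uiz' r] := hz z' Fz'; have [_ r'] := hz' z' Wz'.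
  by apply/(trep_cong _ r)/(agree i').
have rest i z (W : opens X) (r : sec W) : oset (U i) z -> trep t z r <-> trep (s i) z r.
  move=> Uz; have Vz := hU i z Uz; have [i' [Uz' Wz hz]] := hF z Vz.
  have [_ r'] := hz z Wz; have r'' := agree _ _ _ _ _ Uz' Uz r'.
  by rewrite (trep_cong _ (ht z Vz)) (trep_cong _ r'').
exists t; split=> [i|t' ht'].
  apply: trep_eq => z Uz; have [W [r [Wz hr]]] := trep_local (s i) Uz.
  have h := hr z Uz Wz; exists W, r; split=> //.
  by apply/trep_modp_res => //; apply/(rest i).
apply: trep_eq => z Vz; have [i _ Uz] := cov z Vz.
have [W [r [Wz hr]]] := trep_local (s i) Uz; exists W, r; split.
  by apply/(rest i) => //; apply: hr.
by apply/(trep_modp_res (hU i)) => //; rewrite ht'; apply: hr.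
Qed.

Definition modp_ringed_space : ringed_space :=
  @RingedSpace Z S modp_res modp_res_id modp_res_comp modp_sheaf.

Local Notation ipre := (Defs.preim (@modp_emb_cont X q)).

Lemma modp_sharp_ex (V : opens X) (s : sec V) : exists t : S (ipre V),
  forall z, oset V (j z) -> trep t z s.
Proof.
have [||t ht] := @trep_make (ipre V) (fun=> existT _ V s); first by [].
  by move=> z z' /= _ Vz' _; apply/germ_eq_cong/germ_eq_refl.
by exists t.
Qed.

Definition modp_sharp_fun (V : opens X) (s : sec V) : S (ipre V) :=
  sval (cid (modp_sharp_ex s)).

Lemma trep_modp_sharp (V : opens X) (s : sec V) z :
  oset V (j z) -> trep (modp_sharp_fun s) z s.
Proof. by rewrite /modp_sharp_fun; case: cid => t ht; apply: ht. Qed.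

Lemma modp_sharp_zmod (V : opens X) : zmod_morphism (@modp_sharp_fun V).
Proof.
move=> s s'; apply: trep_eq => z Vz; exists V, (s - s'); split.
  exact: trep_modp_sharp.
by apply: trepB => //; apply: trep_modp_sharp.
Qed.

Lemma modp_sharp_monoid (V : opens X) : monoid_morphism (@modp_sharp_fun V).
Proof.
split; first by apply: trep_eq => z Vz; exists V, 1; split; [exact: trep_modp_sharp|exact: trep1].
move=> s s'; apply: trep_eq => z Vz; exists V, (s * s'); split.
  exact: trep_modp_sharp.
by apply: trepM => //; apply: trep_modp_sharp.
Qed.

HB.instance Definition _ (V : opens X) :=
  GRing.isZmodMorphism.Build _ _ (@modp_sharp_fun V) (@modp_sharp_zmod V).
HB.instance Definition _ (V : opens X) :=
  GRing.isMonoidMorphism.Build _ _ (@modp_sharp_fun V) (@modp_sharp_monoid V).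

Definition modp_sharp (V : opens X) :
    {rmorphism sec V -> @sec modp_ringed_space (ipre V)} := @modp_sharp_fun V.

End ModpScheme.

(** * Morphisms compared through germs *)

Section Morphisms.

Lemma mor_germ_eq (X Y : scheme) (f : morphism X Y) (V V' : opens Y) (s : sec V) (t : sec V') x :
  germ_eq s t (f x) -> germ_eq (sharp f V s) (sharp f V' t) x.
Proof. by apply: germ_eq_sharp => U U' h h' r; apply: sharp_res. Qed.

Lemma mor_unit (X Y : scheme) (f : morphism X Y) (V : opens Y) (s : sec V) x :
  unit_at s (f x) -> unit_at (sharp f V s) x.
Proof.
case=> W [h [Wx [b hb]]].
have k : pre f W `<=` pre f V by move=> y /h.
by exists (pre f W), k; split=> //; exists (sharp f W b); rewrite -(sharp_res f h) -rmorphM hb rmorph1.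
Qed.

Lemma mor_eq_germ_eq (X Y : scheme) (f g : morphism X Y) : mor_eq f g ->
  forall (V : opens Y) (s : sec V) x, oset V (f x) -> germ_eq (sharp f V s) (sharp g V s) x.
Proof.
case=> e h V s x Vx.
have k : capo (pre f V) (pre g V) `<=` pre f V by move=> y [].
have k' : capo (pre f V) (pre g V) `<=` pre g V by move=> y [].
exists (capo (pre f V) (pre g V)), k, k'; split; last exact: h.
by split=> //=; rewrite -e.
Qed.

Lemma germ_eq_mor_eq (X Y : scheme) (f g : morphism X Y) : (forall x, f x = g x) ->
  (forall (V : opens Y) (s : sec V) x, oset V (f x) -> germ_eq (sharp f V s) (sharp g V s) x) ->
  mor_eq f g.
Proof.
move=> e h; split=> // V s W hf hg; apply: sec_eq => x Wx.
by apply/germ_eq_resl => //; apply/germ_eq_resr => //; apply: h; apply: hf.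
Qed.

Lemma mor_eq_sym (X Y : scheme) (f g : morphism X Y) : mor_eq f g -> mor_eq g f.
Proof. by case=> e h; split=> // V s W hf hg; rewrite (h V s W hg hf). Qed.

Lemma mor_eq_trans (X Y : scheme) (f g k : morphism X Y) :
  mor_eq f g -> mor_eq g k -> mor_eq f k.
Proof.
move=> fg gk; have e : forall x, f x = g x by case: fg.
have e' : forall x, g x = k x by case: gk.
apply: germ_eq_mor_eq => [x|V s x Vx]; first by rewrite e.
apply: germ_eq_trans (mor_eq_germ_eq fg s Vx) (mor_eq_germ_eq gk s _).
by rewrite -e.
Qed.

Lemma mor_comp_germ_eq (X Y Z : scheme) (g : morphism Y Z) (f : morphism X Y) (V : opens Z)
    (s : sec V) x : oset V (g (f x)) ->
  germ_eq (sharp (mor_comp g f) V s) (sharp f (pre g V) (sharp g V s)) x.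
Proof. by move=> Vx; apply: germ_eq_res. Qed.

Section Identity.
Variable X : scheme.

Lemma id_cont : continuous (@id X).
Proof. by move=> x; apply: cvg_id. Qed.

Lemma id_sub (V : opens X) : Defs.preim id_cont V `<=` V. Proof. by []. Qed.

Lemma id_sharp_res (V V' : opens X) (h : V' `<=` V)
  (h' : Defs.preim id_cont V' `<=` Defs.preim id_cont V) (s : sec V) :
  res (@id_sub V') (res h s) = res h' (res (@id_sub V) s).
Proof.
have k : Defs.preim id_cont V' `<=` V by move=> y /h.
by rewrite !(res_comp _ _ k).
Qed.

Lemma id_sharp_local (V : opens X) (s : sec V) (x : X) :
  oset V (id x) -> unit_at (res (@id_sub V) s) x -> unit_at s (id x).
Proof. by move=> Vx /(unit_at_res (@id_sub V) s Vx). Qed.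

Definition mor_id : morphism X X := Morphism id_sharp_res id_sharp_local.
End Identity.
End Morphisms.

Section ModpClosed.

Variables (X : scheme) (q : nat).
Local Notation Z := (modp_space X q).
Local Notation P := (modp_ringed_space X q).
Local Notation j := (@modp_emb X q).
Local Notation S := (@modp_sec X q).

Lemma germ_eq_trep (U U' : opens Z) (t : S U) (t' : S U') z (W : opens X) (s : sec W) :
  @germ_eq P U U' t t' z -> trep t z s -> trep t' z s.
Proof.
move=> [O [k [k' [Oz e]]]] h; apply/(trep_modp_res k') => //.
have e' : modp_res k t = modp_res k' t' := e.
by rewrite -e'; apply/trep_modp_res.
Qed.

Lemma trep_germ_eq (U U' : opens Z) (t : S U) (t' : S U') z (W : opens X) (s : sec W) :
  oset U z -> oset U' z -> oset W (j z) ->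
  (forall z', oset U z' -> oset U' z' -> oset W (j z') -> trep t z' s /\ trep t' z' s) ->
  @germ_eq P U U' t t' z.
Proof.
move=> Uz Uz' Wz h.
pose O := capo (capo U U') (Defs.preim (@modp_emb_cont X q) W).
have k : O `<=` U by move=> y [] [].
have k' : O `<=` U' by move=> y [] [].
exists O, k, k'; split=> //; apply: trep_eq => z' [[Uz1 Uz1'] Wz1].
have [h1 h2] := h z' Uz1 Uz1' Wz1.
by exists W, s; split; apply/trep_modp_res.
Qed.

Lemma modp_immersion_emb : modp_immersion q (@modp_sharp X q).
Proof.
split.
- move=> V V' h h' s; apply: trep_eq => z Vz; exists V', (res h s).
  split; first exact: trep_modp_sharp.
  have h1 : trep (modp_sharp_fun q s) z s by apply: trep_modp_sharp; apply: (h).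
  apply/(trep_modp_res h' _ _ Vz)/(trep_cong _ h1)/germ_eq_cong/germ_eq_sym.
  exact: germ_eq_res.
- move=> x y; exact: val_inj.
- exact: modp_open.
- move=> z; split=> [[x <-]|hz]; first by apply/asboolP; apply: (valP (x : modp_point X q)).
  by exists (exist _ z (asboolT hz)).
- move=> U t z Uz; have [W [s [Wz hs]]] := trep_local t Uz.
  exists W, s; split=> //; apply: (trep_germ_eq (s := s)) => // z' Uz' _ Wz'.
  by split; [exact: hs|exact: trep_modp_sharp].
- move=> V s z Vz e.
  have h0 := germ_eq_trep e (trep_modp_sharp s Vz).
  have h1 := trep0 (U := Defs.preim (@modp_emb_cont X q) V) (z := z) Vz Vz.
  have [W [h [h' [r [Wz hr]]]]] := (trep_cong _ h0).1 h1.
  exists W, r, W, h, (fun y i => i); split=> //.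
  by rewrite hr rmorph0 add0r res_id.
- apply: (@trep_eq X q (whole P)) => z Uz; exists (whole X), (q%:R); split; first exact: trep_nat.
  apply/(trep_cong _ (trep0 Uz (W := whole X) I)).
  exists (whole X), (fun y i => i), (fun y i => i), (- 1); split=> //.
  by rewrite !res_id mulrN mulr1 addrN.
Qed.
End ModpClosed.

Section ModpFactor.

Variables (X : scheme) (q : nat).
Local Notation Z := (modp_space X q).
Local Notation j := (@modp_emb X q).
Local Notation S := (@modp_sec X q).

Lemma modp_locally_affine (z : modp_ringed_space X q) :
  exists2 U : opens (modp_ringed_space X q), oset U z & affine U.
Proof.
have [U Uz [A [h [th ch]]]] := locally_affine (j z).
exists (Defs.preim (@modp_emb_cont X q) U) => //.
by eexists; apply: (modp_spec_on (modp_immersion_emb X q) ch).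
Qed.

Definition modp_scheme : scheme := Scheme modp_locally_affine.

(** An inverse modulo [q] writes 1 as a multiple of [s] plus a multiple of [q] near [j z]. If [s]
    were a non-unit there, then, [q] being one too, 1 would lie in the prime of non-units. *)
Lemma modp_emb_local (V : opens X) (s : sec V) (z : modp_scheme) :
  oset V (j z) -> @unit_at modp_scheme _ (modp_sharp q V s) z -> unit_at s (j z).
Proof.
move=> Vz [U [k [Uz [b hb]]]]; apply: contrapT => ns.
have [W [r [Wz hr]]] := trep_local (b : S U) Uz.
have kV : capo V W `<=` V by move=> y [].
have kW : capo V W `<=` W by move=> y [].
have Cz : oset (capo V W) (j z) by [].
have hs : trep (modp_res k (modp_sharp_fun q s)) z (res kV s).
  apply/trep_modp_res => //; have h := trep_modp_sharp (q := q) s Vz.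
  by apply/(trep_cong _ h)/germ_eq_cong/germ_eq_sym/germ_eq_res.
have hr' : trep (b : S U) z (res kW r).
  have h := hr z Uz Wz.
  by apply/(trep_cong _ h)/germ_eq_cong/germ_eq_sym/germ_eq_res.
have := trepM Uz hs hr'.
rewrite [X in trep X](_ : _ = 1 :> S U); last exact: hb.
move=> h1; have [O [k1 [k2 [a [Oz e]]]]] := (trep_cong _ h1).1 (trep1 Uz Cz).
have [[_ PD PM] P1 _] := nonunit_prime Oz; apply: P1 => /=.
have -> : 1 = res k1 (res kV s * res kW r) + (- a) * q%:R :> sec O.
  by rewrite e rmorph1 mulNr mulrC addrK.
apply: PD; rewrite /=.
  by move=> /(unit_at_res k1 _ Oz) /unit_atM [] /(unit_at_res kV _ Cz).
apply: PM => /= h2; have /asboolP := valP (z : modp_point X q); apply.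
by apply: germ_eq_unit h2; apply: germ_eq_nat.
Qed.

Definition modp_mor : morphism modp_scheme X :=
  @Morphism modp_scheme X j (@modp_emb_cont X q) (modp_sharp q)
    (imm_sharp (modp_immersion_emb X q)) modp_emb_local.

Section Factor.
Variables (T : scheme) (f : morphism T X).
Hypothesis qT : q%:R = 0 :> sec (whole T).

Lemma char0_sec (U : opens T) : q%:R = 0 :> sec U.
Proof.
have k : U `<=` whole T by [].
by rewrite -(rmorph_nat (res k)) qT rmorph0.
Qed.

Lemma char0_nonunit x : ~ unit_at (q%:R : sec (whole X)) (f x).
Proof.
move=> /mor_unit; rewrite rmorph_nat char0_sec; exact: unit_at_neq0.
Qed.

Definition factor_fun (x : T) : modp_scheme := exist _ (f x) (asboolT (@char0_nonunit x)).

Lemma factor_cont : continuous factor_fun.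
Proof.
apply/continuousP => _ [O oO <-].
by have /continuousP := fcont f; apply.
Qed.

Local Notation wpre := (Defs.preim factor_cont).

(** [q] is zero on [T], so pulling back along [f] depends only on classes modulo [q]. Pullbacks of
    different local lifts therefore glue. *)
Lemma cong_sharp (V V' : opens X) (s : sec V) (t : sec V') x :
  cong q s t (f x) -> germ_eq (sharp f V s) (sharp f V' t) x.
Proof.
case=> W [h [h' [r [Wx e]]]].
have h1 : germ_eq (res h s) s (f x) by apply: germ_eq_res.
apply: germ_eq_trans (mor_germ_eq (germ_eq_sym h1)) _; rewrite e rmorphD rmorphM rmorph_nat char0_sec.
by rewrite mul0r addr0; apply: mor_germ_eq; apply: germ_eq_res.
Qed.

Lemma factor_sharp_ex (U : opens Z) (t : S U) : exists r : sec (wpre U),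
  forall x (W : opens X) (s : sec W), oset (wpre U) x -> trep t (factor_fun x) s ->
    germ_eq r (sharp f W s) x.
Proof.
have /choice [F hF] : forall x : T, exists Ws : {W : opens T & sec W}, oset (wpre U) x ->
    oset (projT1 Ws) x /\ forall y, oset (projT1 Ws) y -> oset (wpre U) y ->
      exists (W : opens X) (s : sec W), trep t (factor_fun y) s /\
        germ_eq (projT2 Ws) (sharp f W s) y.
  move=> x; case: (pselect (oset (wpre U) x)) => [Ux|nU]; last first.
    by exists (existT _ (whole T) (0 : sec (whole T))).
  have [W [s [Wx hs]]] := trep_local t Ux.
  exists (existT _ (pre f W) (sharp f W s)) => _; split=> // y Wy Uy.
  by exists W, s; split; [exact: hs|exact: germ_eq_refl].
have [||r hr] := @glue T (wpre U) F.
- by move=> x /hF [].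
- move=> x y z Ux Uy Uz xz yz.
  have [_ /(_ z xz Uz) [W [s [ts es]]]] := hF x Ux.
  have [_ /(_ z yz Uz) [W' [s' [ts' es']]]] := hF y Uy.
  apply: germ_eq_trans es (germ_eq_trans _ (germ_eq_sym es')).
  by apply: cong_sharp; apply/(trep_cong _ ts).
exists r => x W s Ux ts; have [Fx hx] := hF x Ux.
have [W' [s' [ts' es']]] := hx x Fx Ux.
apply: germ_eq_trans (hr x x Ux Ux Fx) (germ_eq_trans es' _).
by apply: cong_sharp; apply/(trep_cong _ ts').
Qed.

Definition factor_sharp_fun (U : opens Z) (t : S U) : sec (wpre U) :=
  sval (cid (factor_sharp_ex t)).

Lemma factor_sharpP (U : opens Z) (t : S U) x (W : opens X) (s : sec W) :
  oset (wpre U) x -> trep t (factor_fun x) s ->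
  germ_eq (factor_sharp_fun t) (sharp f W s) x.
Proof. by rewrite /factor_sharp_fun; case: cid => r hr /=; apply: hr. Qed.

Lemma trep2 (U : opens Z) (t t' : S U) z : oset U z ->
  exists (W : opens X) (s s' : sec W), trep t z s /\ trep t' z s'.
Proof.
move=> Uz; have [W [s [Wz hs]]] := trep_local t Uz.
have [W' [s' [Wz' hs']]] := trep_local t' Uz.
have k : capo W W' `<=` W by move=> y [].
have k' : capo W W' `<=` W' by move=> y [].
have Cz : oset (capo W W') (j z) by [].
have h := hs z Uz Wz; have h' := hs' z Uz Wz'.
exists (capo W W'), (res k s), (res k' s'); split.
  by apply/(trep_cong _ h)/germ_eq_cong/germ_eq_sym/germ_eq_res.
by apply/(trep_cong _ h')/germ_eq_cong/germ_eq_sym/germ_eq_res.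
Qed.

Lemma factor_sharp_zmod (U : opens Z) : zmod_morphism (@factor_sharp_fun U).
Proof.
move=> t t'; apply: sec_eq => x Ux.
have [W [s [s' [hs hs']]]] := trep2 t t' (Ux : oset U (factor_fun x)).
apply: germ_eq_trans (factor_sharpP Ux (trepB Ux hs hs')) _.
by rewrite rmorphB; apply/germ_eq_sym/germ_eqB; apply: factor_sharpP.
Qed.

Lemma factor_sharp_monoid (U : opens Z) : monoid_morphism (@factor_sharp_fun U).
Proof.
split=> [|t t']; apply: sec_eq => x Ux.
  have := factor_sharpP Ux (trep1 (U := U) (z := factor_fun x) (W := whole X) Ux I).
  rewrite rmorph1 => h; apply: germ_eq_trans h _; exact: germ_eq1.
have [W [s [s' [hs hs']]]] := trep2 t t' (Ux : oset U (factor_fun x)).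
apply: germ_eq_trans (factor_sharpP Ux (trepM Ux hs hs')) _.
by rewrite rmorphM; apply/germ_eq_sym/germ_eqM; apply: factor_sharpP.
Qed.

HB.instance Definition _ (U : opens Z) :=
  GRing.isZmodMorphism.Build _ _ (@factor_sharp_fun U) (@factor_sharp_zmod U).
HB.instance Definition _ (U : opens Z) :=
  GRing.isMonoidMorphism.Build _ _ (@factor_sharp_fun U) (@factor_sharp_monoid U).

Definition factor_sharp (U : opens modp_scheme) : {rmorphism sec U -> sec (wpre U)} :=
  @factor_sharp_fun U.

Lemma factor_sharp_res (V V' : opens modp_scheme) (h : V' `<=` V)
  (h' : wpre V' `<=` wpre V) (s : sec V) :
  factor_sharp V' (res h s) = res h' (factor_sharp V s).
Proof.
apply: sec_eq => x Vx; have Vx1 := h' x Vx.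
have [W [r [Wx hr]]] := trep_local (s : S V) (Vx1 : oset V (factor_fun x)).
have h1 := hr _ Vx1 Wx.
apply/(germ_eq_resr h') => //; apply: germ_eq_trans (germ_eq_sym (factor_sharpP Vx1 h1)).
by apply: factor_sharpP => //; apply/trep_modp_res.
Qed.

Lemma factor_sharp_local (V : opens modp_scheme) (s : sec V) (x : T) :
  oset V (factor_fun x) -> unit_at (factor_sharp V s) x -> unit_at s (factor_fun x).
Proof.
move=> Vx hu; have [W [r [Wx hr]]] := trep_local (s : S V) Vx.
have h1 := germ_eq_unit (factor_sharpP Vx (hr _ Vx Wx)) hu.
have h2 : unit_at r (f x) := sharp_local f Wx h1.
have h3 : unit_at (sharp modp_mor W r) (factor_fun x) by apply: mor_unit.
apply: germ_eq_unit h3; apply/germ_eq_sym/(trep_germ_eq (s := r)) => // z' Vz' _ Wz'.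
by split; [exact: hr|exact: trep_modp_sharp].
Qed.

Definition mor_factor : morphism T modp_scheme :=
  Morphism factor_sharp_res factor_sharp_local.

Lemma mor_factorE : mor_eq (mor_comp modp_mor mor_factor) f.
Proof.
apply: germ_eq_mor_eq => // V s x Vx; apply: germ_eq_trans (mor_comp_germ_eq _ _) _ => //.
by apply: factor_sharpP => //; apply: trep_modp_sharp.
Qed.

End Factor.
End ModpFactor.

(** * Reduction modulo p *)

Section SpecFp.

Variables (p : nat) (pp : prime p) (Sp : scheme) (hSp : is_spec Sp 'F_p).

Lemma Fp_nat (a : 'F_p) : exists k : nat, a = k%:R.
Proof. by exists (nat_of_ord a); rewrite natr_Zp. Qed.

Lemma Fp_prime_ideal (P : set 'F_p) : prime_ideal P -> P = [set 0].
Proof.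
case=> [[P0 _ PM] P1 _]; apply/seteqP; split=> [a Pa|_ -> //]; rewrite /= .
apply: contrapT => /eqP a0; apply: P1; rewrite -(mulVf a0); exact: PM.
Qed.

Lemma specFp_point (x y : Sp) : x = y.
Proof.
case: hSp => h [th ch]; apply: (chart_inj ch) => //.
have hx := Fp_prime_ideal (chart_prime ch (I : oset (whole Sp) x)).
have hy := Fp_prime_ideal (chart_prime ch (I : oset (whole Sp) y)).
by rewrite hx hy.
Qed.

Lemma specFp_ex : exists x : Sp, True.
Proof.
case: hSp => h [th ch].
have pr : prime_ideal [set (0 : 'F_p)].
  split=> /= [|/eqP|a b /eqP]; last 2 first.
  - by rewrite oner_eq0.
  - by rewrite mulf_eq0 => /orP [] /eqP ->; [left|right].
  by split=> /= [//|a b -> ->|a b ->]; rewrite ?addr0 ?mulr0.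
by have [x _ _] := chart_surj ch pr; exists x.
Qed.

Lemma specFp_char (U : opens Sp) : p%:R = 0 :> sec U.
Proof.
case: hSp => h [th ch]; have k : U `<=` whole Sp by [].
by rewrite -(rmorph_nat (res k)) -(rmorph_nat th) pchar_Fp_0 // !rmorph0.
Qed.

(** [Sp] has one point, so a nonempty open set is everything, and elements of F_p are multiples of
    1. Ring morphisms out of these sections are thereby forced, which makes any two morphisms to
    [Sp] equal. *)
Lemma specFp_nat (U : opens Sp) (s : sec U) : exists k : nat, s = k%:R.
Proof.
have [h [th ch]] := hSp.
case: (pselect (exists x, oset U x)) => [[x Ux]|nU]; last first.
  by exists 0%N; apply: sec_empty => x Ux; apply: nU; exists x.
have k : U `<=` whole Sp by [].
have k' : whole Sp `<=` U by move=> y _; rewrite (specFp_point y x).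
have [a ha] := chart_theta_surj ch (res k' s); have [m hm] := Fp_nat a.
exists m; rewrite -(res_id (fun y i => i) s) -(res_comp k' k) -ha hm.
by rewrite !rmorph_nat.
Qed.

Lemma specFp_nat_inj (U : opens Sp) x (m n : nat) : oset U x ->
  m%:R = n%:R :> sec U -> (m%:R = n%:R :> 'F_p).
Proof.
move=> Ux e; have [h [th ch]] := hSp.
have k' : whole Sp `<=` U by move=> y _; rewrite (specFp_point y x).
apply/eqP; rewrite -subr_eq0; apply/eqP/(chart_theta_inj ch).
by rewrite rmorphB !rmorph_nat -!(rmorph_nat (res k')) e subrr.
Qed.

Lemma Fp_nat_mod (m n : nat) : m%:R = n%:R :> 'F_p -> m = n %[mod p].
Proof. by move/(congr1 val); rewrite /= !val_Fp_nat. Qed.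

Lemma char_nat_mod (R : comPzRingType) (m n : nat) : p%:R = 0 :> R ->
  m = n %[mod p] -> m%:R = n%:R :> R.
Proof.
move=> p0 e; rewrite (divn_eq m p) (divn_eq n p) e !natrD !natrM p0.
by rewrite !mulr0.
Qed.

Lemma specFp_mor_eq (T : scheme) (f g : morphism T Sp) : mor_eq f g.
Proof.
apply: germ_eq_mor_eq => [x|V s x Vx]; first exact: specFp_point.
have [k ->] := specFp_nat s; rewrite !rmorph_nat; apply: germ_eq_nat => //.
by rewrite /= (specFp_point (g x) (f x)).
Qed.

Section ToSpec.
Variable T : scheme.
Hypothesis pT : p%:R = 0 :> sec (whole T).

Definition specFp_fun (x : T) : Sp := sval (cid specFp_ex).

Lemma specFp_cont : continuous specFp_fun.
Proof. by move=> x; exact: cvg_cst. Qed.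

Local Notation tpre := (Defs.preim specFp_cont).

(** Two naturals representing [s] agree modulo [p] as soon as [V] contains the point, and [p] is
    zero on [T]; if the preimage is empty, all its sections are equal. *)
Lemma specFp_sharp_ex (V : opens Sp) (s : sec V) : exists t : sec (tpre V),
  forall k : nat, s = k%:R -> t = k%:R.
Proof.
have [k0 hk0] := specFp_nat s; exists k0%:R => k hk.
case: (pselect (exists x, oset (tpre V) x)) => [[x Vx]|nV]; last first.
  by apply: sec_empty => x Vx; apply: nV; exists x.
apply: char_nat_mod; first exact: char0_sec.
by apply/Fp_nat_mod/(specFp_nat_inj Vx); rewrite -hk0.
Qed.

Definition specFp_sharp_fun (V : opens Sp) (s : sec V) : sec (tpre V) :=
  sval (cid (specFp_sharp_ex s)).

Lemma specFp_sharp_nat (V : opens Sp) k : specFp_sharp_fun (k%:R : sec V) = k%:R.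
Proof. by rewrite /specFp_sharp_fun; case: cid => t /= ht; apply: ht. Qed.

(** Sections are handled as natural numbers, so [- n] is replaced by [n * p.-1]. *)
Lemma natrB_char (R : comPzRingType) (m n : nat) : p%:R = 0 :> R ->
  (m + n * p.-1)%:R = m%:R - n%:R :> R.
Proof.
move=> p0; apply/eqP; rewrite eq_sym subr_eq -natrD -addnA -mulnSr prednK ?prime_gt0 //.
by rewrite natrD natrM p0 mulr0 addr0.
Qed.

Lemma specFp_sharp_zmod (V : opens Sp) : zmod_morphism (@specFp_sharp_fun V).
Proof.
move=> s t; have [m ->] := specFp_nat s; have [n ->] := specFp_nat t.
rewrite -natrB_char ?specFp_char // !specFp_sharp_nat natrB_char //.
exact: char0_sec.
Qed.

Lemma specFp_sharp_monoid (V : opens Sp) : monoid_morphism (@specFp_sharp_fun V).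
Proof.
split=> [|s t]; first exact: (specFp_sharp_nat V 1).
have [m ->] := specFp_nat s; have [n ->] := specFp_nat t.
by rewrite -natrM !specFp_sharp_nat natrM.
Qed.

HB.instance Definition _ (V : opens Sp) :=
  GRing.isZmodMorphism.Build _ _ (@specFp_sharp_fun V) (@specFp_sharp_zmod V).
HB.instance Definition _ (V : opens Sp) :=
  GRing.isMonoidMorphism.Build _ _ (@specFp_sharp_fun V) (@specFp_sharp_monoid V).

Definition specFp_sharp (V : opens Sp) : {rmorphism sec V -> sec (tpre V)} :=
  @specFp_sharp_fun V.

Lemma specFp_sharp_res (V V' : opens Sp) (h : V' `<=` V)
  (h' : tpre V' `<=` tpre V) (s : sec V) :
  specFp_sharp V' (res h s) = res h' (specFp_sharp V s).
Proof. by have [k ->] := specFp_nat s; rewrite !rmorph_nat. Qed.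

Lemma specFp_sharp_local (V : opens Sp) (s : sec V) (x : T) :
  oset V (specFp_fun x) -> unit_at (specFp_sharp V s) x -> unit_at s (specFp_fun x).
Proof.
move=> Vx; have [k ->] := specFp_nat s; rewrite rmorph_nat => hu.
apply: contrapT => nu; have [h [th ch]] := hSp.
have kV : V `<=` whole Sp by [].
have k0 : k%:R = 0 :> 'F_p.
  have nu' : ~ unit_at (th k%:R) (specFp_fun x).
    rewrite rmorph_nat => hk; apply: nu.
    by rewrite -(rmorph_nat (res kV)); apply/unit_at_res.
  have : h (specFp_fun x) k%:R.
    by apply: contrapT => hk; apply: nu'; apply/(chart_unit ch).
  by rewrite (Fp_prime_ideal (chart_prime ch _)).
apply: (@unit_at_neq0 T (tpre V) x).
rewrite -(_ : k%:R = 0) //; have := @char_nat_mod (sec (tpre V)) k 0 (char0_sec pT _).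
by apply; apply: Fp_nat_mod.
Qed.

Definition specFp_mor : morphism T Sp := Morphism specFp_sharp_res specFp_sharp_local.
End ToSpec.

Lemma specFp_mor_char (T : scheme) (f : morphism T Sp) : p%:R = 0 :> sec (whole T).
Proof.
have k : whole T `<=` pre f (whole Sp) by [].
by rewrite -(rmorph_nat (res k)) -(rmorph_nat (sharp f (whole Sp))) specFp_char !rmorph0.
Qed.

(** [u] comes from the universal property and [w] from [mor_factor]; uniqueness makes [u] after [w]
    the identity, the projections to [Sp] agreeing automatically. This one composite, with the
    compatibility of [u] and [w] with the maps to [X], transports every clause of
    [modp_immersion]. *)
Lemma product_modp (X Xp : scheme) (iX : morphism Xp X) (qX : morphism Xp Sp) :
  is_product iX qX -> modp_immersion p (sharp iX).
Proof.
move=> hprod; pose Z := modp_scheme X p; pose jm : morphism Z X := modp_mor X p.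
have pZ : p%:R = 0 :> sec (whole Z) := imm_char (modp_immersion_emb X p).
have pX := specFp_mor_char qX.
have [u [ju _ _]] := hprod Z jm (specFp_mor pZ).
pose w := mor_factor iX pX.
have wj : mor_eq (mor_comp jm w) iX by apply: mor_factorE.
have ju1 z : iX (u z) = jm z by case: ju => + _; apply.
have wj1 x : jm (w x) = iX x by case: wj => + _; apply.
have uw : mor_eq (mor_comp u w) (mor_id Xp).
  have [u0 [_ _ uniq]] := hprod Xp iX qX.
  have e1 : mor_eq (mor_comp u w) u0.
    apply: uniq; last exact: specFp_mor_eq.
    apply: germ_eq_mor_eq => [x|V s x Vx]; first exact: etrans (ju1 (w x)) (wj1 x).
    have Vx1 : oset (pre iX V) (u (w x)) := Vx.
    have Vx2 : oset V (mor_comp iX u (w x)) := Vx.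
    have Vx3 : oset V (mor_comp jm w x).
      have : oset V (iX (u (w x))) := Vx.
      by rewrite ju1.
    have g1 := mor_comp_germ_eq (g := iX) (f := mor_comp u w) s Vx.
    have g2 := mor_comp_germ_eq (g := u) (f := w) (sharp iX V s) Vx1.
    have g3 := mor_germ_eq (f := w) (x := x) (mor_comp_germ_eq (g := iX) (f := u) s Vx2).
    have g4 := mor_germ_eq (f := w) (x := x) (mor_eq_germ_eq ju s Vx2).
    have g5 := mor_comp_germ_eq (g := jm) (f := w) s Vx3.
    have g6 := mor_eq_germ_eq wj s Vx3.
    exact: germ_eq_trans g1 (germ_eq_trans g2 (germ_eq_trans (germ_eq_sym g3) (germ_eq_trans g4 (germ_eq_trans (germ_eq_sym g5) g6)))).
  have e2 : mor_eq (mor_id Xp) u0.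
    apply: uniq; last exact: specFp_mor_eq.
    apply: germ_eq_mor_eq => [x|V s x Vx]; first by [].
    have g1 := mor_comp_germ_eq (g := iX) (f := mor_id Xp) s Vx.
    by apply: germ_eq_trans g1 _; apply: germ_eq_res.
  exact: mor_eq_trans e1 (mor_eq_sym e2).
have uwx x : u (w x) = x by case: uw => + _; apply.
have iw x : iX x = @modp_emb X p (w x) by case: wj.
have iu z : iX (u z) = @modp_emb X p z by case: ju => + _; apply.
have back (U : opens Xp) (t : sec U) x : oset U x -> germ_eq (sharp w _ (sharp u U t)) t x.
  move=> Ux; have Ux' : oset U (mor_comp u w x) by rewrite /= uwx.
  apply: germ_eq_trans (germ_eq_sym (mor_comp_germ_eq t Ux')) _.
  by apply: germ_eq_trans (mor_eq_germ_eq uw t Ux') _; apply: germ_eq_res.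
split.
- exact: sharp_res.
- by move=> x y e; rewrite -(uwx x) -(uwx y); congr (u _); apply: val_inj;
  exact: etrans (esym (iw x)) (etrans e (iw y)).
- move=> O x Ox.
  have Oz : oset (pre u O) (w x) by rewrite /= uwx.
  have [W [Wx hW]] := modp_open Oz; exists W; split; first by rewrite iw.
  by move=> y; rewrite iw => /hW; rewrite /= uwx.
- move=> z; split=> [[x <-]|hz]; first exact: char0_nonunit.
  by exists (u (exist _ z (asboolT hz))); rewrite iu.
- move=> U t x Ux; have Uz : oset (pre u U) (w x) by rewrite /= uwx.
  have [W [s [Wz hs]]] := imm_surj (modp_immersion_emb X p) (sharp u U t) Uz.
  exists W, s; split; first by rewrite iw.
  apply: germ_eq_trans (germ_eq_sym (back _ t _ Ux)) _.
  apply: germ_eq_trans (mor_germ_eq (f := w) hs) _.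
  have Wx : oset W (mor_comp jm w x) by [].
  apply: germ_eq_trans (germ_eq_sym (mor_comp_germ_eq s Wx)) _.
  exact: (mor_eq_germ_eq wj s Wx).
- move=> V s x Vx hs; rewrite iw; apply: (imm_ker (modp_immersion_emb X p)); first by rewrite -iw.
  have Vz : oset V (mor_comp iX u (w x)) by rewrite /= uwx.
  have g1 := mor_eq_germ_eq ju s Vz; have g2 := mor_comp_germ_eq (g := iX) (f := u) s Vz.
  have hs' : germ_eq (sharp iX V s) (0 : sec (pre iX V)) (u (w x)) by rewrite uwx.
  have g3 := mor_germ_eq (f := u) hs'; rewrite rmorph0 in g3.
  have g4 := germ_eq_trans (germ_eq_sym g1) (germ_eq_trans g2 g3).
  by apply: germ_eq_trans g4 _; apply: germ_eq0.
- exact: pX.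
Qed.
End SpecFp.

(** * Zero loci and reduced preimages *)

Section ZeroLocus.

Definition vanishing (X : scheme) (T : set X) (U : opens X) (s : sec U) : Prop :=
  forall x, oset U x -> T x -> ~ unit_at s x.

Definition zero_locus (X : scheme) (I : subsheaf X) : set X :=
  [set x | forall (W : opens X) (a : sec W), oset W x -> I W a -> ~ unit_at a x].

Lemma vanishing_ideal (X : scheme) (T : set X) (U : opens X) :
  is_ideal [set s : sec U | vanishing T s].
Proof.
split=> /=.
- by move=> x Ux _; apply: unit_at_neq0.
- move=> a b ha hb x Ux Tx; have [[_ HD _] _ _] := nonunit_prime Ux.
  by apply: HD; [apply: ha|apply: hb].
- move=> a b hb x Ux Tx; have [[_ _ HM] _ _] := nonunit_prime Ux.
  by apply: HM; apply: hb.
Qed.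

Lemma vanishing_res (X : scheme) (T : set X) (U V : opens X) (h : V `<=` U) (s : sec U) :
  vanishing T s -> vanishing T (res h s).
Proof.
by move=> hs x Vx Tx; rewrite (unit_at_res h s Vx); apply: hs => //; apply: h.
Qed.

(* One more factor f than is needed to extend s makes the extension vanish on T
   outside D too. *)
Lemma vanishing_extend (X : scheme) (T : set X) (U D : opens X) (f : sec U)
  (hD : D `<=` U) (s : sec D) : affine U ->
  (forall y, oset U y -> (oset D y <-> unit_at f y)) -> vanishing T s ->
  exists n, forall m, (n < m)%N -> exists t : sec U,
    vanishing T t /\ s * res hD f ^+ m = res hD t.
Proof.
move=> aU hf hs; have [t [n e]] := affine_frac aU hD s hf.
exists n => m nm; exists (t * f ^+ (m - n)); split; last first.
  by rewrite rmorphM rmorphXn -e -mulrA -exprD subnKC // ltnW.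
move=> y Uy Ty /unit_atM [ht hfm].
have fy : unit_at f y by apply: unit_at_exp hfm _; rewrite ?subn_gt0.
have Dy : oset D y by apply/hf.
apply: (hs y Dy Ty).
have : unit_at (res hD t) y by apply/unit_at_res.
by rewrite -e => /unit_atM [].
Qed.

Lemma unit_at_nbhd (X : ringed_space) (U : opens X) (s : sec U) x : unit_at s x ->
  exists W : opens X, oset W x /\ forall y, oset W y -> unit_at s y.
Proof.
by case=> W [h [Wx hb]]; exists W; split=> // y Wy; exists W, h.
Qed.

Section Subvariety.
Variables (X : scheme) (I : subsheaf X).
Hypothesis hI : subvariety I.

Let hid (U : opens X) : is_ideal (@I U). Proof. by case: hI => -[[H _ _] _] _; apply: H. Qed.

Let hres (U V : opens X) (h : V `<=` U) (s : sec U) : I s -> I (res h s).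
Proof. by case: hI => -[[_ H _] _] _; apply: H. Qed.

Let hloc (U : opens X) (s : sec U) :
  (forall x, oset U x -> exists (W : opens X) (h : W `<=` U), oset W x /\ I (res h s)) ->
  I s.
Proof. by case: hI => -[[_ _ H] _] _; apply: H. Qed.

Lemma subvariety_unit_cancel (U : opens X) (s f : sec U) x : unit_at f x -> I (s * f) ->
  exists (W : opens X) (h : W `<=` U), oset W x /\ I (res h s).
Proof.
move=> [W [h [Wx [b hb]]]] hs; exists W, h; split=> //.
have := idealMr b (hid W) (hres h hs).
by rewrite rmorphM -mulrA hb mulr1.
Qed.

(** A Nullstellensatz for reduced quasi-coherent ideals. Off the locus [I] contains 1 locally. At a
    point of the locus, [s] times a power of [f] extends to an affine neighbourhood; the extension
    lies in every prime over [I], so a power of it is in [I], and [I] is reduced. *)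
Lemma zero_locusP (U : opens X) (s : sec U) : I s <-> vanishing (zero_locus I) s.
Proof.
split=> [Is x Ux Zx|hs]; first exact: Zx.
have [_ qc] := hI.1; apply: hloc => x Ux.
case: (pselect (zero_locus I x)) => [Zx|nZ]; last first.
  have [W [a [Wx Ia [O [h [Ox [b hb]]]]]]] : exists (W : opens X) (a : sec W),
      [/\ oset W x, I a & unit_at a x].
    apply: contrapT => H; apply: nZ => W a Wx Ia ua; apply: H.
    by exists W, a.
  have k : capo O U `<=` U by move=> y [].
  have k' : capo O U `<=` O by move=> y [].
  exists (capo O U), k; split=> //.
  have := hres k' (idealMr b (hid O) (hres h Ia)).
  rewrite hb rmorph1 => I1; rewrite -[res k s]mulr1.
  by have [_ _ HM] := hid (capo O U); apply: HM.
have [U0 [U0x aU0 hqc]] := qc x.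
have [f [D [fx DU DU0 hD]]] := affine_basis aU0 U0x Ux.
have [n hn] := vanishing_extend DU0 aU0 hD (vanishing_res (h := DU) hs).
have [t [vt et]] := hn n.+1 (ltnSn n).
have It : I t.
  suff [m Im] : exists m, I (t ^+ m) by case: hI => _ hr; exact: (hr U0 t m Im).
  apply: contrapT => nI; have hJ m : ~ I (t ^+ m) by move=> H; apply: nI; exists m.
  have [Q [pQ IQ Qt]] := prime_avoiding (hid U0) hJ.
  have [y U0y hy] := affine_prime aU0 pQ.
  apply: Qt; apply/hy; apply: vt => // W a Wy Ia.
  (* So far only sections of [I] over all of [U0] are known to be non-units at [y]. Quasi-coherence
     carries [a] to such a section on multiplying by a power of [e], a unit at [y]. *)
  have [e [E [ey EW EU0 hE]]] := affine_basis aU0 U0y Wy.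
  have Ey : oset E y by apply/hE.
  have [r [m [Ir er]]] := hqc e E EU0 hE _ (hres EW Ia).
  move=> ua; have /hy := IQ r Ir; apply.
  apply/(unit_at_res EU0) => //; rewrite -er; apply/unit_atM; split.
    exact/unit_at_res.
  by apply: unit_atX; apply/unit_at_res.
have Dx : oset D x by apply/hD.
have := hres DU0 It; rewrite -et => h1.
have uf : unit_at (res DU0 f ^+ n.+1) x by apply: unit_atX; apply/unit_at_res.
have [W [h [Wx hW]]] := subvariety_unit_cancel uf h1.
have k : W `<=` U by move=> y /h /DU.
by exists W, k; split=> //; rewrite -(res_comp DU h).
Qed.
End Subvariety.

Section Preimage.
Variables (X Y : scheme) (f : morphism Y X) (I : subsheaf X).
Hypothesis hI : subvariety I.

Let T : set Y := [set y | zero_locus I (f y)].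

Variables (V : opens X) (W : opens Y) (hW : W `<=` pre f V).
Hypotheses (aV : affine V) (aW : affine W).

Definition chart_map : {rmorphism sec V -> sec W} := res hW \o sharp f V.

(** The prime is a point [y] of [W], to be shown to lie in [T]. If some [a] in [I] were a unit at
    [f y], then a basic neighbourhood D(e) on which [a] is a unit would make [e] vanish on the zero
    locus; so [e] is in [I], yet its pullback is a unit at [y]. *)
Lemma vanishing_prime (t : sec W) (P : set (sec W)) : vanishing T t ->
  prime_ideal P -> (forall a, I a -> P (chart_map a)) -> P t.
Proof.
move=> vt pP IP; have [y Wy hy] := affine_prime aW pP.
apply/hy; apply: vt => // O a Oy Ia ua.
have [N [Ny hN]] := unit_at_nbhd ua.
have [e [D [ey DN DV hD]]] := affine_basis aV (hW Wy) Ny.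
have Ie : I e.
  apply/(zero_locusP hI) => z Vz Zz ez.
  by apply: (Zz O a) => //; [apply: unit_at_in (hN z _)|apply: hN]; apply: DN; apply/hD.
have /hy := IP e Ie; apply; apply/unit_at_res => //.
exact: mor_unit.
Qed.

Lemma preimage_prime y : oset W y -> T y ->
  forall a, I a -> ~ unit_at (chart_map a) y.
Proof.
move=> Wy Ty a Ia ua; apply: (Ty V a (hW Wy) Ia); apply: (sharp_local f (hW Wy)).
exact/(unit_at_res hW _ Wy).
Qed.

Lemma vanishing_power (t : sec W) : vanishing T t ->
  exists k (n : nat) (a : 'I_n -> sec V) (b : 'I_n -> sec W),
    (forall i, I (a i)) /\ t ^+ k = \sum_(i < n) chart_map (a i) * b i.
Proof.
move=> vt; pose J : set (sec W) := [set s | exists (n : nat) (a : 'I_n -> sec V) (b : 'I_n -> sec W),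
    (forall i, I (a i)) /\ s = \sum_(i < n) chart_map (a i) * b i].
have iJ : is_ideal J.
  split.
  - exists 0%N, (fun=> 0), (fun=> 0); split; first by case.
    by rewrite big_ord0.
  - move=> _ _ [n [a [b [ha ->]]]] [m [c [d [hc ->]]]].
    exists (n + m)%N, (fun i => match fintype.split i with inl j => a j | inr j => c j end),
      (fun i => match fintype.split i with inl j => b j | inr j => d j end); split.
      by move=> i; case: (fintype.split i).
    rewrite big_split_ord /=; congr (_ + _); apply: eq_bigr => i _.
      by rewrite (unsplitK (inl i)).
    by rewrite (unsplitK (inr i)).
  - move=> u _ [n [a [b [ha ->]]]]; exists n, a, (fun i => u * b i); split=> //.
    by rewrite mulr_sumr; apply: eq_bigr => i _; rewrite mulrCA.
suff [k [n [a [b h]]]] : exists k, J (t ^+ k) by exists k, n, a, b.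
apply: contrapT => nJ; have hJ k : ~ J (t ^+ k) by move=> H; apply: nJ; exists k.
have [P [pP JP]] := prime_avoiding iJ hJ; apply; apply: (vanishing_prime vt pP) => a Ia.
apply: JP; exists 1%N, (fun=> a), (fun=> 1); split=> //.
by rewrite big_ord1 mulr1.
Qed.

End Preimage.

Section ReducedPreimage.
Variables (X Y : scheme) (f : morphism Y X) (I : subsheaf X).
Hypothesis hI : subvariety I.
Hypothesis hloc : forall y : Y, exists (V : opens X) (W : opens Y),
  [/\ oset W y, W `<=` pre f V, affine V & affine W].

Let T : set Y := [set y | zero_locus I (f y)].

(** Turns membership into a condition at points, from which the axioms of a subvariety follow. The
    nontrivial direction extends [s] to an affine chart, up to a power of [e], and applies
    [vanishing_power] there. *)
Lemma red_preimageP (U : opens Y) (s : sec U) :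
  red (scheme_preimage f I) s <-> vanishing T s.
Proof.
split=> [hs y Uy Ty us|vs y Uy].
  have [W [hW [n [Wy hp]]]] := hs y Uy.
  have [W' [hW' [V [hV [Wy' [m [a [b [ha e]]]]]]]]] := hp y Wy.
  have : unit_at (res hW' (res hW s ^+ n)) y.
    by apply/unit_at_res => //; apply: unit_atX; apply/unit_at_res.
  have pr := nonunit_prime Wy'; have [iP _ _] := pr.
  rewrite e => usum; suff H i : ~ unit_at (res hV (sharp f V (a i)) * b i) y.
    exact: (@ideal_sum _ _ _ (index_enum 'I_m) xpredT _ iP (fun i _ => H i) usum).
  move=> /unit_atM [ua _]; apply: (Ty V (a i)); [exact: (hV y Wy')|exact: ha|].
  by apply: (sharp_local f (hV y Wy')); apply/(unit_at_res hV _ Wy').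
case: (pselect (T y)) => [Ty|nT]; last first.
  have [V [a [Vy Ia [O [h [Oy [c hc]]]]]]] : exists (V : opens X) (a : sec V),
      [/\ oset V (f y), I a & unit_at a (f y)].
    apply: contrapT => H; apply: nT => V a Vy Ia ua; apply: H.
    by exists V, a.
  have k : capo U (pre f O) `<=` U by move=> z [].
  have k' : capo U (pre f O) `<=` pre f O by move=> z [].
  (* Exponent 0: off [T] the preimage ideal contains 1, since [c] inverts an element [a] of [I]. *)
  exists (capo U (pre f O)), k, 0%N; split=> // z Wz.
  exists (capo U (pre f O)), (fun z i => i), O, k'; split=> //.
  exists 1%N, (fun=> res h a), (fun=> res k' (sharp f O c)); split.
    by move=> _; case: hI => -[[_ H _] _] _; apply: H.
  by rewrite big_ord1 -rmorphM -rmorphM hc expr0 !rmorph1.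
have [V [W [Wy hW aV aW]]] := hloc y.
have [e [D [ey DU DW hD]]] := affine_basis aW Wy Uy.
have [n hn] := vanishing_extend DW aW hD (vanishing_res (h := DU) vs).
have [t [vt et]] := hn n.+1 (ltnSn n).
have [k [m [a [b [ha et']]]]] := vanishing_power hI hW aV aW vt.
have Dy : oset D y by apply/hD.
have [O [h [Oy [c hc]]]] := (unit_at_res DW e Dy).2 ey.
have hU : O `<=` U by move=> z /h /DU.
have OW : O `<=` W by move=> z /h /DW.
have OV : O `<=` pre f V by move=> z /OW /hW.
exists O, hU, k; split=> // z Oz; exists O, (fun z i => i), V, OV; split=> //.
(* [t] is [s * e ^+ n.+1] and [c] inverts [e], so [s ^+ k] is [t ^+ k * c ^+ (n.+1 * k)]. *)
exists m, a, (fun i => res OW (b i) * c ^+ (n.+1 * k)); split=> //.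
rewrite res_id; transitivity (res OW (t ^+ k) * c ^+ (n.+1 * k)).
  have -> : res OW (t ^+ k) = res h (res DW t) ^+ k by rewrite (res_comp _ _ OW) rmorphXn.
  rewrite -et rmorphM rmorphXn exprMn -exprM -mulrA -exprMn hc expr1n mulr1.
  by rewrite (res_comp _ _ hU).
rewrite et' rmorph_sum mulr_suml; apply: eq_bigr => i _.
by rewrite rmorphM -mulrA /= (res_comp _ _ OV).
Qed.

Lemma red_preimage_subvariety : subvariety (red (scheme_preimage f I)).
Proof.
split; first split.
- split.
  + move=> U; have [h0 hD hM] := vanishing_ideal T U; split.
    * exact/red_preimageP.
    * by move=> a b /red_preimageP ha /red_preimageP hb; apply/red_preimageP/hD.
    * by move=> a b /red_preimageP hb; apply/red_preimageP/hM.
  + by move=> U V h s /red_preimageP hs; apply/red_preimageP/vanishing_res.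
  + move=> U s hs; apply/red_preimageP => y Uy Ty us.
    have [W [h [Wy /red_preimageP hr]]] := hs y Uy.
    by apply: (hr y Wy Ty); apply/unit_at_res.
- move=> y; have [V [W [Wy hW aV aW]]] := hloc y.
  exists W; split=> // e D hD De s /red_preimageP vs.
  have [n hn] := vanishing_extend hD aW De vs; have [t [vt et]] := hn n.+1 (ltnSn n).
  by exists t, n.+1; split=> //; apply/red_preimageP.
- move=> U s n /red_preimageP hs; apply/red_preimageP => y Uy Ty us.
  by apply: (hs y Uy Ty); apply: unit_atX.
Qed.
End ReducedPreimage.
End ZeroLocus.

(** * A uniform bound on the number of generators *)

Section FiniteBound.

Definition generated_by (n : nat) (A B : comPzRingType) (g : A -> B) : Prop :=
  exists b : 'I_n -> B, forall s, exists c : 'I_n -> A,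
    s = \sum_(i < n) g (c i) * b i.

Definition finite_near (X Y : scheme) (f : morphism Y X) (N : nat) (x : X) : Prop :=
  exists (V : opens X) (n : nat), [/\ oset V x, affine V, affine (pre f V), (n <= N)%N &
    generated_by n (sharp f V)].

(** Quasi-compactness of the finitely many charts: the [a] with a bound on D(a) form an ideal, and
    no prime contains it, because [finite_morphism] provides a bound near the corresponding
    point. *)
Lemma finite_bound (X Y : scheme) (f : morphism Y X) :
  finite_type_Z X -> finite_morphism f -> exists N, forall x, finite_near f N x.
Proof.
move=> [m [U [covU aU]]] ff.
have mono N N' x : (N <= N')%N -> finite_near f N x -> finite_near f N' x.
  move=> NN [V [n [Vx aV aW nN g]]]; exists V, n; split=> //; exact: leq_trans NN.
have /choice [N hN] : forall i, exists N, forall x, oset (U i) x -> finite_near f N x.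
  move=> i; have [A [h [th ch]] _] := aU i.
  pose J : set A := [set a | exists N, forall x, oset (basic ch a) x -> finite_near f N x].
  have iJ : is_ideal J.
    split.
    - by exists 0%N => x [Ux]; have [[H _ _] _ _] := chart_prime ch Ux.
    - move=> a b [N ha] [N' hb]; exists (maxn N N') => x [Ux hx].
      have [[_ HD _] _ _] := chart_prime ch Ux.
      case: (pselect (h x a)) => [xa|xa]; last first.
        by apply: (mono N); [exact: leq_maxl|apply: ha].
      apply: (mono N'); [exact: leq_maxr|apply: hb]; split=> // xb.
      by apply: hx; apply: HD.
    - by move=> a b [N hb]; exists N => x /basic_mul [_ xb]; apply: hb.
  suff [N hN] : J 1 by exists N => x Ux; apply: hN; split=> //; case: (chart_prime ch Ux).
  apply: contrapT => nJ; have hJ n : ~ J (1 ^+ n) by rewrite expr1n.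
  have [P [pP JP _]] := prime_avoiding iJ hJ.
  have [y Uy hy] := chart_surj ch pP.
  have [V [Vy aV aW [n [b hb]]]] := ff y.
  have [e [ey eV]] := chart_basis ch Uy Vy.
  case: ey => _; apply; rewrite hy; apply: JP; exists n => x /eV Vx.
  by exists V, n; split=> //; exists b.
exists (\max_i N i) => x; have [i Ux] := covU x.
by apply: (mono (N i)); [exact: leq_bigmax|apply: hN].
Qed.

End FiniteBound.

(** * Charts of the reduction modulo p and the global statement *)

Section LocalCharts.

Definition finite_chart (X Y : scheme) (f : morphism Y X) (N : nat) (y : Y) : Prop :=
  exists (V : opens X) (W : opens Y) (hW : W `<=` pre f V) (n : nat),
    [/\ oset W y, affine V, affine W, (n <= N)%N & generated_by n (chart_map hW)].

(** By [modp_surj] the sections over the reduced chart come from sections over [pre f V], so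
    generators for [f] restrict to generators for [fp]. The bound [N] is thus the same for all
    [p]. *)
Lemma modp_finite_chart (p N : nat) (X Y Xp Yp : scheme) (f : morphism Y X)
  (iX : morphism Xp X) (iY : morphism Yp Y) (fp : morphism Yp Xp) :
  modp_immersion p (sharp iX) -> modp_immersion p (sharp iY) ->
  mor_eq (mor_comp iX fp) (mor_comp f iY) ->
  (forall x, finite_near f N x) -> forall y, finite_chart fp N y.
Proof.
move=> immX immY sq fin y.
have sq1 z : iX (fp z) = f (iY z) by case: sq => + _; apply.
have [V [n [Vy [A [hA [thA chA]]] [B [hB [thB chB]]] nN [b hb]]]] := fin (iX (fp y)).
have hW : pre iY (pre f V) `<=` pre fp (pre iX V).
  by move=> z Vz; have : oset V (f (iY z)) := Vz; rewrite -sq1.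
exists (pre iX V), (pre iY (pre f V)), hW, n; split=> //.
- by have : oset V (iX (fp y)) := Vy; rewrite sq1.
- by eexists; apply: (modp_spec_on immX chA).
- by eexists; apply: (modp_spec_on immY chB).
exists (fun i => sharp iY (pre f V) (b i)) => s.
have [a <-] := modp_surj immY chB s.
have [c hc] := hb (thB a); exists (fun i => sharp iX V (c i)).
rewrite /modp_map /= hc rmorph_sum; apply: eq_bigr => i _; rewrite rmorphM; congr (_ * _).
apply: sec_eq => z Vz; apply/germ_eq_sym/germ_eq_resl => //.
have Vz' : oset V (mor_comp iX fp z) := hW z Vz.
have g1 := mor_comp_germ_eq (g := iX) (f := fp) (c i) Vz'.
have g2 := mor_eq_germ_eq sq (c i) Vz'.
have g3 := mor_comp_germ_eq (g := f) (f := iY) (c i) (Vz : oset V (f (iY z))).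
exact: germ_eq_trans (germ_eq_sym g1) (germ_eq_trans g2 g3).
Qed.

Lemma frobenius_ring_splitting (p : nat) (X : scheme) (phi : sheaf_endo X) (U : opens X) :
  frobenius_splitting p phi -> ring_splitting p (phi U).
Proof. by case=> _ hD hM h1; split=> *; [apply: hD|apply: hM|apply: h1]. Qed.

Lemma red_preimage_stable (p N : nat) (X Y : scheme) (f : morphism Y X)
  (phi : sheaf_endo X) (psi : sheaf_endo Y) (I : subsheaf X) :
  prime p -> (N < p)%N -> p%:R = 0 :> sec (whole X) ->
  (forall y, finite_chart f N y) ->
  frobenius_splitting p phi -> frobenius_splitting p psi -> compatible f psi phi ->
  compatibly_split phi I -> compatibly_split psi (red (scheme_preimage f I)).
Proof.
move=> pp Np pX fin hphi hpsi cmp [hI Iphi].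
have hloc y : exists (V : opens X) (W : opens Y),
    [/\ oset W y, W `<=` pre f V, affine V & affine W].
  by have [V [W [hW [n [Wy aV aW _ _]]]]] := fin y; exists V, W.
split; first exact: red_preimage_subvariety.
move=> U s /(red_preimageP hI hloc) vs; apply/(red_preimageP hI hloc) => y Uy Ty us.
have [V [W [hW [n [Wy aV aW nN [b hb]]]]]] := fin y.
have [res_psi _ Mpsi _] := hpsi; have [res_phi _ _ _] := hphi.
have [e [D [ey DU DW hD]]] := affine_basis aW Wy Uy.
have [k hk] := vanishing_extend DW aW hD (vanishing_res (h := DU) vs).
(* The exponent of [e] used to extend [s] is a multiple of [p], so that on [D] the map [psi]
   releases [e ^+ k.+1] and [psi t] is a unit multiple of [psi s] at [y]. *)
have km : (k < p * k.+1)%N.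
  by rewrite (leq_trans (ltnSn k)) // leq_pmull // prime_gt0.
have [t [vt et]] := hk _ km.
have Dy : oset D y by apply/hD.
have Wpsi : forall a, psi W (chart_map hW a) = chart_map hW (phi V a).
  by move=> a; rewrite /chart_map /= -cmp res_psi.
have pV : p%:R = 0 :> sec V by apply: char0_sec.
have [iI _ _] := hI.1.1.
(* [Q] is here the prime of sections over [W] that are non-units at [y]. *)
have := splitting_radical hb pp (leq_ltn_trans nN Np) pV
  (frobenius_ring_splitting V hphi) (frobenius_ring_splitting W hpsi) Wpsi (iI V)
  (fun a => Iphi V a) (nonunit_prime Wy) (preimage_prime (hW := hW) Wy Ty)
  (fun P pP => vanishing_prime (hW := hW) hI aV aW vt pP).
apply => //=.
apply/(unit_at_res DW (psi W t) Dy).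
rewrite -res_psi -et mulnC exprM mulrC Mpsi res_psi; apply/unit_atM; split.
  by apply: unit_atX; apply/unit_at_res.
exact/unit_at_res.
Qed.

End LocalCharts.

Theorem theorem3 (X Y : scheme) (alpha : morphism Y X)
    (hX : finite_type_Z X) (hY : finite_type_Z Y)
    (halpha : finite_morphism alpha) :
  exists N : nat, (0 < N)%N /\
  forall p : nat, prime p -> (N < p)%N ->
  forall (* Spec F_p *) (Sp : scheme) (hSp : is_spec Sp 'F_p)
    (* X(p) = X x Spec F_p and Y(p) = Y x Spec F_p *)
    (Xp : scheme) (iX : morphism Xp X) (qX : morphism Xp Sp)
    (hXp : is_product iX qX)
    (Yp : scheme) (iY : morphism Yp Y) (qY : morphism Yp Sp)
    (hYp : is_product iY qY)
    (* alpha_p = alpha x Spec F_p *)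
    (alphap : morphism Yp Xp)
    (halphap : mor_eq (mor_comp iX alphap) (mor_comp alpha iY))
    (halphap' : mor_eq (mor_comp qX alphap) qY)
    (phi : sheaf_endo Xp) (psi : sheaf_endo Yp)
    (hphi : frobenius_splitting p phi) (hpsi : frobenius_splitting p psi)
    (hcompat : compatible alphap psi phi)
    (V : subsheaf Xp) (hV : compatibly_split phi V),
  compatibly_split psi (red (scheme_preimage alphap V)).
Proof.
(* The successor makes the bound positive. *)
have [N hN] := finite_bound hX halpha; exists N.+1; split=> // p pp Np.
move=> Sp hSp Xp iX qX hXp Yp iY qY hYp alphap sq _ phi psi hphi hpsi hcompat V hV.
have immX := product_modp pp hSp hXp; have immY := product_modp pp hSp hYp.
have fin := modp_finite_chart immX immY sq hN.
exact: (red_preimage_stable pp (ltnW Np) (imm_char immX) fin hphi hpsi hcompat hV).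
Qed.
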